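(* Let $(Y_t)_{t\in\mathbb Z}$ be a stationary $\mathbb R^d$-valued process and $(\varepsilon_t)_{t\in\mathbb Z}$ a sequence of i.i.d. real random variables, independent of $(Y_t)_{t\in\mathbb Z}$, with $\mathbb E\varepsilon_0=0$, $\mathbb E\varepsilon_0^2=1$. Let $X_0=x\in\mathbb R$ and $$X_t=r(Y_{t-1},X_{t-1})+\varepsilon_t\,\sigma(Y_{t-1},X_{t-1}),\qquad t\ge1,$$ where $r:\mathbb R^d\times\mathbb R\to\mathbb R$ and $\sigma:\mathbb R^d\times\mathbb R\to\mathbb R_+$ are measurable and satisfy, for all $(y,x)\in\mathbb R^d\times\mathbb R$, $|r(y,x)|\le a(y)|x|+b(y)$ and $|\sigma(y,x)|\le c(y)|x|+d(y)$ for some measurable $a,b,c,d:\mathbb R^d\to\mathbb R_+$. Set $\gamma(y)=a(y)+c(y)$ and $K(y)=b(y)+d(y)$. Suppose that $\alpha^Y(m)=O(m^{-a_0})$ for some $a_0>0$, that the distribution of $\varepsilon_0$ has a density with respect to Lebesgue measure which is lower bounded by a positive constant on any compact interval, and that $\inf_{|x|\le R}\sigma(y,x)>0$ for any $R>0$ and $y\in\mathbb R^d$. 1. Suppose that there exists $\gamma_+\in(0,1)$ such that $\gamma(Y_0)\le\gamma_+$ a.s. and that $\mathbb E K(Y_0)<\infty$. Then the process $((X_t,Y_t))_{t\geq 0}$ is $\alpha$-mixing with $\alpha^{X,Y}(m)=O\big((\log m)^{a_0}m^{-a_0}\big)$. 2. Suppose that $\gamma(Y_0)\in[0,1]$ a.s.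 with $\mathbb P(\gamma(Y_0)<1)>0$ and that $\mathbb E[K(Y_0)^k]<\infty$ for some $k>1$. Then, if $b_0:=a_0(k-1)/k>1$, the process $((X_t,Y_t))_{t\geq 0}$ is $\alpha$-mixing with $\alpha^{X,Y}(m)=O\big((\log m)^{2b_0-1}m^{-b_0+1}\big)$.
   Context: For sub-$\sigma$-algebras, $\alpha(\mathcal G,\mathcal H)=\sup\{|\mathbb P(G\cap H)-\mathbb P(G)\mathbb P(H)|:G\in\mathcal G,H\in\mathcal H\}$. For a process $W=(W_t)_{t\in I}$, $\mathcal F^W_{t,s}=\sigma(W_k:k\in I,t\le k\le s)$ (trivial if the index set is empty) and $\alpha^W(n)=\sup_{j\in\mathbb Z}\alpha(\mathcal F^W_{-\infty,j},\mathcal F^W_{j+n,\infty})$. $W$ is $\alpha$-mixing if $\alpha^W(n)\to0$. $\alpha^{X,Y}$ denotes the coefficients of $((X_t,Y_t))_{t\ge0}$. *)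

(* Defs.v *)
From HB Require Import structures.
From mathcomp Require Import all_boot all_order all_algebra.
From mathcomp Require Import all_classical all_reals all_analysis.
Set Implicit Arguments.
Unset Strict Implicit.
Unset Printing Implicit Defensive.
Import Order.TTheory GRing.Theory Num.Theory.
Import numFieldNormedType.Exports.
Local Open Scope classical_set_scope.
Local Open Scope ring_scope.

(* R^n is [n.-tuple R] with the library's product sigma-algebra, i.e. the
   Borel sigma-algebra. *)

(* A process (W_t)_{t in I}, I a subset of Z, is a function W on int together
   with the set I; the values of W outside I are never used. *)
Section processes.
Context d d' (T : measurableType d) (V : measurableType d').

(* sigma(W_k : k in I, k in J); for J = `[t, s], `]-oo, s], `[t, +oo[ this is
   the sigma-algebra F^W_{t,s} of the process, with t, s possibly infinite.
   It is {set0, setT} when no index of I lies in J. *)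
Definition sigma_process (I : set int) (W : int -> T -> V)
    (J : interval int) : set_system T :=
  <<s \bigcup_(k in [set k | I k /\ k \in J])
        preimage_set_system setT (W k) measurable >>.

End processes.

Section dependence.
Context d d' (T : measurableType d) (V : measurableType d') (R : realType).
Variable P : probability T R.

(* The suprema below are over nonempty subsets of [0, 1], so that the
   real-valued [sup] is the genuine supremum. *)
Definition alpha_coef (G H : set_system T) : R :=
  sup [set x | exists A B, [/\ G A, H B &
    x = `|fine (P (A `&` B)) - fine (P A) * fine (P B)|]].

Definition alpha_process (I : set int) (W : int -> T -> V) (n : nat) : R :=
  sup [set alpha_coef (sigma_process I W `]-oo, j])
                      (sigma_process I W `[(j + n%:Z)%R, +oo[) | j in setT].

Definition alpha_mixing (I : set int) (W : int -> T -> V) : Prop :=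
  alpha_process I W n @[n --> \oo] --> (0 : R).

Definition independent_systems (G H : set_system T) : Prop :=
  forall A B, G A -> H B -> (P (A `&` B) = P A * P B)%E.

Definition stationary (W : int -> T -> V) : Prop :=
  forall (n : nat) (t : 'I_n -> int) (h : int) (A : set (n.-tuple V)),
    measurable A ->
    P [set w | A [tuple W (t i + h) w | i < n]] =
    P [set w | A [tuple W (t i) w | i < n]].

Definition mutually_independent (W : int -> T -> V) : Prop :=
  forall (J : seq int) (A : int -> set V), uniq J ->
    (forall j, measurable (A j)) ->
    P (\bigcap_(j in [set` J]) W j @^-1` A j) =
    (\prod_(j <- J) P (W j @^-1` A j))%E.

Definition identically_distributed (W : int -> T -> V) : Prop :=
  forall (s t : int) (A : set V), measurable A ->
    P (W s @^-1` A) = P (W t @^-1` A).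

Definition iid (W : int -> T -> V) : Prop :=
  mutually_independent W /\ identically_distributed W.

End dependence.

Definition has_density d (T : measurableType d) (R : realType)
    (P : probability T R) (X : {RV P >-> R}) (f : R -> R) : Prop :=
  [/\ measurable_fun setT f, (forall u, 0 <= f u) &
      forall A, measurable A ->
        distribution P X A = (\int[lebesgue_measure]_(u in A) (f u)%:E)%E].

(* Main.v *)
Require Import Defs.
From HB Require Import structures.
From mathcomp Require Import all_boot all_order all_algebra.
From mathcomp Require Import all_classical all_reals all_analysis.
From mathcomp Require Import measurable_realfun.
From mathcomp Require Import ring lra.
Import Order.TTheory GRing.Theory Num.Theory.
Import numFieldNormedType.Exports.
Set Implicit Arguments.
Unset Strict Implicit.
Unset Printing Implicit Defensive.
Local Open Scope classical_set_scope.
Local Open Scope ring_scope.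

(* Conditionally on the environment Y, the process X is a time-inhomogeneous
   Markov chain.  Two copies of it, one started at time 0 and one restarted at
   x in the middle of a gap, are compared block by block.  During the first m
   steps of a block the random product of the gamma(Y_i) brings the states back
   to a fixed ball; at the last step, if Y lies in a good set on which sigma is
   bounded below on that ball, the density of the noise makes the transition
   kernel dominate eta times the uniform law on [0, 1], so that the distance
   between the two laws contracts by a factor 1 - eta / 4 up to the mixing
   coefficient alpha^Y(m) and the moments of the random products.  Choosing
   about log n blocks of length about n / log n gives the rates.

   The infimum of sigma over a ball need not be a measurable function of y; a
   capacitability argument for Suslin sets shows that it is bounded below by a
   positive constant off a measurable set of small probability. *)

(** No coupling space is built. Laws are compared by duality: [close] is an inequality between
    integrals of test functions that may look at all of Y and at the noise after time N, with an
    error that depends on the environment. The obstacle is that the contraction over a block depends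
    on Y, so successive factors are not independent. Each block therefore opens with m idle steps:
    the error accumulated before them is a function of earlier Y, the contraction rate a function of
    later Y, and two [0,1]-valued functions m steps apart have covariance at most alpha^Y(m). As the
    mean rate is bounded below, these errors sum as a geometric series, whatever the number of
    blocks.

    The second chain restarts from the state 0 and uses Y and noise from its starting time on only.
    Substituting it for X in a future event gives an event nearly independent of the past, because
    independent noise does not increase the mixing coefficient. What remains is to bound the means
    of products of gamma(Y_i) and of K(Y_u) times such a product; the latter are summed over lags,
    which costs one power of m in the second case. *)

(** * Sub-sigma-algebras and independence *)

(* T with the sigma-algebra generated by G as its structure, so that a function
   f : sub_sigma G -> U is measurable iff f is G-measurable on T. *)
Definition sub_sigma d (T : measurableType d) (G : set_system T) :
  measurableType (sigma_display G) := g_sigma_algebraType G.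

Section sub_sigma_algebras.
Context d (T : measurableType d) (R : realType) (P : probability T R).
Implicit Types G H : set_system T.

Local Notation gT := (@sub_sigma _ T).

Lemma measurable_fun_idg G H : G `<=` <<s H >> ->
  measurable_fun setT (idfun : gT H -> gT G).
Proof.
move=> GH _ A mA; rewrite setTI preimage_id.
by apply: (smallest_sub (smallest_sigma_algebra _ _) GH).
Qed.

Lemma measurable_fun_idT G : G `<=` measurable ->
  measurable_fun setT (idfun : T -> gT G).
Proof.
move=> GM _ A mA; rewrite setTI preimage_id.
exact: (smallest_sub (sigma_algebra_measurable T) GM).
Qed.

Lemma measurable_fun_sub G H d' (U : measurableType d') (f : T -> U) :
  G `<=` <<s H >> ->
  measurable_fun setT (f : gT G -> U) -> measurable_fun setT (f : gT H -> U).
Proof.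
by move=> GH mf; exact: (measurableT_comp mf (measurable_fun_idg GH)).
Qed.

Lemma measurable_fun_subT G d' (U : measurableType d') (f : T -> U) :
  G `<=` measurable ->
  measurable_fun setT (f : gT G -> U) -> measurable_fun setT f.
Proof.
by move=> GH mf; exact: (measurableT_comp mf (measurable_fun_idT GH)).
Qed.

Lemma measurable_fun_genP G d' (U : measurableType d') (f : T -> U) :
  measurable_fun setT (f : gT G -> U) <->
  preimage_set_system setT f measurable `<=` <<s G >>.
Proof.
split=> [mf _ [B mB <-]|fG _ B mB]; first exact: mf.
by apply: fG; exists B.
Qed.

(** By independence the diagonal map into (T, G) x (T, H) pushes P to a product measure, as is
    checked on rectangles; Tonelli's theorem then separates the two occurrences of w. *)
Lemma integral_freeze G H (F : gT G * gT H -> \bar R) :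
  G `<=` measurable -> H `<=` measurable ->
  independent_systems P <<s G >> <<s H >> ->
  measurable_fun setT F -> (forall z, 0 <= F z)%E ->
  (\int[P]_w F (w, w) = \int[P]_w \int[P]_w' F (w, w'))%E.
Proof.
move=> GM HM GH mF F0.
pose iG : {mfun T >-> gT G} :=
  HB.pack_for {mfun T >-> gT G} (idfun : T -> gT G)
    (isMeasurableFun.Build _ _ _ _ _ (measurable_fun_idT GM)).
pose iH : {mfun T >-> gT H} :=
  HB.pack_for {mfun T >-> gT H} (idfun : T -> gT H)
    (isMeasurableFun.Build _ _ _ _ _ (measurable_fun_idT HM)).
have mD : measurable_fun setT (fun w : T => (iG w, iH w)).
  by apply/measurable_fun_pairP; split; exact: measurable_funPT.
pose iD : {mfun T >-> (gT G * gT H)%type} :=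
  HB.pack_for {mfun T >-> (gT G * gT H)%type} (fun w : T => (iG w, iH w))
    (isMeasurableFun.Build _ _ _ _ _ mD).
have PE A : measurable A ->
    (distribution P iG \x distribution P iH)%E A = distribution P iD A.
  apply: product_measure_unique => /= B C mB mC.
  rewrite /distribution /= /pushforward /= preimage_id preimage_id.
  rewrite -(GH _ _ mB mC); congr (P _).
transitivity (\int[distribution P iD]_z F z)%E.
  by rewrite ge0_integral_distribution.
rewrite (eq_measure_integral (distribution P iG \x distribution P iH)%E);
  last by move=> A mA _; exact: (esym (PE _ mA)).
rewrite fubini_tonelli1// ge0_integral_distribution//=; last 2 first.
- exact: measurable_fun_fubini_tonelli_F.
- by move=> w; exact: integral_ge0.
apply: eq_integral => w _ /=.
rewrite /fubini_F ge0_integral_distribution//.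
by apply: measurableT_comp => //; exact: pair1_measurable.
Qed.

End sub_sigma_algebras.

Lemma measurable_set_lt d (T : measurableType d) (R : realType) (f g : T -> R) :
  measurable_fun setT f -> measurable_fun setT g -> measurable [set w | f w < g w].
Proof.
by move=> mf mg; have := measurable_fun_ltr mf mg measurableT (Y := [set true]) I;
  rewrite setTI.
Qed.

Lemma measurable_set_le d (T : measurableType d) (R : realType) (f g : T -> R) :
  measurable_fun setT f -> measurable_fun setT g -> measurable [set w | f w <= g w].
Proof.
by move=> mf mg; have := measurable_fun_ler mf mg measurableT (Y := [set true]) I;
  rewrite setTI.
Qed.

(** Kept as a bare generating family for an arbitrary index set, so that the join of two such
    sigma-algebras is generated by a plain union. *)
Definition generators d (T : measurableType d) d' (V : measurableType d')
    (W : int -> T -> V) (J : set int) : set_system T :=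
  \bigcup_(k in J) preimage_set_system setT (W k) measurable.

Section independence.
Context d (T : measurableType d) (R : realType) (P : probability T R).
Implicit Types G H : set_system T.

Lemma generators_sub_measurable d' (V : measurableType d') (W : int -> T -> V)
    (J : set int) : (forall k, measurable_fun setT (W k)) ->
  generators W J `<=` measurable.
Proof. by move=> mW A [k _ [B mB <-]]; exact: mW. Qed.

Lemma generatorsS d' (V : measurableType d') (W : int -> T -> V)
    (J K : set int) : J `<=` K -> generators W J `<=` generators W K.
Proof. by move=> JK A [k Jk WA]; exists k => //; exact: JK. Qed.

Lemma independent_systemsC G H :
  independent_systems P G H -> independent_systems P H G.
Proof. by move=> GH A B HA GB; rewrite setIC muleC; exact: GH. Qed.

(** Dynkin's argument: for fixed B, the sets A independent of B form a lambda-system that contains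
    the pi-system G. *)
Lemma independent_setI_closed G H :
  G `<=` measurable -> H `<=` measurable -> setI_closed G ->
  independent_systems P G H -> independent_systems P <<s G >> H.
Proof.
move=> GM HM GI GH A B sA HB.
pose L := [set A : set T | measurable A /\ (P (A `&` B) = P A * P B)%E].
suff : <<s G >> `<=` L by move=> /(_ _ sA)[].
have mB := HM _ HB.
have fin E : measurable E -> P E \is a fin_num by exact: fin_num_measure.
apply: lambda_system_subset => //; last first.
  by move=> C GC; split; [exact: GM|exact: GH].
split => //.
- by split => //; rewrite setTI probability_setT mul1e.
- move=> C D CD [mC PC] [mD PD]; split; first exact: measurableD.
  have DC E : measurable E -> (P (E `&` C) = P (E `&` D) + P (E `&` (C `\` D)))%E.
    move=> mE; rewrite -measureU//; last 3 first.
    - exact: measurableI.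
    - by apply: measurableI => //; exact: measurableD.
    - by apply/seteqP; split => [x /= [[_ Dx] [_ [_ nDx]]]|x].
    congr (P _); rewrite -setIUr; congr (_ `&` _).
    by rewrite setDE setUIr setUv setIT; apply/esym/setUidPr.
  have := DC _ mB; rewrite !(setIC B) PC PD.
  have := DC _ measurableT; rewrite !setTI => ->.
  rewrite muleDl ?fin_num_adde_defr ?fin//.
  have fDB : (P D * P B)%E \is a fin_num by rewrite fin_numM ?fin.
  move=> h; rewrite -[LHS](addeK _ fDB) -[RHS](addeK _ fDB).
  by congr (_ - _)%E; rewrite addeC -h addeC.
- move=> F ndF FL; split.
    by apply: bigcupT_measurable => n; have [] := FL n.
  have mF n : measurable (F n) by have [] := FL n.
  have c1 : P (F n `&` B) @[n --> \oo] --> P (\bigcup_n F n `&` B).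
    rewrite setI_bigcupl; apply: nondecreasing_cvg_mu.
    - by move=> n; exact: measurableI.
    - by apply: bigcup_measurable => n _; exact: measurableI.
    - by move=> m n mn; apply/subsetPset; apply: setSI; apply/subsetPset/ndF.
  have c2 : P (F n `&` B) @[n --> \oo] --> (P (\bigcup_n F n) * P B)%E.
    under eq_fun do rewrite (FL _).2.
    apply: cvgeZr; first exact: fin.
    by apply: nondecreasing_cvg_mu => //; exact: bigcupT_measurable.
  exact: cvg_unique c1 c2.
Qed.

Lemma independent_generated G H :
  G `<=` measurable -> H `<=` measurable -> setI_closed G -> setI_closed H ->
  independent_systems P G H -> independent_systems P <<s G >> <<s H >>.
Proof.
move=> GM HM GI HI GH; apply: independent_setI_closed => //.
  exact: (smallest_sub (sigma_algebra_measurable T) HM).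
apply/independent_systemsC/independent_setI_closed => //.
exact: independent_systemsC.
Qed.

Section mutual.
Context d' (V : measurableType d') (W : int -> T -> V).
Hypothesis mW : forall k, measurable_fun setT (W k).
Hypothesis indW : mutually_independent P W.

(** A pi-system for the coordinates in J, in the shape to which [mutually_independent] applies. *)
Definition cylinders (J : set int) : set_system T :=
  [set A | exists s (B : int -> set V), [/\ uniq s, [set` s] `<=` J,
    forall j, measurable (B j) & A = \bigcap_(j in [set` s]) W j @^-1` B j]].

Lemma setI_closed_cylinders J : setI_closed (cylinders J).
Proof.
move=> _ _ [s1 [B1 [u1 s1J mB1 ->]]] [s2 [B2 [u2 s2J mB2 ->]]].
exists (undup (s1 ++ s2)), (fun j => (if j \in s1 then B1 j else setT) `&`
  (if j \in s2 then B2 j else setT)); split.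
- exact: undup_uniq.
- move=> j /=; rewrite mem_undup mem_cat => /orP[?|?]; [exact: s1J|exact: s2J].
- by move=> j; apply: measurableI; case: ifP.
- apply/seteqP; split => [w [h1 h2] j|w h].
    by move=> _; split; case: ifPn => // ?; [exact: h1|exact: h2].
  split=> j js; have /= := h j; rewrite mem_undup mem_cat js ?orbT => /(_ isT);
  by case=> //.
Qed.

Lemma measurable_cylinders J : cylinders J `<=` measurable.
Proof.
move=> _ [s [B [_ _ mB ->]]]; apply: fin_bigcap_measurable => //.
by move=> j _; rewrite -[X in measurable X]setTI; exact: mW.
Qed.

Lemma generators_cylinders J : <<s generators W J >> `<=` <<s cylinders J >>.
Proof.
apply: smallest_sub; first exact: smallest_sigma_algebra.
move=> _ [k Jk [B mB <-]]; apply: sub_gen_smallest.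
exists [:: k], (fun=> B); split => //.
  by move=> j /=; rewrite inE => /eqP ->.
rewrite setTI; apply/seteqP; split => [w Bw j /=|w /(_ k)]; last first.
    by apply; rewrite /= mem_head.
  by rewrite inE => /eqP ->.
Qed.

Lemma independent_generators (J K : set int) : J `&` K = set0 ->
  independent_systems P <<s generators W J >> <<s generators W K >>.
Proof.
move=> JK A B /generators_cylinders sA /generators_cylinders sB.
apply: (independent_generated (measurable_cylinders (J := J))
  (measurable_cylinders (J := K))) sA sB; try exact: setI_closed_cylinders.
move=> {A B} _ _ [s1 [B1 [u1 s1J mB1 ->]]] [s2 [B2 [u2 s2J mB2 ->]]].
have s12 j : j \in s1 -> j \notin s2.
  move=> j1; apply/negP => j2; have : (J `&` K) j by split; [exact: s1J|exact: s2J].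
  by rewrite JK.
(* The index lists are disjoint, so the two families of sets glue into one, and both cylinders and
   their intersection have product probabilities for it. *)
pose B j := if j \in s1 then B1 j else B2 j.
have u12 : uniq (s1 ++ s2).
  rewrite cat_uniq u1 u2 andbT /=; apply/hasPn => j j2.
  by apply/negP => /s12; rewrite j2.
have mB j : measurable (B j) by rewrite /B; case: ifP.
have E1 : \bigcap_(j in [set` s1]) W j @^-1` B1 j =
          \bigcap_(j in [set` s1]) W j @^-1` B j.
  by apply: eq_bigcapr => j /= js; rewrite /B js.
have E2 : \bigcap_(j in [set` s2]) W j @^-1` B2 j =
          \bigcap_(j in [set` s2]) W j @^-1` B j.
  apply: eq_bigcapr => j /= js; rewrite /B ifF//.
  by apply/negP => /s12; rewrite js.
rewrite E1 E2 -bigcap_setU.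
have -> : [set` s1] `|` [set` s2] = [set` s1 ++ s2].
  apply/seteqP; split => j /=; rewrite mem_cat.
    by case=> ->; rewrite ?orbT.
  by move=> /orP[->|->]; [left|right].
by rewrite !indW// big_cat.
Qed.

End mutual.

Lemma setI_closed_sigma G : setI_closed <<s G >>.
Proof.
move=> A B sA sB.
exact: (@measurableI _ (sub_sigma G) A B sA sB).
Qed.

(** The intersections of a set of <<s G >> with one of <<s H1 >> form a pi-system generating the
    join. On it G is split off first, then H1 from H2. It is meant for G the environment and H1, H2
    the noise at disjoint times. *)
Lemma independent_join (G H1 H2 : set_system T) (GM : G `<=` measurable)
    (HM1 : H1 `<=` measurable) (HM2 : H2 `<=` measurable) :
  independent_systems P <<s H1 >> <<s H2 >> ->
  independent_systems P <<s H1 `|` H2 >> <<s G >> ->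
  independent_systems P <<s G `|` H1 >> <<s H2 >>.
Proof.
move=> H12 HG.
have sM (K : set_system T) : K `<=` measurable -> <<s K >> `<=` (measurable : set_system T).
  by move=> KM; exact: (smallest_sub (sigma_algebra_measurable T) KM).
pose C := [set A `&` B | A in <<s G >> & B in <<s H1 >>].
have sC : <<s G `|` H1 >> `<=` <<s C >>.
  apply: smallest_sub; first exact: smallest_sigma_algebra.
  move=> A [GA|HA]; apply: sub_gen_smallest.
    exists A; first exact: sub_gen_smallest.
    by exists setT; [exact: (@measurableT _ (sub_sigma H1))|rewrite setIT].
  exists setT; first exact: (@measurableT _ (sub_sigma G)).
  by exists A; [exact: sub_gen_smallest|rewrite setTI].
move=> A B /sC sA sB; apply: independent_setI_closed sA sB.
- by move=> _ [A1 GA [B1 HB <-]]; apply: measurableI; [exact: (sM G)|exact: (sM H1)].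
- exact: sM.
- move=> _ _ [A1 GA1 [B1 HB1 <-]] [A2 GA2 [B2 HB2 <-]].
  exists (A1 `&` A2); first exact: setI_closed_sigma.
  exists (B1 `&` B2); first exact: setI_closed_sigma.
  by rewrite setIACA.
move=> {A B} _ B [A1 GA1 [B1 HB1 <-]] HB.
have HU1 : <<s H1 >> `<=` <<s H1 `|` H2 >>.
  by apply: sub_smallest2r; [exact: smallest_sigma_algebra|exact: subsetUl].
have HU2 : <<s H2 >> `<=` <<s H1 `|` H2 >>.
  by apply: sub_smallest2r; [exact: smallest_sigma_algebra|exact: subsetUr].
rewrite -setIA (setIC A1) HG//; last first.
  by apply: setI_closed_sigma; [exact: HU1|exact: HU2].
rewrite H12// (setIC A1) HG//; last exact: HU1.
by rewrite muleAC.
Qed.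

End independence.

(** * Covariances under mixing *)

Section level_sets.
Context d (T : measurableType d) (R : realType) (P : probability T R).

Lemma staircase (k : nat) (c : R) : 0 <= c <= k%:R ->
  c <= \sum_(i < k) (i%:R < c)%R%:R <= c + 1.
Proof.
move=> /andP[c0].
(* The induction on k would break the hypothesis c <= k; truncating both bounds at k gives a
   statement valid for every c >= 0. *)
suff: Num.min c k%:R <= \sum_(i < k) (i%:R < c)%R%:R <= Num.min k%:R (c + 1).
  move=> /andP[h1 h2] ck; rewrite (min_idPl ck) in h1.
  by rewrite h1 (le_trans h2)// ge_min lexx orbT.
elim: k => [|k /andP[IH1 IH2]].
  by rewrite big_ord0 ge_min lexx orbT le_min lexx addr_ge0.
rewrite big_ord_recr /=; case: (ltP k%:R c) => kc /=.
  rewrite (min_idPr (ltW kc)) in IH1.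
  have k1 : k.+1%:R = k%:R + 1 :> R by rewrite -natr1.
  move: IH2; rewrite !ge_min !le_min => /andP[IH2 IH3].
  rewrite k1; apply/andP; split; first by rewrite lerD2r IH1 orbT.
  by apply/andP; split; lra.
have k1 : k%:R <= k.+1%:R :> R by rewrite ler_nat.
rewrite (min_idPl kc) in IH1; rewrite addr0 (min_idPl (le_trans kc k1)) IH1 /=.
by move: IH2; rewrite !le_min => /andP[h1 ->]; rewrite andbT (le_trans h1).
Qed.

(** U lies within 1/k of the average of the indicators of its k level sets. The weights of an
    average sum to 1, so the error alpha of the hypothesis appears once. *)
Lemma integral_level_le (G : set_system T) (U xi : T -> R) (c alpha : R) :
  G `<=` measurable -> measurable_fun setT (U : sub_sigma G -> R) ->
  (forall w, 0 <= U w <= 1) ->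
  measurable_fun setT xi -> (forall w, 0 <= xi w) -> 0 <= c ->
  (forall A, <<s G >> A ->
    \int[P]_w (\1_A w * xi w)%:E <= P A * c%:E + alpha%:E)%E ->
  (\int[P]_w (U w * xi w)%:E <= (\int[P]_w (U w)%:E) * c%:E + alpha%:E)%E.
Proof.
move=> GM mU U01 mxi xi0 c0 hA.
have mUT : measurable_fun setT U by exact: measurable_fun_subT mU.
have U0 w : 0 <= U w by case/andP: (U01 w).
have U1 w : U w <= 1 by case/andP: (U01 w).
have iU : (\int[P]_w (U w)%:E <= 1)%E.
  rewrite -(@probability_setT _ _ _ P) -[leRHS]mul1e -integral_cst//.
  by apply: ge0_le_integral => //; [move=> w _; rewrite lee_fin|
    exact/measurable_EFinP|move=> w _; rewrite lee_fin].
have iU0 : (0 <= \int[P]_w (U w)%:E)%E.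
  by apply: integral_ge0 => w _; rewrite lee_fin.
apply/lee_addgt0Pr => e e0.
(* The discretization costs c / k, which this choice makes at most e. *)
pose k := (Num.trunc (c / e)).+1.
have ke : c / e < k%:R by rewrite /k truncnS_gt.
pose A (i : 'I_k) : set T := [set w | i%:R < k%:R * U w].
have k0 : (0 : R) < k%:R by rewrite ltr0n.
have kE : k%:R^-1 * k%:R = 1 :> R by rewrite mulVf// gt_eqF.
have ki0 : 0 <= k%:R^-1 :> R by rewrite invr_ge0 ltW.
have sA i : <<s G >> (A i).
  have -> : A i = U @^-1` `]i%:R / k%:R, +oo[.
    by apply/seteqP; split => w; rewrite /A /= in_itv /= andbT
      ltr_pdivrMr// mulrC.
  have := mU measurableT `]i%:R / k%:R, +oo[%classic (measurable_itv _).
  by rewrite setTI.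
have mA i : measurable (A i).
  exact: (smallest_sub (sigma_algebra_measurable T) GM).
have step w : U w <= \sum_(i < k) k%:R^-1 * \1_(A i) w <= U w + k%:R^-1.
  have : 0 <= k%:R * U w <= k%:R.
    by rewrite mulr_ge0//= ger_pMr.
  move=> /staircase; rewrite -mulr_sumr.
  have -> : \sum_(i < k) (i%:R < k%:R * U w)%R%:R =
            \sum_(i < k) \1_(A i) w :> R.
    apply: eq_bigr => i _; rewrite indicE; congr (_%:R); congr nat_of_bool.
    by apply/idP/idP => [h|/set_mem//]; exact/mem_set.
  move=> /andP[h1 h2]; apply/andP; split.
    by rewrite (le_trans _ (ler_wpM2l ki0 h1))// mulrA kE mul1r.
  have -> : U w + k%:R^-1 = k%:R^-1 * (k%:R * U w + 1) by field; rewrite gt_eqF.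
  exact: ler_wpM2l.
have m1 i : measurable_fun setT (fun w => k%:R^-1 * \1_(A i) w : R).
  exact: measurable_funM.
apply: (@le_trans _ _ (\int[P]_w (\sum_(i < k) ((k%:R^-1 * \1_(A i) w) * xi w)%:E))%E).
  apply: ge0_le_integral => //.
  - by move=> w _; rewrite lee_fin mulr_ge0.
  - by apply/measurable_EFinP; exact: measurable_funM.
  - by apply: emeasurable_sum => i; apply/measurable_EFinP; exact: measurable_funM.
  - move=> w _; rewrite sumEFin lee_fin -mulr_suml ler_wpM2r//.
    by case/andP: (step w).
rewrite ge0_integral_sum//; last 2 first.
- by move=> i; apply/measurable_EFinP; exact: measurable_funM.
- by move=> i w _; rewrite lee_fin !mulr_ge0// invr_ge0 ltW.
apply: (@le_trans _ _ (\sum_(i < k) (k%:R^-1)%:E * (P (A i) * c%:E + alpha%:E))%E).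
  apply: lee_sum => i _.
  under eq_integral do rewrite -mulrA EFinM.
  rewrite ge0_integralZl//; last 2 first.
  - by apply/measurable_EFinP; exact: measurable_funM.
  - by move=> w _; rewrite lee_fin mulr_ge0.
  by rewrite lee_pmul2l ?lte_fin ?invr_gt0//; exact: hA.
have sumA : (\sum_(i < k) (k%:R^-1)%:E * P (A i) <=
    \int[P]_w (U w)%:E + (k%:R^-1)%:E)%E.
  have -> : (\sum_(i < k) (k%:R^-1)%:E * P (A i) =
      \int[P]_w (\sum_(i < k) (k%:R^-1 * \1_(A i) w)%:E))%E.
    rewrite ge0_integral_sum//; last by move=> i; exact/measurable_EFinP.
    apply: eq_bigr => i _.
    under eq_integral do rewrite EFinM.
    rewrite ge0_integralZl//; last exact/measurable_EFinP.
    by rewrite integral_indic// setIT.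
  have -> : ((k%:R^-1)%:E = \int[P]_w (cst (k%:R^-1)%:E w) :> \bar R)%E.
    rewrite integral_cst//=. by rewrite probability_setT mule1.
  rewrite -ge0_integralD//; last 2 first.
  - by move=> w _; rewrite lee_fin.
  - exact/measurable_EFinP.
  apply: ge0_le_integral => //.
  - by move=> w _; apply: sume_ge0 => i _; rewrite lee_fin mulr_ge0// invr_ge0 ltW.
  - by apply: emeasurable_sum => i; exact/measurable_EFinP.
  - by apply: emeasurable_funD; [exact/measurable_EFinP|exact: measurable_cst].
  - by move=> w _; rewrite sumEFin -EFinD lee_fin; case/andP: (step w).
have finP i : P (A i) = (fine (P (A i)))%:E by rewrite fineK// fin_num_measure.
have [u uE] : exists u : R, (\int[P]_w (U w)%:E = u%:E)%E.
  exists (fine (\int[P]_w (U w)%:E)); rewrite fineK// ge0_fin_numE//.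
  by rewrite (le_lt_trans iU)// ltry.
rewrite uE; under eq_bigr do
  rewrite finP -[X in (X + _)%E]EFinM -[X in (_ * X)%E]EFinD -EFinM.
have {}sumA : \sum_(i < k) k%:R^-1 * fine (P (A i)) <= u + k%:R^-1.
  rewrite -lee_fin -sumEFin EFinD -uE (le_trans _ sumA)//.
  by apply: lee_sum => i _; rewrite EFinM -finP.
rewrite sumEFin -EFinM -!EFinD lee_fin.
under eq_bigr do rewrite mulrDr mulrA.
rewrite big_split /= -mulr_suml sumr_const card_ord -[(_ * alpha) *+ _]mulr_natl.
rewrite mulrA mulfV ?gt_eqF// mul1r.
have : (\sum_(i < k) k%:R^-1 * fine (P (A i))) * c <= (u + k%:R^-1) * c.
  exact: ler_wpM2r.
have : k%:R^-1 * c <= e.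
  by rewrite mulrC ler_pdivrMr// mulrC -ler_pdivrMr// ltW.
by rewrite mulrDl; lra.
Qed.

(** The level-set argument is used for U with weight V, then for each level set A of U for V with
    weight \1_A. The bound on events thus passes to [0,1]-valued functions without a constant
    factor. *)
Lemma covariance_le (G H : set_system T) (U V : T -> R) (alpha : R) :
  G `<=` measurable -> H `<=` measurable ->
  measurable_fun setT (U : sub_sigma G -> R) ->
  measurable_fun setT (V : sub_sigma H -> R) ->
  (forall w, 0 <= U w <= 1) -> (forall w, 0 <= V w <= 1) ->
  (forall A B, <<s G >> A -> <<s H >> B ->
    P (A `&` B) <= P A * P B + alpha%:E)%E ->
  (\int[P]_w (U w * V w)%:E <=
    (\int[P]_w (U w)%:E) * (\int[P]_w (V w)%:E) + alpha%:E)%E.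
Proof.
move=> GM HM mU mV U01 V01 hAB.
have mUT := measurable_fun_subT GM mU.
have mVT := measurable_fun_subT HM mV.
have U0 w : 0 <= U w by case/andP: (U01 w).
have V0 w : 0 <= V w by case/andP: (V01 w).
have sM K : K `<=` measurable -> forall A : set T, <<s K >> A -> measurable A.
  by move=> KM A; exact: (smallest_sub (sigma_algebra_measurable T) KM).
have fV : (\int[P]_w (V w)%:E = (fine (\int[P]_w (V w)%:E))%:E)%E.
  rewrite fineK// ge0_fin_numE; last by apply: integral_ge0 => w _; rewrite lee_fin.
  apply: (@le_lt_trans _ _ 1%E); last exact: ltry.
  rewrite -(@probability_setT _ _ _ P) -[leRHS]mul1e -integral_cst//.
  apply: ge0_le_integral => //; [by move=> w _; rewrite lee_fin|
    exact/measurable_EFinP|].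
  by move=> w _; rewrite lee_fin; case/andP: (V01 w).
rewrite [in leRHS]fV; apply: (integral_level_le GM) => //.
  by rewrite -lee_fin -fV; apply: integral_ge0 => w _; rewrite lee_fin.
move=> A sA; have mA := sM _ GM _ sA.
rewrite -fV [in leRHS]muleC; under eq_integral do rewrite mulrC.
rewrite -[P A]fineK ?fin_num_measure//.
apply: (integral_level_le HM) => //; first exact: fine_ge0.
move=> B sB; have mB := sM _ HM _ sB.
rewrite fineK ?fin_num_measure//.
have -> : (fun w => (\1_B w * \1_A w : R)%:E) = EFin \o \1_(A `&` B).
  by apply/funext => w; rewrite /= indicI mulrC.
by rewrite integral_indic//; [rewrite setIT muleC; exact: hAB|exact: measurableI].
Qed.

Lemma integral_eqD (f g h : T -> R) :
  measurable_fun setT g -> measurable_fun setT h ->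
  (forall w, 0 <= g w) -> (forall w, 0 <= h w) ->
  (forall w, f w = g w + h w) ->
  (\int[P]_w (f w)%:E = \int[P]_w (g w)%:E + \int[P]_w (h w)%:E)%E.
Proof.
move=> mg mh g0 h0 fE; rewrite -ge0_integralD//.
- by apply: eq_integral => w _; rewrite fE.
- by move=> w _; rewrite lee_fin.
- exact/measurable_EFinP.
- by move=> w _; rewrite lee_fin.
- exact/measurable_EFinP.
Qed.

Lemma integral_le (f g : T -> R) :
  measurable_fun setT f -> measurable_fun setT g ->
  (forall w, 0 <= f w) -> (forall w, f w <= g w) ->
  (\int[P]_w (f w)%:E <= \int[P]_w (g w)%:E)%E.
Proof.
move=> mf mg f0 fg; apply: ge0_le_integral => //.
- by move=> w _; rewrite lee_fin.
- exact/measurable_EFinP.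
- exact/measurable_EFinP.
- by move=> w _; rewrite lee_fin.
Qed.

Lemma integral_leD (f g h : T -> R) :
  measurable_fun setT f -> measurable_fun setT g -> measurable_fun setT h ->
  (forall w, 0 <= f w) -> (forall w, 0 <= g w) -> (forall w, 0 <= h w) ->
  (forall w, f w <= g w + h w) ->
  (\int[P]_w (f w)%:E <= \int[P]_w (g w)%:E + \int[P]_w (h w)%:E)%E.
Proof.
move=> mf mg mh f0 g0 h0 fgh.
rewrite -(integral_eqD (f := fun w => g w + h w))//.
by apply: integral_le => //; exact: measurable_funD.
Qed.

Lemma integral_le1 (f : T -> R) : measurable_fun setT f ->
  (forall w, 0 <= f w <= 1) -> (\int[P]_w (f w)%:E <= 1)%E.
Proof.
move=> mf f01; rewrite -(@probability_setT _ _ _ P) -[leRHS]mul1e -integral_cst//.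
by apply: (@integral_le f (cst 1)) => // w; case/andP: (f01 w).
Qed.

Lemma integral_scale (c : R) (f : T -> R) : measurable_fun setT f ->
  (forall w, 0 <= f w) -> 0 <= c ->
  (\int[P]_w (c * f w)%:E = c%:E * \int[P]_w (f w)%:E)%E.
Proof.
move=> mf f0 c0; under eq_integral do rewrite EFinM.
rewrite ge0_integralZl//; first exact/measurable_EFinP.
by move=> w _; rewrite lee_fin.
Qed.

End level_sets.

(** The value c is the projection of p onto the interval [n t, 1 - (1 - n) t], which is contained in
    [0,1] and from which p is at distance at most u. *)
Lemma clamp_close (R : realType) (p n t u : R) :
  0 <= p <= 1 -> 0 <= n <= 1 -> 0 <= t <= 2^-1 -> 0 <= u ->
  p <= 1 - (1 - n) * t + u -> n * t - u <= p ->
  let c := n * t + (1 - t) * Num.max 0 (Num.min 1 ((p - n * t) / (1 - t))) in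
  p <= c + Num.min 1 u /\ c <= p + Num.min 1 u.
Proof.
move=> /andP[p0 p1] /andP[n0 n1] /andP[t0 t1] u0 h1 h2 /=.
set q := _ / _.
have ee : 0 < 1 - t by lra.
have qE : p = n * t + (1 - t) * q.
  by rewrite /q mulrCA mulfV ?mulr1 ?gt_eqF// addrC subrK.
have m0 : 0 <= Num.min 1 u by rewrite le_min ler01.
have nt0 : 0 <= n * t by rewrite mulr_ge0.
have nt1 : n * t <= t by rewrite ler_piMl.
case: (leP q 1) => q1; last first.
  rewrite (max_r (@ler01 R)) mulr1.
  have q1' : (1 - t) <= (1 - t) * q by rewrite ler_pMr// ltW.
  split; last by lra.
  have : p - (n * t + (1 - t)) <= Num.min 1 u.
    by rewrite le_min; apply/andP; split; lra.
  by lra.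
case: (leP 0 q) => q0; first by rewrite -qE; split; lra.
rewrite mulr0 addr0.
have q0' : (1 - t) * q <= 0 by rewrite pmulr_rle0// ltW.
split; first by lra.
have : n * t - p <= Num.min 1 u.
  by rewrite le_min; apply/andP; split; lra.
by lra.
Qed.

(** * Uniform lower bounds off small sets *)

Section suslin_operation.
Context d (V : measurableType d) (R : realType).

(** The Suslin operation on rectangles with one measurable and one closed side; closedness of the
    real side feeds the compactness argument of [konig_compact]. *)
Definition suslin (C : set (V * R)) := exists A : seq nat -> set V,
  exists L : seq nat -> set R,
  [/\ forall s, measurable (A s), forall s, closed (L s) &
      C = [set p | exists f : nat -> nat,
             forall n, A (mkseq f n) p.1 /\ L (mkseq f n) p.2]].

Lemma suslin_setX (A : set V) (L : set R) :
  measurable A -> closed L -> suslin (A `*` L).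
Proof.
move=> mA cL; exists (fun=> A), (fun=> L); split => //.
by apply/seteqP; split => [[y u] /= [Ay Lu]|[y u] /= [_ /(_ 0%N)]//]; exists id.
Qed.

(** The first term of the index sequence selects k and the remaining terms run the scheme of C k;
    the empty sequence imposes no condition. *)
Lemma suslin_bigcup (C : nat -> set (V * R)) :
  (forall k, suslin (C k)) -> suslin (\bigcup_k C k).
Proof.
move=> /choice[A /choice[L AL]].
exists (fun s => if s is k :: s' then A k s' else setT).
exists (fun s => if s is k :: s' then L k s' else setT); split.
- by case=> // k s; have [] := AL k.
- by case=> [|k s]; [exact: closedT|have [_ + _] := AL k].
have mkS (f : nat -> nat) n : mkseq f n.+1 = f 0%N :: mkseq (fun i => f i.+1) n.
  by rewrite /mkseq /= -[1%N]addn0 iotaDl -map_comp.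
apply/seteqP; split => [p [k _]|p [f fp]].
  have [_ _ ->] := AL k; move=> [f fp].
  exists (fun i => if i is i'.+1 then f i' else k) => -[|n]//.
  by rewrite mkS.
exists (f 0%N) => //; have [_ _ ->] := AL (f 0%N).
by exists (fun i => f i.+1) => n; have := fp n.+1; rewrite mkS.
Qed.

(* A pairing function increasing in m, so that the first n terms of a coded
   sequence of sequences determine the first [dec2 n] terms of the [dec1 n]-th. *)
Let code k m := ((2 ^ k * (2 * m + 1)).-1)%N.
Let dec1 n := logn 2 n.+1.
Let dec2 n := (n.+1 %/ 2 ^ logn 2 n.+1)./2%N.

Let codeS k m : (code k m).+1 = (2 ^ k * (2 * m + 1))%N.
Proof. by rewrite prednK// muln_gt0 expn_gt0 addn1. Qed.

Let codeK1 k m : dec1 (code k m) = k.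
Proof.
rewrite /dec1 codeS lognM ?expn_gt0 ?addn1// pfactorK// lognE /=.
by rewrite dvdn2 /= mul2n odd_double /= addn0.
Qed.

Let codeK2 k m : dec2 (code k m) = m.
Proof.
rewrite /dec2 -/(dec1 _) codeK1 codeS mulKn ?expn_gt0//.
by rewrite mul2n addn1 /= uphalf_double.
Qed.

Let code_lt k i m : (i < m)%N -> (code k i < code k m)%N.
Proof.
move=> im; rewrite -ltnS !codeS ltn_pmul2l ?expn_gt0//.
by rewrite ltn_add2r ltn_pmul2l.
Qed.

Let decK n : code (dec1 n) (dec2 n) = n.
Proof.
apply: succn_inj; rewrite codeS /dec1 /dec2.
set k := logn 2 n.+1; set q := (n.+1 %/ 2 ^ k)%N.
have dq : (n.+1 = 2 ^ k * q)%N by rewrite /q mulnC divnK// pfactor_dvdnn.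
have oq : odd q.
  rewrite -[odd q]negbK -dvdn2; apply/negP => q2.
  have : (2 ^ k.+1 %| n.+1)%N by rewrite dq expnSr dvdn_mul.
  by rewrite pfactor_dvdn// -/k ltnn.
by rewrite dq -[in RHS](odd_double_half q) oq -mul2n addnC.
Qed.

Lemma suslin_bigcap (C : nat -> set (V * R)) :
  (forall k, suslin (C k)) -> suslin (\bigcap_k C k).
Proof.
move=> /choice[A /choice[L AL]].
pose sub (s : seq nat) := mkseq (fun i => nth 0%N s (code (dec1 (size s)) i))
  (dec2 (size s)).
(* The default value of [nth] is never reached: the codes of (dec1 n, i) with i < dec2 n are all
   smaller than n. *)
have subE f n : sub (mkseq f n) = mkseq (fun i => f (code (dec1 n) i)) (dec2 n).
  rewrite /sub size_mkseq; apply/eq_in_map => i; rewrite mem_iota /= => im.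
  by rewrite nth_mkseq// -[ltnRHS]decK; exact: code_lt.
exists (fun s => A (dec1 (size s)) (sub s)).
exists (fun s => L (dec1 (size s)) (sub s)); split.
- by move=> s; have [] := AL (dec1 (size s)).
- by move=> s; have [_ + _] := AL (dec1 (size s)).
apply/seteqP; split => [p Cp|p [f fp] k _].
  have /choice[F Fp] : forall k, exists f : nat -> nat, forall n,
      A k (mkseq f n) p.1 /\ L k (mkseq f n) p.2.
    by move=> k; have := Cp k I; have [_ _ ->] := AL k.
  exists (fun n => F (dec1 n) (dec2 n)) => n; rewrite subE size_mkseq.
  have -> : mkseq (fun i => F (dec1 (code (dec1 n) i)) (dec2 (code (dec1 n) i)))
      (dec2 n) = mkseq (F (dec1 n)) (dec2 n).
    by apply: eq_map => i; rewrite codeK1 codeK2.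
  exact: Fp.
have [_ _ ->] := AL k; exists (fun i => f (code k i)) => m.
by have := fp (code k m); rewrite subE size_mkseq codeK1 codeK2.
Qed.

Lemma suslin_setU (C D : set (V * R)) :
  suslin C -> suslin D -> suslin (C `|` D).
Proof.
move=> sC sD; rewrite (_ : _ `|` _ = \bigcup_k (if k is 0%N then C else D)).
  by apply: suslin_bigcup => -[].
apply/seteqP; split => [p [Cp|Dp]|p [[|k] _ ?]]; [by exists 0%N|by exists 1%N|
  by left|by right].
Qed.

(** The sets that are Suslin together with their complement form a sigma-algebra, since Suslin sets
    are stable under countable unions and intersections. It contains the measurable rectangles, by
    the same argument on the real side: the complement of a closed ray is a countable union of
    closed rays. *)
Lemma measurable_suslin (C : set (V * R)) : measurable C -> suslin C.
Proof.
pose S : set_system (V * R) := [set C | suslin C /\ suslin (~` C)].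
have SA : sigma_algebra setT S.
  split.
  - split; first by rewrite -(set0X (setT : set R)); exact: suslin_setX closedT.
    by rewrite setC0 -setXTT; exact: suslin_setX closedT.
  - by move=> A [sA sCA]; rewrite setTD; split; rewrite ?setCK.
  - move=> F FS; split; first by apply: suslin_bigcup => k; have [] := FS k.
    by rewrite setC_bigcup; apply: suslin_bigcap => k; have [] := FS k.
suff SX (A : set V) (B : set R) : measurable A -> measurable B -> S (A `*` B).
  rewrite measurable_prod_measurableType => mC.
  suff : S C by case.
  apply: smallest_sub mC => // _ [A mA [B mB <-]]; exact: SX.
move=> mA.
pose SB : set_system R := [set B | suslin (A `*` B) /\ suslin (A `*` ~` B)].
have SBA : sigma_algebra setT SB.
  split.
  - split; first by rewrite setX0 -(set0X (setT : set R)); exact: suslin_setX closedT.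
    by rewrite setC0; exact: suslin_setX closedT.
  - by move=> B1 [sB sCB]; rewrite setTD; split; rewrite ?setCK.
  - move=> F FS; split.
      have -> : A `*` \bigcup_k F k = \bigcup_k (A `*` F k).
        by apply/seteqP; split => [[y u] [/= Ay [k _ Fu]]|[y u] [k _ [/= Ay Fu]]];
          [exists k|split => //; exists k].
      by apply: suslin_bigcup => k; have [] := FS k.
    have -> : A `*` ~` (\bigcup_k F k) = \bigcap_k (A `*` ~` F k).
      rewrite setC_bigcup; apply/seteqP.
      split => [[y u] [/= Ay Fu] k _|[y u] h]; first by split => //; exact: Fu.
      split; first by have [] := h 0%N I.
      by move=> k _; have [] := h k I.
    by apply: suslin_bigcap => k; have [] := FS k.
move=> mB; have [sB sCB] : SB B.
  have : (@RGenCInfty.G R).-sigma.-measurable B by rewrite -RGenCInfty.measurableE.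
  apply: smallest_sub => // _ [x ->]; split.
    by apply: suslin_setX => //; exact: rray_closed.
  have -> : A `*` ~` `[x, +oo[%classic =
      \bigcup_k (A `*` `]-oo, x - k.+1%:R^-1]%classic).
    rewrite setCitvr; apply/seteqP; split => [[y u] /= [Ay]|[y u] [k _ /= [Ay]]].
      rewrite in_itv /= => ux.
      exists (Num.trunc (x - u)^-1) => //=; split => //; rewrite in_itv /=.
      rewrite lerBrDr -lerBrDl -[leRHS]invrK lef_pV2 ?posrE ?invr_gt0 ?subr_gt0//.
      by rewrite ltW// truncnS_gt.
    rewrite !in_itv /= => h; split => //.
    by rewrite (le_lt_trans h)// ltrBlDr ltrDl invr_gt0.
  apply: suslin_bigcup => k; apply: suslin_setX => //; exact: lray_closed.
split; first exact: sB.
have -> : ~` (A `*` B) = (~` A `*` setT) `|` (A `*` ~` B).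
  apply/seteqP; split => [[y u] /= h|[y u] /= [[nAy _] []//|[_ Bu] []//]].
  have [Ay|nAy] := pselect (A y); last by left.
  by right; split => // Bu; exact: h.
apply: suslin_setU => //; apply: suslin_setX closedT; exact: measurableC.
Qed.

End suslin_operation.

Section measurable_projection.
Context d (V : measurableType d) (R : realType) (mu : probability V R).

(** Continuity from below of the outer measure: covers of the F n need not increase, but their tail
    intersections K n do, and they still cover F n because F is nondecreasing. *)
Lemma measurable_cover_bigcup (c : R) (F : nat -> set V) :
  nondecreasing_seq F ->
  (forall n, exists H, [/\ measurable H, F n `<=` H & (mu H <= c%:E)%E]) ->
  exists H, [/\ measurable H, \bigcup_n F n `<=` H & (mu H <= c%:E)%E].
Proof.
move=> ndF /choice[H HP].
pose K n := \bigcap_(i in [set i | (n <= i)%N]) H i.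
have mK n : measurable (K n).
  by apply: bigcap_measurable => [|i _]; [exists n => /=|have [] := HP i].
have ndK : nondecreasing_seq K.
  by move=> m n mn; apply/subsetPset => y Ky i ni; apply: Ky; exact: leq_trans ni.
exists (\bigcup_n K n); split; first exact: bigcupT_measurable.
  move=> y [n _ Fy]; exists n => // i ni; have [_ + _] := HP i; apply.
  by have /subsetPset := ndF _ _ ni; apply.
have cK := @nondecreasing_cvg_mu _ _ _ mu _ mK (bigcupT_measurable _ mK) ndK.
rewrite -(cvg_lim _ cK)//; apply: lime_le; [exact: cvgP cK|]; apply: nearW => n.
have [mH _] := HP n; apply: le_trans; apply: le_measure; rewrite ?inE//.
by move=> y Ky; apply: (Ky n) => /=.
Qed.

(** Koenig's lemma gives an infinite branch f, every finite piece of which is compatible with some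
    u; a single u for the whole branch then comes from compactness of [- rho, rho]. *)
Lemma konig_compact (A : seq nat -> Prop) (L : seq nat -> set R) (rho : R)
    (g : nat -> nat) :
  (forall s, closed (L s)) ->
  (forall n, exists s u, [/\ size s = n, forall i, (i < n)%N ->
    (nth 0%N s i <= g i)%N, `|u| <= rho &
    forall k, (k <= n)%N -> A (take k s) /\ L (take k s) u]) ->
  exists f u, `|u| <= rho /\ forall n, A (mkseq f n) /\ L (mkseq f n) u.
Proof.
move=> cL AL.
pose good n s := exists s' u, [/\ size (s ++ s') = n,
    forall i, (i < n)%N -> (nth 0%N (s ++ s') i <= g i)%N, `|u| <= rho &
    forall k, (k <= n)%N -> A (take k (s ++ s')) /\ L (take k (s ++ s')) u].
pose tree s := forall n, (size s <= n)%N -> good n s.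
have good_le m n s : (size s <= m <= n)%N -> good n s -> good m s.
  move=> /andP[sm mn] [s' [u [sn sg ur sAL]]].
  have tE : s ++ take (m - size s) s' = take m (s ++ s').
    by rewrite take_cat ltnNge sm.
  exists (take (m - size s) s'), u; rewrite tE; split => //.
  - by rewrite size_takel// sn.
  - by move=> i im; rewrite nth_take// sg// (leq_trans im).
  - move=> k km; rewrite take_takel//; apply: sAL; exact: leq_trans mn.
have tree0 : tree [::].
  by move=> n _; have [s [u ?]] := AL n; exists s, u.
have treeS s : exists j, tree s -> tree (rcons s j).
  have [ts|] := pselect (tree s); last by move=> nts; exists 0%N.
  apply: contrapT => /forallNP nt.
  have nt' j : exists n, (size s < n)%N /\ ~ good n (rcons s j).
    have /not_implyP[_ /existsNP[n /not_implyP[h1 h2]]] := nt j.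
    by exists n; rewrite size_rcons in h1.
  have [N NP] := choice nt'.
  (* If every admissible child of s died at some level, s would have no extension to the largest of
     these finitely many levels. *)
  pose M := (\max_(j < (g (size s)).+1) N j)%N.
  have NM j : (j <= g (size s))%N -> (N j <= M)%N.
    move=> jg; have := @leq_bigmax _ (fun j : 'I_(g (size s)).+1 => N j) (inord j).
    by rewrite inordK.
  have sM : (size s < M)%N by apply: leq_trans (NM 0%N (leq0n _)); have [] := NP 0%N.
  have [s' [u [sn sg ur sAL]]] := ts M (ltnW sM).
  case: s' sn sg sAL => [|j s'] sn sg sAL.
    by move: sM; rewrite -sn cats0 ltnn.
  have jg : (j <= g (size s))%N.
    by have := sg _ sM; rewrite nth_cat ltnn subnn.
  have [sN ng] := NP j; apply: ng.
  apply: (@good_le _ M); first by rewrite size_rcons sN NM.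
  by exists s', u; rewrite cat_rcons.
have [nxt nxtP] := choice treeS.
pose pr := fix pr n := if n is n'.+1 then rcons (pr n') (nxt (pr n')) else [::].
have tr n : tree (pr n) by elim: n => //= n; exact: nxtP.
have spr n : size (pr n) = n by elim: n => //= n; rewrite size_rcons => ->.
pose f n := nxt (pr n).
have prE n : pr n = mkseq f n.
  by elim: n => //= n IH; rewrite mkseqS -IH.
pose K n := [set u : R | `|u| <= rho /\ forall k, (k <= n)%N ->
  A (pr k) /\ L (pr k) u].
have tpr k n : (k <= n)%N -> take k (pr n) = pr k.
  move=> kn; rewrite !prE -map_take take_iota; congr map.
  by congr iota; exact/minn_idPl.
have K0 n : K n !=set0.
  have [s' [u [sn sg ur sAL]]] := tr n n (eq_leq (spr n)).
  have s'0 : s' = [::].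
    apply/nilP; rewrite /nilp -(eqn_add2l (size (pr n))) -size_cat sn.
    by rewrite spr addn0.
  move: sAL; rewrite s'0 cats0 => sAL.
  by exists u; split => // k kn; have := sAL k kn; rewrite tpr.
(* The K n are nonempty, nested and closed in a segment. *)
have : \bigcap_(n in [set: nat]) K n !=set0.
  have := @segment_compact R (- rho) rho; rewrite compact_In0; apply.
    have cK n : closed [set u : R | `|u| <= rho /\
        forall k, (k <= n)%N -> L (pr k) u].
      have -> : [set u : R | `|u| <= rho /\ forall k, (k <= n)%N -> L (pr k) u] =
          `[- rho, rho]%classic `&` \bigcap_(k in [set k | (k <= n)%N]) L (pr k).
        by apply/seteqP; split => u /=; rewrite in_itv /= ler_norml.
      apply: closedI; first exact: itv_closed.
      by apply: closed_bigI => k _; exact: cL.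
    exists (fun n => [set u : R | `|u| <= rho /\
        forall k, (k <= n)%N -> L (pr k) u]) => n _ //.
    have [u0 [_ u0P]] := K0 n.
    apply/seteqP; split => u /=.
      move=> [ur uL]; split; first by rewrite in_itv /= -ler_norml.
      by split => // k kn; have [] := uL k kn.
    move=> [_ [ur uL]]; split => // k kn; split; last exact: uL.
    by have [] := u0P k kn.
  move=> D DT; pose N := (\max_(i <- finmap.enum_fset D) i)%N.
  have [u [ur uP]] := K0 N; exists u => i iD; split => // k ki; apply: uP.
  by rewrite (leq_trans ki)// (@leq_bigmax_seq _ _ xpredT id).
move=> [u uK]; exists f, u; split; first by have [] := uK 0%N I.
by move=> n; rewrite -prE; have [_] := uK n I; apply.
Qed.

(* The projection of C need not be measurable.  Bounding the n-th index of the
   Suslin scheme by g n, with g chosen step by step to keep every measurable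
   cover large, leaves a finitely branching tree, and Koenig's lemma applies. *)
Lemma inner_measurable_projection (C : set (V * R)) (rho c : R) :
  measurable C ->
  (forall H, measurable H ->
    [set y | exists u, `|u| <= rho /\ C (y, u)] `<=` H -> (c%:E < mu H)%E) ->
  exists D, [/\ measurable D, (c%:E <= mu D)%E &
    D `<=` [set y | exists u, `|u| <= rho /\ C (y, u)]].
Proof.
move=> /measurable_suslin[A [L [mA cL CE]]] big.
pose Cg (g : nat -> nat) n := [set y | exists f u, [/\ `|u| <= rho,
  forall i, (i < n)%N -> (f i <= g i)%N &
  forall k, A (mkseq f k) y /\ L (mkseq f k) u]].
pose Big (B : set V) := forall H, measurable H -> B `<=` H -> (c%:E < mu H)%E.
(* The set Cg g n is the increasing union over j of its parts with n-th index at most j. If every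
   part had a cover of measure at most c, [measurable_cover_bigcup] would give one for the union. *)
have stepg g n : exists j, Big (Cg g n) ->
    forall g', (forall i, (i < n)%N -> g' i = g i) -> g' n = j -> Big (Cg g' n.+1).
  have [bg|] := pselect (Big (Cg g n)); last by move=> nb; exists 0%N.
  pose F j := [set y | exists f u, [/\ `|u| <= rho,
    forall i, (i < n)%N -> (f i <= g i)%N, (f n <= j)%N &
    forall k, A (mkseq f k) y /\ L (mkseq f k) u]].
  have ndF : nondecreasing_seq F.
    move=> j k jk; apply/subsetPset => y [f [u [ur fg fn fAL]]].
    by exists f, u; split => //; exact: leq_trans jk.
  have [j bj] : exists j, Big (F j).
    apply: contrapT => /forallNP nB.
    have [|H [mH FH cH]] := @measurable_cover_bigcup c F ndF.
      move=> j; have /existsNP[H /not_implyP[mH /not_implyP[FH /negP]]] := nB j.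
      by rewrite -leNgt => cH; exists H.
    suff : (c%:E < mu H)%E by rewrite ltNge cH.
    apply: (bg H mH) => y [f [u [ur fg fAL]]]; apply: FH; exists (f n) => //.
    by exists f, u; split.
  exists j => _ g' gg' g'n H mH FH; apply: (bj H mH) => y [f [u [ur fg fn fAL]]].
  apply: FH; exists f, u; split => // i; rewrite ltnS leq_eqVlt => /orP[/eqP ->|im].
    by rewrite g'n.
  by rewrite gg'// fg.
pose G s := nth 0%N s.
have stepG s : exists j, Big (Cg (G s) (size s)) ->
    Big (Cg (G (rcons s j)) (size s).+1).
  have [j jP] := stepg (G s) (size s); exists j => /jP; apply.
    by move=> i im; rewrite /G nth_rcons im.
  by rewrite /G nth_rcons ltnn eqxx.
have [nxt nxtP] := choice stepG.
pose pr := fix pr n := if n is n'.+1 then rcons (pr n') (nxt (pr n')) else [::].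
have spr n : size (pr n) = n by elim: n => //= n; rewrite size_rcons => ->.
have bpr n : Big (Cg (G (pr n)) n).
  elim: n => [H mH CH|n]; last by rewrite -{2}(spr n) => /nxtP; rewrite spr.
  apply: big => // y [u [ur]]; rewrite CE /= => -[f fAL].
  by apply: CH; exists f, u; split.
pose g i := nxt (pr i).
have gE i n : (i < n)%N -> G (pr n) i = g i.
  elim: n => // n IH; rewrite ltnS leq_eqVlt => /orP[/eqP ->|im].
    by rewrite /G /= nth_rcons spr ltnn eqxx.
  by rewrite /G /= nth_rcons spr im; exact: IH.
(* The approximation at depth n: the scheme is checked along a sequence of length n only. This set
   is measurable and contains Cg, hence has measure above c, and the intersection over n falls into
   the projection by [konig_compact]. *)
pose D n := [set y | exists s u, [/\ size s = n, forall i, (i < n)%N ->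
    (nth 0%N s i <= g i)%N, `|u| <= rho &
    forall k, (k <= n)%N -> A (take k s) y /\ L (take k s) u]].
have mD n : measurable (D n).
  (* The conditions on s and u do not involve y, so D n is a countable union, over enumerated finite
     sequences s, of finite intersections of the sets A. *)
  pose Q (s : seq nat) := [/\ size s = n, forall i, (i < n)%N ->
    (nth 0%N s i <= g i)%N & exists u, `|u| <= rho /\
    forall k, (k <= n)%N -> L (take k s) u].
  pose DD (m : nat) := if unpickle m is Some s then
    [set y | Q s] `&` \bigcap_(k in [set k | (k <= n)%N]) A (take k s) else set0.
  have -> : D n = \bigcup_m DD m.
    apply/seteqP; split => [y [s [u [sn sg ur sAL]]]|y [m _]].
      exists (pickle s) => //; rewrite /DD pickleK; split => /=.
        by split => //; exists u; split => // k /sAL[].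
      by move=> k /sAL[].
    rewrite /DD; case: unpickle => //= s [[sn sg [u [ur sL]]] sA].
    by exists s, u; split => // k kn; split; [exact: sA|exact: sL].
  apply: bigcupT_measurable => m; rewrite /DD; case: unpickle => // s.
  apply: measurableI; last by apply: bigcap_measurable => //; exists 0%N.
  have [q|q] := pselect (Q s).
    by rewrite (_ : [set _ | _] = setT)//; apply/seteqP; split.
  by rewrite (_ : [set _ | _] = set0)//; apply/seteqP; split.
have DC n : Cg (G (pr n)) n `<=` D n.
  move=> y [f [u [ur fg fAL]]]; exists (mkseq f n), u; split => //.
  - exact: size_mkseq.
  - by move=> i im; rewrite nth_mkseq// -(gE i n)// fg.
  - by move=> k kn; rewrite -map_take take_iota (minn_idPl kn); exact: fAL.
have niD : nonincreasing_seq D.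
  move=> m n mn; apply/subsetPset => y [s [u [sn sg ur sAL]]].
  exists (take m s), u; split => //.
  - by rewrite size_takel// sn.
  - by move=> i im; rewrite nth_take// sg// (leq_trans im).
  - by move=> k km; rewrite take_takel//; apply: sAL; exact: leq_trans mn.
exists (\bigcap_n D n); split; first exact: bigcapT_measurable.
  have cD : mu (D n) @[n --> \oo] --> mu (\bigcap_n D n).
    apply: nonincreasing_cvg_mu => //; last exact: bigcapT_measurable.
    by rewrite ltey_eq fin_num_measure.
  rewrite -(cvg_lim _ cD)//; apply: lime_ge; first exact: cvgP cD.
  by apply: nearW => n; apply/ltW/(bpr n) => //; exact: DC.
move=> y Dy; have [|f [u [ur fAL]]] :=
  @konig_compact (fun s => A s y) L rho g cL; first by move=> n; exact: Dy.
by exists u; split => //; rewrite CE /=; exists f.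
Qed.

(** Otherwise, for every k, each measurable cover of the set of y with h (y, u) < 1/(k+1) for some
    admissible u has measure above delta, and that set contains a measurable D k of measure at least
    delta. The limsup of the D k then has measure at least delta, and any of its points contradicts
    the positive lower bound there. *)
Lemma measurable_uniform_lower_bound (h : V * R -> R) (rho delta : R) :
  measurable_fun setT h ->
  (forall y, exists2 e : R, 0 < e & forall u, `|u| <= rho -> e <= h (y, u)) ->
  0 < delta ->
  exists G : set V, [/\ measurable G, (mu (~` G) <= delta%:E)%E &
    exists2 e : R, 0 < e & forall y u, G y -> `|u| <= rho -> e <= h (y, u)].
Proof.
move=> mh hpos d0; apply: contrapT => nG.
pose C k : set (V * R) := [set z | h z < k.+1%:R^-1].
have mC k : measurable (C k) by exact: measurable_set_lt mh (measurable_cst _).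
have /choice[D DP] k : exists D, [/\ measurable D, (delta%:E <= mu D)%E &
    D `<=` [set y | exists u, `|u| <= rho /\ C k (y, u)]].
  apply: inner_measurable_projection => // H mH CH.
  rewrite ltNge; apply/negP => Hd; apply: nG.
  exists (~` H); split; [exact: measurableC|by rewrite setCK|].
  exists k.+1%:R^-1; first by rewrite invr_gt0.
  move=> y u nHy ur; rewrite leNgt; apply/negP => hyu; apply: nHy.
  by apply: CH; exists u.
pose E n := \bigcup_(k in [set k | (n <= k)%N]) D k.
have mE n : measurable (E n) by apply: bigcup_measurable => k _; have [] := DP k.
have cE : mu (E n) @[n --> \oo] --> mu (\bigcap_n E n).
  apply: nonincreasing_cvg_mu => //.
  - by rewrite ltey_eq fin_num_measure.
  - exact: bigcapT_measurable.
  - move=> m n mn; apply/subsetPset => y [k /= nk Dk]; exists k => //=.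
    exact: leq_trans nk.
have : (delta%:E <= mu (\bigcap_n E n))%E.
  rewrite -(cvg_lim _ cE)//; apply: lime_ge; first exact: cvgP cE.
  apply: nearW => n; have [mD dD _] := DP n; apply: le_trans dD _.
  by apply: le_measure; rewrite ?inE// => y Dy; exists n => /=.
have [[y Ey] _|nE] := pselect (\bigcap_n E n !=set0); last first.
  have -> : \bigcap_n E n = set0 by apply/seteqP; split => // y Ey; apply: nE; exists y.
  by rewrite measure0 lee_fin leNgt d0.
have [e e0 he] := hpos y.
have [k /= ek Dk] := Ey (Num.trunc e^-1) I.
have [_ _ /(_ _ Dk)[u [ur]]] := DP k; rewrite /C /= ltNge => /negP; apply.
rewrite (le_trans _ (he u ur))// -[leRHS]invrK lef_pV2 ?posrE ?invr_gt0//.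
by rewrite ltW// (lt_le_trans (truncnS_gt _))// ler_nat.
Qed.

End measurable_projection.

(** * The chain in a random environment *)

Section minorization.
Context (R : realType).
Local Notation leb := (@lebesgue_measure R).
Local Notation unif := (uniform_prob (@ltr01 R)).

Lemma uniform_prob01E (A : set R) : measurable A ->
  unif A = leb (A `&` `[0, 1]).
Proof.
move=> mA; rewrite -[A in LHS]setIT -integral_indic// integral_uniform//; last first.
  by apply/measurable_EFinP.
by rewrite subr0 invr1 mul1e integral_indic// setIC.
Qed.

(** Both sides are measures in A that agree on half-open intervals. *)
Lemma lebesgue_measure_affine (a s : R) (A : set R) : 0 < s -> measurable A ->
  leb A = (s%:E * leb [set u : R | A (a + u * s)%R])%E.
Proof.
move=> s0 mA.
have mf : measurable_fun setT
    (fun u : measurableTypeR R => a + (u : R) * s : measurableTypeR R).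
  by apply: measurable_funD => //; exact: measurable_funM.
have s0' : 0 <= s by exact: ltW.
pose mf' : {mfun (measurableTypeR R) >-> (measurableTypeR R)} :=
  HB.pack_for {mfun (measurableTypeR R) >-> (measurableTypeR R)}
   (fun u : measurableTypeR R => a + (u : R) * s : measurableTypeR R)
   (isMeasurableFun.Build _ _ _ _ _ mf).
rewrite (lebesgue_measure_unique
  (mu := mscale (NngNum s0') (pushforward leb mf')) _ mA)//=.
move=> _ [[x y] _ <-]; rewrite /mscale /= /pushforward /=.
have -> : (fun u : R => a + u * s) @^-1` `]x, y] = `](x - a) / s, (y - a) / s]%classic.
  apply/seteqP; split => u /=; rewrite !in_itv /= ltr_pdivrMr// ler_pdivlMr//;
  by rewrite ltrBlDl lerBrDl.
rewrite !lebesgue_measure_itv /= !lte_fin ltr_pM2r ?invr_gt0// ltrD2r.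
case: ifP => _; last by rewrite mule0.
rewrite -!EFinD -EFinM; congr (_%:E); field; exact: lt0r_neq0.
Qed.

Context d (T : measurableType d) (P : probability T R).

(** To land at z in [0,1] the noise must equal (z - a) / s, which is at most B in absolute value,
    where the density is at least e. The change of variables contributes the factor 1 / s >= 1 /
    M. *)
Lemma density_minorization (X : {RV P >-> R}) (f : R -> R) (e B M a s : R)
    (psi : R -> R) : has_density X f -> 0 < e -> 0 < M ->
  (forall u, `|u| <= B -> e <= f u) ->
  0 < s -> s <= M -> (1 + `|a|) / s <= B ->
  measurable_fun setT psi -> (forall z, 0 <= psi z) ->
  ((e / M)%:E * \int[unif]_z (psi z)%:E <=
   \int[P]_w (psi (a + X w * s))%:E)%E.
Proof.
move=> [mf f0 fX] e0 M0 fe s0 sM aB mpsi psi0.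
have eM0 : 0 <= e / M by rewrite divr_ge0// ltW.
have mg : measurable_fun setT (fun w => a + X w * s).
  by apply: measurable_funD => //; exact: measurable_funM.
pose g : {mfun T >-> measurableTypeR R} :=
  HB.pack_for {mfun T >-> measurableTypeR R} (fun w => a + X w * s)
    (isMeasurableFun.Build _ _ T (measurableTypeR R) _ mg).
have mpsiE : measurable_fun (setT : set (measurableTypeR R)) (EFin \o psi).
  exact/measurable_EFinP.
have psiE0 (z : measurableTypeR R) : (0 <= (EFin \o psi) z)%E by rewrite lee_fin.
rewrite -[leLHS](ge0_integral_mscale unif measurableT (NngNum eM0) mpsiE
  (fun z _ => psiE0 z)).
have <- : (\int[distribution P g]_z (EFin \o psi) z =
           \int[P]_w (psi (a + X w * s)%R)%:E)%E.
  by rewrite ge0_integral_distribution.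
apply: ge0_le_measure_integral => // A mA.
rewrite [leLHS](_ : _ = (e / M)%:E * leb (A `&` `[0%R, 1%R]))%E; last first.
  by rewrite -(uniform_prob01E (A := A)).
pose A' := [set u | (A `&` `[0, 1]) (a + u * s)].
have mA' : measurable A'.
  rewrite -[X in measurable X]setTI.
  have m1 : measurable_fun setT (fun u : R => a + u * s).
    by apply: measurable_funD => //; exact: measurable_funM.
  by apply: m1 => //; exact: measurableI.
apply: (@le_trans _ _ (distribution P X A')); last first.
  apply: (@le_measure _ _ _ P (X @^-1` A') (g @^-1` A)); rewrite ?inE.
  - by rewrite -[X in measurable X]setTI; exact: measurable_funPT.
  - by rewrite -[X in measurable X]setTI; exact: (mg measurableT _ mA).
  - by move=> w [].
rewrite fX//; apply: (@le_trans _ _ (\int[leb]_(u in A') e%:E)%E); last first.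
  apply: ge0_le_integral => //.
  - by move=> u _; rewrite lee_fin ltW.
  - by apply/measurable_EFinP; exact: measurable_funTS.
  move=> u [_]; rewrite /= in_itv /= lee_fin => /andP[h1 h2]; apply: fe.
  rewrite (le_trans _ aB)// ler_pdivlMr//.
  rewrite -[s in leLHS]gtr0_norm// -normrM.
  have -> : u * s = (a + u * s) - a by rewrite addrC addKr.
  by rewrite (le_trans (ler_normB _ _))// lerD2r ger0_norm.
rewrite integral_cst// (lebesgue_measure_affine a s0); last exact: measurableI.
rewrite muleA -EFinM lee_wpmul2r// lee_fin -mulrA ler_piMr//; first exact: ltW.
by rewrite mulrC ler_pdivrMr// mul1r.
Qed.

End minorization.

Section random_recursion.
Context disp (T : measurableType disp) (R : realType) (P : probability T R).
Context dV (V : measurableType dV).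
Variables (Y : int -> T -> V) (eps : int -> T -> R) (r sigma : V * R -> R).
Hypothesis mY : forall k, measurable_fun setT (Y k).
Hypothesis meps : forall k, measurable_fun setT (eps k).
Hypothesis eps_indep : mutually_independent P eps.
Hypothesis eps_Y_indep : independent_systems P
  <<s generators eps setT >> <<s generators Y setT >>.
Hypothesis mr : measurable_fun setT r.
Hypothesis msigma : measurable_fun setT sigma.

Local Notation gY := (generators Y).
Local Notation ge := (generators eps).
Local Notation sT := (@sub_sigma _ T).

Lemma measurable_generator (G : set_system T) d' (U : measurableType d')
    (W : int -> T -> U) (J : set int) (k : int) :
  J k -> generators W J `<=` G -> measurable_fun setT (W k : sT G -> U).
Proof.
move=> Jk JG; apply/measurable_fun_genP => A WA; apply: sub_gen_smallest.
by apply: JG; exists k.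
Qed.

Lemma sub_generated (G H : set_system T) : G `<=` H -> G `<=` <<s H >>.
Proof. by move=> GH A GA; apply: sub_gen_smallest; exact: GH. Qed.

Lemma generators_sub (J : set int) (K : set int) :
  gY J `|` ge K `<=` measurable.
Proof. by move=> A [|]; exact: generators_sub_measurable. Qed.

Lemma independent_env_noise (J K : set int) : J `&` K = set0 ->
  independent_systems P <<s gY setT `|` ge J >> <<s ge K >>.
Proof.
move=> JK; apply: independent_join.
- exact: generators_sub_measurable.
- exact: generators_sub_measurable.
- exact: generators_sub_measurable.
- exact: independent_generators.
move=> A B sA sB; apply: eps_Y_indep => //.
apply: sub_smallest2r sA; first exact: smallest_sigma_algebra.
by move=> C [|]; exact: generatorsS.
Qed.

Definition next (t : nat) (p : R * T) (e : R) : R :=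
  r (Y t%:Z p.2, p.1) + e * sigma (Y t%:Z p.2, p.1).

(** The quenched transition operator. The sample point in the second component carries the
    environment and stays fixed, while the noise is averaged over a separate sample point. *)
Definition kernel_op (t : nat) (psi : R * T -> R) (p : R * T) : R :=
  fine (\int[P]_w (psi (next t p (eps t.+1%:Z w), p.2))%:E).

Fixpoint kernel_iter (t k : nat) (psi : R * T -> R) : R * T -> R :=
  if k is k'.+1 then kernel_op t (kernel_iter t.+1 k' psi) else psi.

(** Test functions of the state and of the randomness recorded in G; a [0,1] range makes all
    integrals finite and is preserved by [kernel_op] and by complementation. *)
Definition unit_fun (G : set_system T) (psi : R * T -> R) :=
  measurable_fun setT (psi : R * sT G -> R) /\ forall p, 0 <= psi p <= 1.

Definition unit_weight (G : set_system T) (Z : T -> R) :=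
  measurable_fun setT (Z : sT G -> R) /\ forall w, 0 <= Z w <= 1.

Section kernel.
Variables (G : set_system T) (t : nat).
Hypothesis GM : G `<=` measurable.
Hypothesis mYG : measurable_fun setT (Y t%:Z : sT G -> V).

Lemma measurable_next d' (U : measurableType d') (e : U -> R) :
  measurable_fun setT e ->
  measurable_fun setT
    (fun q : (R * sT G) * U => (next t q.1 (e q.2), q.1.2) : R * sT G).
Proof.
move=> me.
have mYx : measurable_fun setT (fun q : (R * sT G) * U => (Y t%:Z q.1.2, q.1.1)).
  apply/measurable_fun_pairP; split => /=.
    apply: (measurableT_comp mYG (g := fun q : (R * sT G) * U => q.1.2)).
    exact: (measurableT_comp measurable_snd measurable_fst).
  exact: (measurableT_comp measurable_fst measurable_fst).
apply/measurable_fun_pairP; split => /=; last first.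
  exact: (measurableT_comp measurable_snd measurable_fst).
apply: measurable_funD; first exact: (measurableT_comp mr mYx).
apply: measurable_funM; last exact: (measurableT_comp msigma mYx).
exact: (measurableT_comp me measurable_snd).
Qed.

Lemma measurable_next_at psi p : unit_fun G psi ->
  measurable_fun setT (fun w : T => (psi (next t p (eps t.+1%:Z w), p.2))%:E).
Proof.
move=> [mpsi _]; apply/measurable_EFinP.
have := measurableT_comp mpsi (measurable_next (meps t.+1%:Z)).
by move=> /measurableT_comp => /(_ _ _ _ _ (pair1_measurable (p : R * sT G))).
Qed.

Lemma kernel_opE psi p : unit_fun G psi ->
  (kernel_op t psi p)%:E = (\int[P]_w (psi (next t p (eps t.+1%:Z w), p.2))%:E)%E.
Proof.
move=> upsi; have [_ psi01] := upsi; rewrite /kernel_op fineK//.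
rewrite ge0_fin_numE; last first.
  by apply: integral_ge0 => w _; rewrite lee_fin; case/andP: (psi01
    (next t p (eps t.+1%:Z w), p.2)).
apply: (@le_lt_trans _ _ 1%E); last exact: ltry.
rewrite -(@probability_setT _ _ _ P) -[leRHS]mul1e -integral_cst//.
by apply: ge0_le_integral => //; [|exact: measurable_next_at|];
  move=> w _; rewrite lee_fin; case/andP: (psi01 (next t p (eps t.+1%:Z w), p.2)).
Qed.

Lemma unit_fun_kernel_op psi : unit_fun G psi -> unit_fun G (kernel_op t psi).
Proof.
move=> upsi; have [mpsi psi01] := upsi; split.
  apply: measurableT_comp => //.
  have mF : measurable_fun setT (fun q : (R * sT G) * T =>
      (psi (next t q.1 (eps t.+1%:Z q.2), q.1.2))%:E).
    apply/measurable_EFinP.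
    exact: (measurableT_comp mpsi (measurable_next (meps t.+1%:Z))).
  have := measurable_fun_fubini_tonelli_F (m2 := P) _ mF.
  by apply=> q; rewrite lee_fin; case/andP: (psi01 (next t q.1 (eps t.+1%:Z q.2), q.1.2)).
move=> p; rewrite -!lee_fin kernel_opE//.
apply/andP; split.
  by apply: integral_ge0 => w _; rewrite lee_fin; case/andP: (psi01
    (next t p (eps t.+1%:Z w), p.2)).
rewrite -(@probability_setT _ _ _ P) -[leRHS]mul1e -integral_cst//.
by apply: ge0_le_integral => //; [|exact: measurable_next_at|];
  move=> w _; rewrite lee_fin; case/andP: (psi01 (next t p (eps t.+1%:Z w), p.2)).
Qed.

Lemma unit_fun_onem psi : unit_fun G psi -> unit_fun G (fun p => 1 - psi p).
Proof.
move=> [mpsi psi01]; split; first exact: measurable_funB.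
by move=> q; have := psi01 q; lra.
Qed.

Lemma kernel_op_onem psi : unit_fun G psi ->
  kernel_op t (fun p => 1 - psi p) = fun p => 1 - kernel_op t psi p.
Proof.
move=> upsi; have [mpsi psi01] := upsi; apply/funext => p.
have upsi' := unit_fun_onem upsi; have [_ psi01'] := upsi'.
suff : ((kernel_op t (fun p => 1 - psi p) p)%:E + (kernel_op t psi p)%:E = 1)%E.
  by move=> /(congr1 fine) /= h; apply/eqP; rewrite -subr_eq0 opprB addrA h subrr.
rewrite !kernel_opE// -ge0_integralD//; last 4 first.
- by move=> w _; rewrite lee_fin; case/andP: (psi01' (next t p (eps t.+1%:Z w), p.2)).
- exact: measurable_next_at upsi'.
- by move=> w _; rewrite lee_fin; case/andP: (psi01 (next t p (eps t.+1%:Z w), p.2)).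
- exact: measurable_next_at.
under eq_integral do rewrite -EFinD subrK.
by rewrite integral_cst//= probability_setT mul1e.
Qed.

(** The Markov property in integrated form: H carries the weight, the state and the arguments of psi
    other than the new noise, so by [integral_freeze] the latter may be averaged first. *)
Lemma integral_kernel_op (H : set_system T) (U z : T -> R) psi :
  H `<=` measurable -> ge [set t.+1%:Z] `<=` measurable ->
  independent_systems P <<s H >> <<s ge [set t.+1%:Z] >> ->
  G `<=` <<s H >> ->
  measurable_fun setT (U : sT H -> R) -> (forall w, 0 <= U w) ->
  measurable_fun setT (z : sT H -> R) -> unit_fun G psi ->
  (\int[P]_w (U w * psi (next t (z w, w) (eps t.+1%:Z w), w))%:E =
   \int[P]_w (U w * kernel_op t psi (z w, w))%:E)%E.
Proof.
move=> HM eM indep GH mU U0 mz upsi; have [mpsi psi01] := upsi.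
pose F (q : sT H * sT (ge [set t.+1%:Z])) :=
  (U q.1 * psi (next t (z q.1, q.1) (eps t.+1%:Z q.2), q.1))%:E.
have mzw : measurable_fun setT (fun w : sT H => (z w, w) : R * sT G).
  by apply/measurable_fun_pairP; split => //=; exact: measurable_fun_idg.
have meH : measurable_fun setT (eps t.+1%:Z : sT (ge [set t.+1%:Z]) -> R).
  exact: (measurable_generator (J := [set t.+1%:Z])).
have mF : measurable_fun setT F.
  apply/measurable_EFinP; apply: measurable_funM.
    exact: (measurableT_comp mU measurable_fst).
  apply: (measurableT_comp mpsi).
  apply: (measurableT_comp (measurable_next meH)
    (g := fun q : sT H * sT (ge [set t.+1%:Z]) => ((z q.1, q.1) : R * sT G, q.2))).
  apply/measurable_fun_pairP; split => /=; last exact: measurable_snd.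
  exact: (measurableT_comp mzw measurable_fst).
have F0 q : (0 <= F q)%E.
  rewrite lee_fin mulr_ge0//.
  by case/andP: (psi01 (next t (z q.1, q.1) (eps t.+1%:Z q.2), q.1)).
rewrite (integral_freeze HM eM indep mF F0).
apply: eq_integral => w _; rewrite /F /=.
under eq_integral do rewrite EFinM.
rewrite ge0_integralZl//; last 3 first.
- exact: (measurable_next_at (z w, w)).
- by move=> w' _; rewrite lee_fin;
    case/andP: (psi01 (next t (z w, w) (eps t.+1%:Z w'), w)).
- by rewrite lee_fin.
by rewrite EFinM kernel_opE.
Qed.

Lemma kernel_op_lin_bound (psi : R * T -> R) (p : R * T) (B C g k : R) :
  (\int[P]_w `|eps t.+1%:Z w|%:E <= 1)%E ->
  unit_fun G psi -> 0 <= B -> 0 <= C -> (forall z, 0 <= sigma z) ->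
  (`|r (Y t%:Z p.2, p.1)| + sigma (Y t%:Z p.2, p.1) <= g * `|p.1| + k) ->
  (forall x, psi (x, p.2) <= B * `|x| + C) ->
  kernel_op t psi p <= B * (g * `|p.1| + k) + C.
Proof.
move=> e1 upsi B0 C0 sig0 rs psiBC; have [mpsi psi01] := upsi.
set rr := r _ in rs; set ss := sigma _ in rs.
have ss0 : 0 <= ss by exact: sig0.
apply: (@le_trans _ _ (B * (`|rr| + ss) + C)); last first.
  by rewrite lerD2r ler_wpM2l.
rewrite -lee_fin kernel_opE//.
have me : measurable_fun setT (fun w => (`|eps t.+1%:Z w|)%:E).
  by apply/measurable_EFinP; exact: measurableT_comp.
apply: (@le_trans _ _ (\int[P]_w ((B * `|rr| + C)%:E +
    (B * ss)%:E * `|eps t.+1%:Z w|%:E))%E).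
  apply: ge0_le_integral => //.
  - by move=> w _; rewrite lee_fin; case/andP: (psi01
      (next t p (eps t.+1%:Z w), p.2)).
  - exact: measurable_next_at.
  - by apply: emeasurable_funD => //; exact: measurable_funeM.
  - move=> w _; rewrite -EFinM -EFinD lee_fin (le_trans (psiBC _))//.
    rewrite addrAC lerD2r -mulrA -mulrDr ler_wpM2l// (le_trans (ler_normD _ _))//.
    by rewrite lerD2l normrM mulrC (ger0_norm ss0).
rewrite ge0_integralD//; last 3 first.
- by move=> w _; rewrite lee_fin addr_ge0// mulr_ge0.
- by move=> w _; rewrite -EFinM lee_fin !mulr_ge0.
- exact: measurable_funeM.
rewrite integral_cst//= probability_setT mule1 ge0_integralZl//; last first.
  by rewrite lee_fin mulr_ge0.
apply: (@le_trans _ _ ((B * `|rr| + C)%:E + (B * ss)%:E * 1)%E).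
  by rewrite leeD2l// lee_wpmul2l// lee_fin mulr_ge0.
by rewrite mule1 -EFinD lee_fin mulrDr; lra.
Qed.

End kernel.

(** The noise after N is included so that a test function at time N can encode an event about the
    whole future of the chain; the chain up to time N uses only earlier noise. *)
Definition env (N : nat) : set_system T :=
  gY setT `|` ge [set k | (N%:Z < k)%R].

(** All of Y is known from the start, since the chain is studied given the environment. *)
Definition past (t : nat) : set_system T :=
  gY setT `|` ge [set k | (k <= t%:Z)%R].

Fixpoint chain (t k : nat) (z : T -> R) : T -> R :=
  if k is k'.+1 then chain t.+1 k' (fun w => next t (z w, w) (eps t.+1%:Z w))
  else z.

Lemma sub_generators (J J' K K' : set int) : J `<=` J' -> K `<=` K' ->
  gY J `|` ge K `<=` <<s gY J' `|` ge K' >>.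
Proof.
move=> JJ KK; apply: sub_generated => A [|] h; [left|right];
  by apply: generatorsS h.
Qed.

Lemma measurable_Y_sub (J K : set int) (k : int) : J k ->
  measurable_fun setT (Y k : sT (gY J `|` ge K) -> V).
Proof. by move=> Jk; apply: measurable_generator Jk _; exact: subsetUl. Qed.

Lemma measurable_eps_sub (J K : set int) (k : int) : K k ->
  measurable_fun setT (eps k : sT (gY J `|` ge K) -> R).
Proof. by move=> Kk; apply: measurable_generator Kk _; exact: subsetUr. Qed.

Lemma measurable_next_fun (G : set_system T) (t : nat) (z e : T -> R) :
  measurable_fun setT (Y t%:Z : sT G -> V) ->
  measurable_fun setT (z : sT G -> R) -> measurable_fun setT (e : sT G -> R) ->
  measurable_fun setT ((fun w => next t (z w, w) (e w)) : sT G -> R).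
Proof.
move=> mYG mz me.
have mYz : measurable_fun setT (fun w : sT G => (Y t%:Z w, z w)).
  by apply/measurable_fun_pairP; split.
apply: measurable_funD; first exact: (measurableT_comp mr mYz).
by apply: measurable_funM => //; exact: (measurableT_comp msigma mYz).
Qed.

Lemma unit_fun_kernel_iter (G : set_system T) t k psi :
  (forall s : nat, measurable_fun setT (Y s%:Z : sT G -> V)) ->
  unit_fun G psi -> unit_fun G (kernel_iter t k psi).
Proof.
move=> mYG upsi; elim: k t => //= k IH t.
exact: unit_fun_kernel_op.
Qed.

Lemma kernel_iter_onem (G : set_system T) t k psi :
  (forall s : nat, measurable_fun setT (Y s%:Z : sT G -> V)) ->
  unit_fun G psi ->
  kernel_iter t k (fun p => 1 - psi p) = fun p => 1 - kernel_iter t k psi p.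
Proof.
move=> mYG upsi; elim: k t => //= k IH t.
by rewrite IH (kernel_op_onem (mYG t) (unit_fun_kernel_iter _ _ mYG upsi)).
Qed.

Lemma measurable_chain (G : set_system T) (t k : nat) (z : T -> R) :
  (forall s, (t <= s < t + k)%N -> measurable_fun setT (Y s%:Z : sT G -> V)) ->
  (forall s, (t < s <= t + k)%N -> measurable_fun setT (eps s%:Z : sT G -> R)) ->
  measurable_fun setT (z : sT G -> R) ->
  measurable_fun setT (chain t k z : sT G -> R).
Proof.
elim: k t z => //= k IH t z hY he mz; apply: IH.
- by move=> s /andP[h1 h2]; apply: hY; rewrite (ltnW h1)/= addnS -addSn.
- by move=> s /andP[h1 h2]; apply: he; rewrite (ltnW h1)/= addnS -addSn.
apply: measurable_next_fun => //; first by apply: hY; rewrite leqnn addnS leq_addr.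
by apply: he; rewrite ltnSn addnS ltnS leq_addr.
Qed.

Lemma integral_chain (N t k : nat) (U z : T -> R) psi :
  (t + k <= N)%N -> measurable_fun setT (U : sT (past t) -> R) ->
  (forall w, 0 <= U w) -> measurable_fun setT (z : sT (past t) -> R) ->
  unit_fun (env N) psi ->
  (\int[P]_w (U w * psi (chain t k z w, w))%:E =
   \int[P]_w (U w * kernel_iter t k psi (z w, w))%:E)%E.
Proof.
move=> tkN mU U0 mz upsi.
have mYE (s : nat) : measurable_fun setT (Y s%:Z : sT (env N) -> V).
  exact: measurable_Y_sub.
elim: k t U z tkN mU U0 mz => //= k IH t U z tkN mU U0 mz.
have pS : past t `<=` <<s past t.+1 >>.
  by apply: sub_generators => // j /= jt; rewrite (le_trans jt)// lez_nat.
rewrite IH//; last 3 first.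
- by rewrite addSn -addnS.
- exact: measurable_fun_sub pS mU.
- apply: measurable_next_fun.
  + exact: measurable_Y_sub.
  + exact: measurable_fun_sub pS mz.
  + by apply: measurable_eps_sub => /=.
(* All noise but that of time t + 1: it contains the past, which carries U and z, as well as the
   noise after N, which psi may use. *)
pose H := gY setT `|` ge [set j | j != t.+1%:Z].
have pH : past t `<=` <<s H >>.
  apply: sub_generators => // j /= jt; apply/eqP => jE.
  by move: jt; rewrite jE lez_nat ltnn.
apply: (integral_kernel_op (mYE t) (H := H)) => //.
- exact: generators_sub.
- exact: generators_sub_measurable.
- apply: independent_env_noise; apply/seteqP; split => // j [/= + jE].
  by rewrite jE eqxx.
- apply: sub_generators => // j /= Nj; apply/eqP => jE.
  by move: Nj; rewrite jE ltz_nat ltnNge (leq_trans _ tkN)// addnS ltnS leq_addr.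
- exact: measurable_fun_sub pH mU.
- exact: measurable_fun_sub pH mz.
- exact: unit_fun_kernel_iter.
Qed.

Lemma sigma_preimage (G : set_system T) d' (U : measurableType d') (f : T -> U) :
  (forall A, G A -> exists2 D, measurable D & A = f @^-1` D) ->
  forall A, <<s G >> A -> exists2 D, measurable D & A = f @^-1` D.
Proof.
move=> GD.
suff : <<s G >> `<=` [set A | exists2 D, measurable D & A = f @^-1` D] by [].
apply: smallest_sub => //; split.
- by exists set0; rewrite ?preimage_set0.
- by move=> A [D mD ->]; exists (~` D); [exact: measurableC|rewrite setTD].
- move=> F FD.
  have /choice[D DP] k : exists D, measurable D /\ F k = f @^-1` D.
    by have [D mD FE] := FD k; exists D.
  exists (\bigcup_k D k).
    by apply: bigcupT_measurable => k; have [] := DP k.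
  rewrite preimage_bigcup; apply: eq_bigcupr => k _; by have [] := DP k.
Qed.

(* [U] is the conditional probability of [A] given [Y]. *)
Lemma conditional_given_Y (J K : set int) (A : set T) :
  <<s gY J `|` ge K >> A -> exists U : T -> R,
  [/\ measurable_fun setT (U : sT (gY J) -> R), forall w, 0 <= U w <= 1 &
    forall (L : set int) (Z : T -> R), L `&` K = set0 ->
      measurable_fun setT (Z : sT (gY setT `|` ge L) -> R) ->
      (forall w, 0 <= Z w <= 1) ->
      (\int[P]_w (\1_A w * Z w)%:E = \int[P]_w (U w * Z w)%:E)%E].
Proof.
move=> sA.
(* The event is pulled back by the diagonal from a set D in which the Y part and the noise part vary
   separately; integrating D over the second coordinate gives U. *)
have [D mD AD] : exists2 D : set (sT (gY J) * sT (ge K)), measurable D &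
    A = (fun w => (w, w)) @^-1` D.
  apply: sigma_preimage sA => B [B1|B2].
    exists (B `*` setT).
      by apply: measurableX => //; exact: sub_gen_smallest.
    by apply/seteqP; split => w //= [].
  exists (setT `*` B).
    by apply: measurableX => //; exact: sub_gen_smallest.
  by apply/seteqP; split => w //= [].
have eM : ge K `<=` measurable by exact: generators_sub_measurable.
have YM : gY J `<=` measurable by exact: generators_sub_measurable.
pose U w := fine (\int[P]_w' (\1_D (w, w'))%:E).
have mID : measurable_fun setT (\1_D : sT (gY J) * sT (ge K) -> R).
  exact: measurable_indic.
have mD1 : measurable_fun setT (fun q : sT (gY J) * T => \1_D (q.1, q.2) : R).
  apply: (measurableT_comp mID (g := fun q : sT (gY J) * T =>
    (q.1, q.2) : sT (gY J) * sT (ge K))).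
  apply/measurable_fun_pairP; split => /=; first exact: measurable_fst.
  apply: (measurableT_comp (measurable_fun_idT eM) (g := fun q : sT (gY J) * T => q.2)).
  exact: measurable_snd.
have mD1E : measurable_fun setT (fun q : sT (gY J) * T => (\1_D (q.1, q.2))%:E : \bar R).
  exact/measurable_EFinP.
have mDw w : measurable_fun setT (fun w' : T => \1_D (w, w') : R).
  exact: (measurableT_comp mD1 (pair1_measurable (w : sT (gY J)))).
have D01 q : 0 <= (\1_D q : R) <= 1.
  by rewrite indicE; case: (q \in D); rewrite ?lexx ler01.
have UE w : (U w)%:E = (\int[P]_w' (\1_D (w, w'))%:E)%E.
  rewrite /U fineK// ge0_fin_numE; last first.
    by apply: integral_ge0 => w' _; rewrite lee_fin.
  by apply: le_lt_trans (ltry 1); exact: integral_le1.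
exists U; split.
- apply: measurableT_comp => //.
  have := measurable_fun_fubini_tonelli_F (m2 := P) _ mD1E.
  by apply=> q; rewrite lee_fin.
- move=> w; rewrite -!lee_fin UE; apply/andP; split.
    by apply: integral_ge0 => w' _; rewrite lee_fin.
  exact: integral_le1.
move=> L Z LK mZ Z01.
have Z0 w : 0 <= Z w by case/andP: (Z01 w).
pose G := gY setT `|` ge L.
have GM : G `<=` measurable by exact: generators_sub.
pose F (q : sT G * sT (ge K)) := (\1_D (q.1, q.2) * Z q.1)%:E : \bar R.
have YG : gY J `<=` <<s G >>.
  by apply: sub_generated => B BJ; left; exact: generatorsS BJ.
have mF : measurable_fun setT F.
  apply/measurable_EFinP; apply: measurable_funM; last first.
    exact: (measurableT_comp mZ measurable_fst).
  apply: (measurableT_comp mID (g := fun q : sT G * sT (ge K) =>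
    (q.1, q.2) : sT (gY J) * sT (ge K))).
  apply/measurable_fun_pairP; split => /=; last exact: measurable_snd.
  exact: (measurableT_comp (measurable_fun_idg YG) measurable_fst).
have F0 q : (0 <= F q)%E by rewrite lee_fin mulr_ge0//; case/andP: (D01 (q.1, q.2)).
transitivity (\int[P]_w F (w, w))%E.
  by apply: eq_integral => w _; rewrite /F AD.
rewrite (integral_freeze GM eM (independent_env_noise LK) mF F0).
apply: eq_integral => w _; rewrite /F /=.
under eq_integral do rewrite mulrC.
by rewrite integral_scale// -UE -EFinM mulrC.
Qed.

(** The noises entering A and B belong to disjoint times, so the two indicators can be replaced one
    after the other by their conditional probabilities given Y. These are functions of Y before s
    and after t, to which [covariance_le] applies. *)
Lemma mixing_with_noise (alpha : R) (s t : nat) (A B : set T) :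
  (s <= t)%N ->
  (forall A B, <<s gY [set k | (k <= s%:Z)%R] >> A ->
     <<s gY [set k | (t%:Z <= k)%R] >> B ->
     (P (A `&` B) <= P A * P B + alpha%:E)%E) ->
  <<s gY [set k | (k <= s%:Z)%R] `|` ge [set k | (k <= s%:Z)%R] >> A ->
  <<s gY [set k | (t%:Z <= k)%R] `|` ge [set k | (t%:Z < k)%R] >> B ->
  (P (A `&` B) <= P A * P B + alpha%:E)%E.
Proof.
move=> st mix sA sB.
have mA : measurable A.
  exact: (smallest_sub (sigma_algebra_measurable T) (@generators_sub _ _) sA).
have mB : measurable B.
  exact: (smallest_sub (sigma_algebra_measurable T) (@generators_sub _ _) sB).
have [U [mU U01 UP]] := conditional_given_Y sA.
have [W [mW W01 WP]] := conditional_given_Y sB.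
have ind01 (C : set T) w : 0 <= (\1_C w : R) <= 1.
  by rewrite indicE; case: (w \in C); rewrite ?lexx ler01.
have disj1 : [set k : int | (k <= s%:Z)%R] `&` [set k | (t%:Z < k)%R] = set0.
  apply/seteqP; split => // k [/= h1 h2].
  have st' : (s%:Z <= t%:Z)%R by rewrite lez_nat.
  by have := le_lt_trans (le_trans h1 st') h2; rewrite ltxx.
have disj2 : (set0 : set int) `&` [set k | (k <= s%:Z)%R] = set0 by rewrite set0I.
have sAT : <<s gY setT `|` ge [set k | (k <= s%:Z)%R] >> A.
  apply: sub_smallest2r sA; first exact: smallest_sigma_algebra.
  by move=> C [|] h; [left|right] => //; exact: generatorsS h.
have mAT : measurable_fun setT (\1_A : sT (gY setT `|` ge [set k | (k <= s%:Z)%R]) -> R).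
  exact: (@measurable_indic _ (sT _) R setT A sAT).
have PE (C : set T) : measurable C -> P C = (\int[P]_w (\1_C w)%:E)%E.
  by move=> mC; rewrite integral_indic// setIT.
have PU : P A = (\int[P]_w (U w)%:E)%E.
  have := UP set0 (cst 1) disj2 (measurable_cst _) (fun _ => _).
  under eq_integral do rewrite mulr1; under [in RHS]eq_integral do rewrite mulr1.
  by rewrite -PE// => ->// w; rewrite /= ler01 lexx.
have PW : P B = (\int[P]_w (W w)%:E)%E.
  have := WP set0 (cst 1) (set0I _) (measurable_cst _) (fun _ => _).
  under eq_integral do rewrite mulr1; under [in RHS]eq_integral do rewrite mulr1.
  by rewrite -PE// => ->// w; rewrite /= ler01 lexx.
have -> : P (A `&` B) = (\int[P]_w (U w * W w)%:E)%E.
  rewrite PE; last exact: measurableI.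
  transitivity (\int[P]_w (\1_B w * \1_A w)%:E)%E.
    by apply: eq_integral => w _; rewrite indicI mulrC.
  rewrite (WP _ _ disj1 mAT (ind01 A)).
  transitivity (\int[P]_w (\1_A w * W w)%:E)%E.
    by apply: eq_integral => w _; rewrite mulrC.
  apply: (UP set0) => //; apply: measurable_fun_sub mW.
  by apply: sub_generated => C h; left; exact: generatorsS h.
rewrite PU PW; apply: (covariance_le _ _ mU mW) => //;
  exact: generators_sub_measurable.
Qed.

(** * Moments and comparison of laws given the environment *)

Section growth.
Variables (gamma K : V -> R).
Hypothesis mgamma : measurable_fun setT gamma.
Hypothesis mK : measurable_fun setT K.
Hypothesis gamma_ge0 : forall y, 0 <= gamma y.
Hypothesis K_ge0 : forall y, 0 <= K y.
Hypothesis sigma_ge0 : forall z, 0 <= sigma z.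
Hypothesis growth : forall y u, `|r (y, u)| + sigma (y, u) <= gamma y * `|u| + K y.
Hypothesis eps_abs : forall k, (\int[P]_w `|eps k w|%:E <= 1)%E.

Fixpoint decay (t k : nat) (w : T) : R :=
  if k is k'.+1 then gamma (Y t%:Z w) * decay t.+1 k' w else 1.

(** Given Y, the mean absolute state after k steps from x at time t is at most decay t k * |x| +
    drift t k. *)
Fixpoint drift (t k : nat) (w : T) : R :=
  if k is k'.+1 then K (Y t%:Z w) * decay t.+1 k' w + drift t.+1 k' w else 0.

Lemma decay_ge0 t k w : 0 <= decay t k w.
Proof. by elim: k t => //= k IH t; rewrite mulr_ge0. Qed.

Lemma drift_ge0 t k w : 0 <= drift t k w.
Proof. by elim: k t => //= k IH t; rewrite addr_ge0// mulr_ge0// decay_ge0. Qed.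

Lemma measurable_decay (G : set_system T) t k :
  (forall s, (t <= s < t + k)%N -> measurable_fun setT (Y s%:Z : sT G -> V)) ->
  measurable_fun setT (decay t k : sT G -> R).
Proof.
elim: k t => [|k IH] t hY /=; first exact: measurable_cst.
apply: measurable_funM.
  by apply: (measurableT_comp mgamma); apply: hY; rewrite leqnn addnS ltnS leq_addr.
by apply: IH => s /andP[h1 h2]; apply: hY; rewrite (ltnW h1)/= addnS -addSn.
Qed.

Lemma measurable_drift (G : set_system T) t k :
  (forall s, (t <= s < t + k)%N -> measurable_fun setT (Y s%:Z : sT G -> V)) ->
  measurable_fun setT (drift t k : sT G -> R).
Proof.
elim: k t => [|k IH] t hY /=; first exact: measurable_cst.
have hY' s : (t.+1 <= s < t.+1 + k)%N -> measurable_fun setT (Y s%:Z : sT G -> V).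
  by move=> /andP[h1 h2]; apply: hY; rewrite (ltnW h1)/= addnS -addSn.
apply: measurable_funD; last exact: IH.
apply: measurable_funM; last exact: measurable_decay.
by apply: (measurableT_comp mK); apply: hY; rewrite leqnn addnS ltnS leq_addr.
Qed.

(** Each step maps an affine bound in |x| to an affine bound, as the noise has mean absolute value
    at most 1. The bound is put on test functions, which keeps [kernel_op] within bounded
    functions. *)
Lemma kernel_iter_lin_bound (G : set_system T) t k psi B C w x :
  (forall s : nat, measurable_fun setT (Y s%:Z : sT G -> V)) ->
  unit_fun G psi -> 0 <= B -> 0 <= C ->
  (forall x, psi (x, w) <= B * `|x| + C) ->
  kernel_iter t k psi (x, w) <= B * (decay t k w * `|x| + drift t k w) + C.
Proof.
move=> mYG upsi B0 C0 hpsi; elim: k t x => [|k IH] t x /=.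
  by rewrite mul1r addr0.
have d0 := decay_ge0 t.+1 k w; have s0 := drift_ge0 t.+1 k w.
have psib x' : kernel_iter t.+1 k psi (x', w) <=
    (B * decay t.+1 k w) * `|x'| + (B * drift t.+1 k w + C).
  by rewrite addrA -mulrA -mulrDr; exact: IH.
have := kernel_op_lin_bound (mYG t) (p := (x, w)) (eps_abs t.+1%:Z)
  (unit_fun_kernel_iter t.+1 k mYG upsi) (mulr_ge0 B0 d0)
  (addr_ge0 (mulr_ge0 B0 s0) C0) sigma_ge0 (growth (Y t%:Z w) x) psib.
move=> /le_trans; apply; rewrite le_eqVlt; apply/orP; left; apply/eqP => /=.
by ring.
Qed.

Lemma measurable_unit_at (G : set_system T) psi (z : T -> R) :
  G `<=` measurable -> unit_fun G psi -> measurable_fun setT z ->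
  measurable_fun setT (fun w => psi (z w, w)).
Proof.
move=> GM [mpsi _] mz; apply: (measurableT_comp mpsi (g := fun w : T => (z w, w) : R * sT G)).
by apply/measurable_fun_pairP; split => //=; exact: measurable_fun_idT.
Qed.

Lemma unit_fun_weight (G : set_system T) psi Z :
  unit_fun G psi -> unit_weight G Z -> unit_fun G (fun p => Z p.2 * psi p).
Proof.
move=> [mpsi psi01] [mZ Z01]; split.
  by apply: measurable_funM => //; exact: (measurableT_comp mZ measurable_snd).
move=> p; have /andP[p0 p1] := psi01 p; have /andP[z0 z1] := Z01 p.2.
by rewrite mulr_ge0//= mulr_ile1.
Qed.

Lemma kernel_iter_weight (G : set_system T) t k psi Z :
  (forall s : nat, measurable_fun setT (Y s%:Z : sT G -> V)) ->
  unit_fun G psi -> unit_weight G Z ->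
  kernel_iter t k (fun p => Z p.2 * psi p) =
  fun p => Z p.2 * kernel_iter t k psi p.
Proof.
move=> mYG upsi uZ; elim: k t => //= k IH t; rewrite IH; apply/funext => p.
have up := unit_fun_kernel_iter t.+1 k mYG upsi; have [_ p01] := up.
have [_ /(_ p.2)/andP[Z0 _]] := uZ.
apply/EFin_inj; rewrite EFinM (kernel_opE (mYG t) p up).
rewrite (kernel_opE (mYG t) p (unit_fun_weight up uZ)) /=.
under eq_integral do rewrite EFinM.
rewrite ge0_integralZl//; last 2 first.
- exact: (measurable_next_at (mYG t) p up).
- by move=> w _; rewrite lee_fin; case/andP: (p01 (next t p (eps t.+1%:Z w), p.2)).
Qed.

(* On the event A, the law of z given the environment after time N differs from
   that of z' by at most W. *)
Definition close (N : nat) (A : set T) (z z' W : T -> R) :=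
  forall psi Z, unit_fun (env N) psi -> unit_weight (env N) Z ->
  (\int[P]_w (\1_A w * (Z w * psi (z w, w)))%:E <=
   \int[P]_w (\1_A w * (Z w * psi (z' w, w)))%:E + \int[P]_w (Z w * W w)%:E)%E.

Lemma env_sub N : env N `<=` measurable.
Proof. exact: generators_sub. Qed.

Lemma measurable_Y_env N (s : nat) :
  measurable_fun setT (Y s%:Z : sT (env N) -> V).
Proof. exact: measurable_Y_sub. Qed.

(** Common transitions do not increase the distance: the kernel maps test functions to test
    functions and commutes with weights that depend on the environment only. *)
Lemma close_chain N (A : set T) (z z' W : T -> R) t k : (t + k <= N)%N ->
  <<s past t >> A -> measurable_fun setT (z : sT (past t) -> R) ->
  measurable_fun setT (z' : sT (past t) -> R) ->
  close N A z z' W -> close N A (chain t k z) (chain t k z') W.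
Proof.
move=> tkN sA mz mz' cl psi Z upsi uZ.
have mA : measurable_fun setT (\1_A : sT (past t) -> R).
  exact: (@measurable_indic _ (sT (past t)) R setT A sA).
have uZpsi := unit_fun_weight upsi uZ.
rewrite (integral_chain tkN mA _ mz uZpsi)//.
rewrite (integral_chain tkN mA _ mz' uZpsi)//.
rewrite (kernel_iter_weight t k (@measurable_Y_env N) upsi uZ).
by apply: cl => //; apply: unit_fun_kernel_iter => //; exact: measurable_Y_env.
Qed.

Lemma close1 N (A : set T) (z z' : T -> R) : measurable A ->
  measurable_fun setT z -> close N A z z' (cst 1).
Proof.
move=> mA mz psi Z upsi uZ; have [_ psi01] := upsi; have [mZ Z01] := uZ.
have mZT := measurable_fun_subT (@env_sub N) mZ.
apply: (@le_trans _ _ (\int[P]_w (Z w * 1)%:E)%E).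
  apply: ge0_le_integral => //.
  - move=> w _; rewrite lee_fin !mulr_ge0//; first by case/andP: (Z01 w).
    by case/andP: (psi01 (z w, w)).
  - apply/measurable_EFinP; apply: measurable_funM => //.
    by apply: measurable_funM => //; exact: (measurable_unit_at (@env_sub N) upsi).
  - by apply/measurable_EFinP; exact: measurable_funM.
  - move=> w _; have /andP[p0 p1] := psi01 (z w, w); have /andP[z0 z1] := Z01 w.
    rewrite lee_fin indicE mulrC; case: (w \in A) => /=.
      by rewrite !mulr1 ler_piMr.
    by rewrite mulr0 mulr1.
rewrite leeDr//; apply: integral_ge0 => w _; rewrite lee_fin !mulr_ge0//.
  by case/andP: (Z01 w).
by case/andP: (psi01 (z' w, w)).
Qed.

(** The event W <= 1 belongs to the environment, so Z can be split along it: the hypothesis serves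
    on the event and the trivial error 1 off it. Errors in [0,1] are what [covariance_le]
    requires. *)
Lemma close_min1 N (A : set T) (z z' W : T -> R) : measurable A ->
  measurable_fun setT z -> measurable_fun setT z' ->
  measurable_fun setT (W : sT (env N) -> R) -> (forall w, 0 <= W w) ->
  close N A z z' W -> close N A z z' (fun w => Num.min 1 (W w)).
Proof.
move=> mA mz mz' mW W0 cl psi Z upsi uZ.
have [_ psi01] := upsi; have [mZ Z01] := uZ.
have mZT := measurable_fun_subT (@env_sub N) mZ.
have mWT := measurable_fun_subT (@env_sub N) mW.
have Z0 w : 0 <= Z w by case/andP: (Z01 w).
pose D := [set w | W w <= 1].
have sD : <<s env N >> D.
  have -> : D = W @^-1` `]-oo, 1].
    by apply/seteqP; split => w; rewrite /D /= in_itv.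
  by have := mW measurableT _ (measurable_itv `]-oo, 1%R]); rewrite setTI.
have mD : measurable D by exact: (smallest_sub (sigma_algebra_measurable T) (@env_sub N)).
have mi (B : set T) : <<s env N >> B -> unit_weight (env N) (fun w => \1_B w * Z w).
  move=> sB; split.
    by apply: measurable_funM.
  move=> w; rewrite indicE; case: (w \in B) => /=; first by rewrite mul1r.
  by rewrite mul0r lexx ler01.
have sDC : <<s env N >> (~` D) by exact: sigma_algebraC.
have split_int (f : T -> R) : (forall w, 0 <= f w) -> measurable_fun setT f ->
    (\int[P]_w (Z w * f w)%:E = \int[P]_w (\1_D w * Z w * f w)%:E +
     \int[P]_w (\1_(~` D) w * Z w * f w)%:E)%E.
  move=> f0 mf; rewrite -ge0_integralD//.
  - apply: eq_integral => w _; rewrite -EFinD -!mulrA -mulrDl !indicE in_setC.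
    by case: (w \in D); rewrite /= ?addr0 ?add0r mul1r.
  - by move=> w _; rewrite lee_fin !mulr_ge0.
  - apply/measurable_EFinP; apply: measurable_funM => //; exact: measurable_funM.
  - by move=> w _; rewrite lee_fin !mulr_ge0.
  - apply/measurable_EFinP; apply: measurable_funM => //; apply: measurable_funM => //.
    by apply: measurable_indic; exact: measurableC.
have psi_at z0 : measurable_fun setT z0 ->
    (forall w, 0 <= \1_A w * psi (z0 w, w)) /\
    measurable_fun setT (fun w => \1_A w * psi (z0 w, w)).
  move=> mz0; split.
    by move=> w; rewrite mulr_ge0//; case/andP: (psi01 (z0 w, w)).
  by apply: measurable_funM => //; exact: (measurable_unit_at (@env_sub N) upsi).
have E f g : (fun w => (\1_A w * (f w * g w))%:E) = (fun w => (f w * (\1_A w * g w))%:E)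
    :> (T -> \bar R).
  by apply/funext => w; rewrite mulrCA.
rewrite !E !split_int; last 6 first.
- by have [] := psi_at _ mz'.
- by have [] := psi_at _ mz'.
- by have [] := psi_at _ mz.
- by have [] := psi_at _ mz.
- by move=> w; rewrite le_min ler01 W0.
- exact: measurable_minr.
rewrite addeACA; apply: leeD.
  have := cl _ _ upsi (mi _ sD); rewrite !E => /le_trans; apply.
  rewrite leeD2l// le_eqVlt; apply/orP; left; apply/eqP; apply: eq_integral => w _.
  rewrite !indicE; case: (boolP (w \in D)) => [/set_mem Dw|_].
    by rewrite (min_idPr Dw).
  by rewrite !mul0r.
have := close1 z' mA mz upsi (mi _ sDC); rewrite !E => /le_trans; apply.
rewrite leeD2l// le_eqVlt; apply/orP; left; apply/eqP; apply: eq_integral => w _.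
rewrite !indicE in_setC; case: (boolP (w \in D)) => [_|/negP nDw].
  by rewrite /= !mul0r.
rewrite min_l//; case: (leP (W w) 1) => [h|/ltW//]; exfalso.
by apply: nDw; exact/mem_set.
Qed.

(* [phi] is clamped to [n eta, 1 - (1 - n) eta]; there it is an affine function
   of another unit function, with slope [1 - eta], and the constant term
   [n eta] cancels because both sides integrate it against the same weight. *)
Lemma close_contract N (A : set T) (z z' W n eta h Z : T -> R) phi :
  measurable A -> measurable_fun setT z -> measurable_fun setT z' ->
  measurable_fun setT W -> (forall w, 0 <= W w) ->
  close N A z z' W -> unit_fun (env N) phi -> unit_weight (env N) Z ->
  unit_weight (env N) n -> measurable_fun setT (eta : sT (env N) -> R) ->
  (forall w, 0 <= eta w <= 2^-1) -> measurable_fun setT h ->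
  (forall w, 0 <= h w) ->
  (forall x w, phi (x, w) <= 1 - (1 - n w) * eta w + h w * `|x|) ->
  (forall x w, n w * eta w - h w * `|x| <= phi (x, w)) ->
  (\int[P]_w (\1_A w * (Z w * phi (z w, w)))%:E <=
   \int[P]_w (\1_A w * (Z w * phi (z' w, w)))%:E +
   \int[P]_w (Z w * ((1 - eta w) * W w))%:E +
   (\int[P]_w (Z w * Num.min 1 (h w * `|z w|))%:E +
    \int[P]_w (Z w * Num.min 1 (h w * `|z' w|))%:E))%E.
Proof.
move=> mA mz mz' mW W0 cl uphi uZ un meta eta12 mh h0 phiu phil.
have [mphi phi01] := uphi; have [mZ Z01] := uZ; have [mn n01] := un.
have mZT := measurable_fun_subT (@env_sub N) mZ.
have Z0 w : 0 <= Z w by case/andP: (Z01 w).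
pose chi p := Num.max 0 (Num.min 1
  ((phi p - n p.2 * eta p.2) / (1 - eta p.2))).
have e1 w : 0 < 1 - eta w by have := eta12 w; lra.
have mn2 : measurable_fun setT (fun p : R * sT (env N) => n p.2).
  exact: (measurableT_comp mn measurable_snd).
have me2 : measurable_fun setT (fun p : R * sT (env N) => eta p.2).
  exact: (measurableT_comp meta measurable_snd).
have uchi : unit_fun (env N) chi.
  split; last first.
    move=> p; rewrite /chi le_max lexx /= ge_max ler01 /=.
    by rewrite ge_min lexx.
  apply: measurable_maxr => //; apply: measurable_minr => //.
  apply: measurable_funM.
    by apply: measurable_funB => //; exact: measurable_funM.
  have mi : measurable_fun setT (fun p : R * sT (env N) => 1 - eta p.2).
    exact: measurable_funB.
  have -> : (fun p : R * sT (env N) => (1 - eta p.2)^-1) =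
      (fun p => (1 - eta p.2) `^ (-1)).
    by apply/funext => p; rewrite powR_inv1// ltW.
  exact: measurableT_comp (measurable_powR _) mi.
pose clamp p := n p.2 * eta p.2 + (1 - eta p.2) * chi p.
have clampP x w : phi (x, w) <= clamp (x, w) + Num.min 1 (h w * `|x|) /\
    clamp (x, w) <= phi (x, w) + Num.min 1 (h w * `|x|).
  by apply: clamp_close; rewrite ?mulr_ge0.
have uclamp : unit_fun (env N) clamp.
  have [mchi chi01] := uchi; split.
    apply: measurable_funD; first exact: measurable_funM.
    by apply: measurable_funM => //; exact: measurable_funB.
  move=> p; have /andP[c0 c1] := chi01 p; have /andP[n0 n1] := n01 p.2.
  have /andP[t0 t1] := eta12 p.2; have ee := e1 p.2; rewrite /clamp.
  have nt0 : 0 <= n p.2 * eta p.2 by rewrite mulr_ge0.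
  have nt1 : n p.2 * eta p.2 <= eta p.2 by rewrite ler_piMl.
  have ct0 : 0 <= (1 - eta p.2) * chi p by rewrite mulr_ge0// ltW.
  have ct1 : (1 - eta p.2) * chi p <= 1 - eta p.2 by rewrite ler_piMr// ltW.
  by rewrite addr_ge0//= (le_trans (lerD nt1 ct1))// addrC subrK.
have AZ0 w : 0 <= \1_A w * Z w by rewrite mulr_ge0.
have mAZ : measurable_fun setT (fun w => \1_A w * Z w) by exact: measurable_funM.
have at_meas psi (z0 : T -> R) : unit_fun (env N) psi -> measurable_fun setT z0 ->
    measurable_fun setT (fun w => \1_A w * (Z w * psi (z0 w, w))).
  move=> upsi mz0; apply: measurable_funM => //; apply: measurable_funM => //.
  exact: (measurable_unit_at (@env_sub N) upsi).
have at_ge0 psi z0 w : unit_fun (env N) psi ->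
    0 <= \1_A w * (Z w * psi (z0 w, w)).
  by move=> [_ psi01]; rewrite !mulr_ge0//; case/andP: (psi01 (z0 w, w)).
have mZm (z0 : T -> R) : measurable_fun setT z0 ->
    measurable_fun setT (fun w => Z w * Num.min 1 (h w * `|z0 w|)).
  move=> mz0; apply: measurable_funM => //; apply: measurable_minr => //.
  by apply: measurable_funM => //; exact: measurableT_comp.
have Zm0 (z0 : T -> R) w : 0 <= Z w * Num.min 1 (h w * `|z0 w|).
  by rewrite mulr_ge0// le_min ler01 mulr_ge0.
have AZle (psi psi' : R * T -> R) (z0 : T -> R) w : psi (z0 w, w) <= psi' (z0 w, w) + Num.min 1 (h w * `|z0 w|) ->
    \1_A w * (Z w * psi (z0 w, w)) <=
    \1_A w * (Z w * psi' (z0 w, w)) + Z w * Num.min 1 (h w * `|z0 w|).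
  move=> hle; have Zw := Z0 w; have mm := Zm0 z0 w.
  rewrite indicE; case: (w \in A); rewrite /= ?mul0r ?mul1r ?add0r//.
  by rewrite -mulrDr ler_wpM2l.
have s1 : (\int[P]_w (\1_A w * (Z w * phi (z w, w)))%:E <=
    \int[P]_w (\1_A w * (Z w * clamp (z w, w)))%:E +
    \int[P]_w (Z w * Num.min 1 (h w * `|z w|))%:E)%E.
  apply: integral_leD => //; try exact: at_meas; try exact: mZm.
  - by move=> w; exact: (at_ge0 _ z w uphi).
  - by move=> w; exact: (at_ge0 _ z w uclamp).
  - by move=> w; apply: (AZle phi clamp); have [] := clampP (z w) w.
have s2 : (\int[P]_w (\1_A w * (Z w * clamp (z' w, w)))%:E <=
    \int[P]_w (\1_A w * (Z w * phi (z' w, w)))%:E +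
    \int[P]_w (Z w * Num.min 1 (h w * `|z' w|))%:E)%E.
  apply: integral_leD => //; try exact: at_meas; try exact: mZm.
  - by move=> w; exact: (at_ge0 _ z' w uclamp).
  - by move=> w; exact: (at_ge0 _ z' w uphi).
  - by move=> w; apply: (AZle clamp phi); have [] := clampP (z' w) w.
have uZ' : unit_weight (env N) (fun w => Z w * (1 - eta w)).
  split; first by apply: measurable_funM => //; exact: measurable_funB.
  move=> w; have /andP[z0 z1] := Z01 w; have ee := e1 w; have /andP[t0 t1] := eta12 w.
  have ee0 := ltW ee; have e1' : 1 - eta w <= 1 by rewrite gerBl.
  by rewrite mulr_ge0//= mulr_ile1.
have metaT := measurable_fun_subT (@env_sub N) meta.
have mnT := measurable_fun_subT (@env_sub N) mn.
have n0 w : 0 <= n w by case/andP: (n01 w).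
have eta0 w : 0 <= eta w by case/andP: (eta12 w).
have chi0 p : 0 <= chi p by have [_ /(_ p)/andP[]] := uchi.
have clampE (z0 : T -> R) : measurable_fun setT z0 ->
    (\int[P]_w (\1_A w * (Z w * clamp (z0 w, w)))%:E =
     \int[P]_w (\1_A w * Z w * (n w * eta w))%:E +
     \int[P]_w (\1_A w * (Z w * (1 - eta w) * chi (z0 w, w)))%:E)%E.
  move=> mz0; apply: integral_eqD.
  - by apply: measurable_funM => //; exact: measurable_funM.
  - apply: measurable_funM => //; apply: measurable_funM.
      by apply: measurable_funM => //; exact: measurable_funB.
    exact: (measurable_unit_at (@env_sub N) uchi).
  - by move=> w; rewrite mulr_ge0// mulr_ge0.
  - by move=> w; rewrite !mulr_ge0// ltW.
  - by move=> w; rewrite /clamp /=; ring.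
apply: (le_trans s1); rewrite (clampE z mz).
have s3 := cl _ _ uchi uZ'.
have -> : (\int[P]_w (Z w * ((1 - eta w) * W w))%:E =
           \int[P]_w (Z w * (1 - eta w) * W w)%:E)%E.
  by apply: eq_integral => w _; rewrite mulrA.
rewrite [X in (_ <= _ + X)%E]addeC addeA leeD2r//.
apply: (@le_trans _ _ (\int[P]_w (\1_A w * (Z w * clamp (z' w, w)))%:E +
  \int[P]_w (Z w * (1 - eta w) * W w)%:E)%E).
  by rewrite (clampE z' mz') -addeA leeD2l.
by rewrite addeAC leeD2r.
Qed.

(** Truncation at 1 makes h |z| a test function, still below the linear function of slope h that
    [kernel_iter_lin_bound] propagates. *)
Lemma integral_moment N s k x (h Z : T -> R) : (s + k <= N)%N ->
  unit_weight (env N) Z -> measurable_fun setT (h : sT (env N) -> R) ->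
  (forall w, 0 <= h w) ->
  (\int[P]_w (Z w * Num.min 1 (h w * `|chain s k (cst x) w|))%:E <=
   \int[P]_w (Z w * (h w * (decay s k w * `|x| + drift s k w)))%:E)%E.
Proof.
move=> skN uZ mh h0; have [mZ Z01] := uZ.
pose psi (p : R * T) := Z p.2 * Num.min 1 (h p.2 * `|p.1|).
have upsi : unit_fun (env N) psi.
  apply: (unit_fun_weight (psi := fun p => Num.min 1 (h p.2 * `|p.1|))) => //.
  split; last first.
    by move=> p; rewrite le_min ler01 mulr_ge0//= ge_min lexx.
  apply: measurable_minr => //; apply: measurable_funM.
    exact: (measurableT_comp mh measurable_snd).
  by apply: measurableT_comp => //; exact: measurable_fst.
have -> : (\int[P]_w (Z w * Num.min 1 (h w * `|chain s k (cst x) w|))%:E =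
    \int[P]_w ((cst 1 w) * psi (chain s k (cst x) w, w))%:E)%E.
  by apply: eq_integral => w _; rewrite /= mul1r.
rewrite (integral_chain skN _ _ _ upsi)//; [|exact: measurable_cst..].
have uit := unit_fun_kernel_iter s k (@measurable_Y_env N) upsi.
have Z0 w : 0 <= Z w by case/andP: (Z01 w).
apply: integral_le.
- apply: measurable_funM => //.
  exact: (measurable_unit_at (@env_sub N) uit (z := cst x)).
- apply: measurable_funM; first exact: (measurable_fun_subT (@env_sub N) mZ).
  apply: measurable_funM; first exact: (measurable_fun_subT (@env_sub N) mh).
  apply: measurable_funD.
    apply: measurable_funM => //; apply: (measurable_fun_subT (@env_sub N)).
    by apply: measurable_decay => *; exact: measurable_Y_env.
  apply: (measurable_fun_subT (@env_sub N)).
  by apply: measurable_drift => *; exact: measurable_Y_env.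
- by move=> w; have [_ /(_ (x, w))/andP[h1 _]] := uit; rewrite mul1r.
- move=> w; rewrite mul1r.
  have := @kernel_iter_lin_bound _ s k psi (Z w * h w) 0 w x
    (@measurable_Y_env N) upsi.
  rewrite addr0 -mulrA; apply=> //; first by rewrite mulr_ge0.
  move=> x'; rewrite addr0 /psi /= -mulrA ler_wpM2l// ge_min.
  by rewrite lexx orbT.
Qed.

Lemma kernel_iter_rcons t k psi :
  kernel_iter t k.+1 psi = kernel_iter t k (kernel_op (t + k) psi).
Proof.
elim: k t => [|k IH] t; first by rewrite addn0.
by rewrite [LHS]/= -/(kernel_iter t.+1 k.+1 psi) IH addSnnS.
Qed.

Lemma chainD t k l z : chain t (k + l) z = chain (t + k) l (chain t k z).
Proof.
elim: k t z => [|k IH] t z; first by rewrite addn0.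
by rewrite addSn [LHS]/= IH addSnnS.
Qed.

(** * Coupling along blocks *)

Section coupling.
Variables (good : set V) (rho eta0 : R).
Hypothesis mgood : measurable good.
Hypothesis rho_ge1 : 1 <= rho.
Hypothesis eta0_01 : 0 <= eta0 <= 1.

Definition base_mean (psi : R * T -> R) (w : T) : R :=
  fine (\int[uniform_prob (@ltr01 R)]_z (psi (z, w))%:E).

Hypothesis minorization : forall (t : nat) (w : T) (psi : R -> R) (x : R),
  good (Y t%:Z w) -> `|x| <= rho ->
  measurable_fun setT psi -> (forall z, 0 <= psi z <= 1) ->
  (eta0%:E * \int[uniform_prob (@ltr01 R)]_z (psi z)%:E <=
   \int[P]_w' (psi (r (Y t%:Z w, x) + eps t.+1%:Z w' * sigma (Y t%:Z w, x)))%:E)%E.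

Lemma measurable_section (G : set_system T) psi w : unit_fun G psi ->
  measurable_fun setT (fun z : R => psi (z, w)).
Proof.
by move=> [mpsi _]; exact: (measurableT_comp mpsi (pair2_measurable (w : sT G))).
Qed.

Lemma base_meanE (G : set_system T) psi w : unit_fun G psi ->
  (base_mean psi w)%:E = (\int[uniform_prob (@ltr01 R)]_z (psi (z, w))%:E)%E.
Proof.
move=> upsi; have mw := measurable_section w upsi; have [_ psi01] := upsi.
rewrite /base_mean fineK// ge0_fin_numE; last first.
  by apply: integral_ge0 => z _; rewrite lee_fin; case/andP: (psi01 (z, w)).
by apply: le_lt_trans (ltry 1); apply: integral_le1.
Qed.

Lemma unit_weight_base_mean (G : set_system T) psi : unit_fun G psi ->
  unit_weight G (base_mean psi).
Proof.
move=> upsi; have [mpsi psi01] := upsi; split.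
  apply: measurableT_comp => //.
  have mF : measurable_fun setT (fun q : sT G * R => (psi (q.2, q.1))%:E).
    apply/measurable_EFinP; apply: (measurableT_comp mpsi
      (g := fun q : sT G * R => (q.2, q.1))).
    by apply/measurable_fun_pairP; split => /=;
      [exact: measurable_snd|exact: measurable_fst].
  have := measurable_fun_fubini_tonelli_F (m2 := uniform_prob (@ltr01 R)) _ mF.
  by apply=> q; rewrite lee_fin; case/andP: (psi01 (q.2, q.1)).
move=> w; rewrite -!lee_fin (base_meanE w upsi); apply/andP; split.
  by apply: integral_ge0 => z _; rewrite lee_fin; case/andP: (psi01 (z, w)).
by apply: integral_le1 => //; exact: (measurable_section w upsi).
Qed.

Lemma base_mean_onem (G : set_system T) psi w : unit_fun G psi ->
  base_mean (fun p => 1 - psi p) w = 1 - base_mean psi w.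
Proof.
move=> upsi; have upsi' := unit_fun_onem upsi.
have [_ psi01] := upsi; have [_ psi01'] := upsi'.
suff : ((base_mean (fun p => 1 - psi p) w)%:E + (base_mean psi w)%:E = 1)%E.
  by move=> /(congr1 fine) /= h; apply/eqP; rewrite -subr_eq0 opprB addrA h subrr.
rewrite (base_meanE w upsi) (base_meanE w upsi').
rewrite -(integral_eqD _ (f := cst 1)).
- by rewrite (eq_integral (cst 1%E))// integral_cst//= probability_setT mule1.
- exact: (measurable_section w upsi').
- exact: (measurable_section w upsi).
- by move=> z; case/andP: (psi01' (z, w)).
- by move=> z; case/andP: (psi01 (z, w)).
- by move=> z; rewrite subrK.
Qed.

(** Half of eta0 pays for the drift, which is at most rho / 2; the starting point costs decay * |x|,
    as rho >= 1. *)
Lemma kernel_iter_minorized N t m psi x w :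
  unit_fun (env N) psi -> good (Y (t + m)%N%:Z w) -> drift t m w <= rho / 2 ->
  base_mean psi w * (eta0 / 2) - decay t m w * `|x| <=
    kernel_iter t m.+1 psi (x, w).
Proof.
move=> upsi gw dw; rewrite kernel_iter_rcons.
have mYG := @measurable_Y_env N.
have uk := unit_fun_kernel_op (mYG (t + m)%N) upsi; have [_ k01] := uk.
have [_ /(_ w)/andP[n0 n1]] := unit_weight_base_mean upsi.
set n := base_mean psi w in n0 n1 *.
have /andP[e0 e1] := eta0_01.
have rho0 : 0 < rho by exact: lt_le_trans rho_ge1.
have en0 : 0 <= eta0 * n by rewrite mulr_ge0.
have en1 : eta0 * n <= 1 by rewrite mulr_ile1.
have kn x' : `|x'| <= rho -> eta0 * n <= kernel_op (t + m) psi (x', w).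
  move=> xr; rewrite -lee_fin (kernel_opE (mYG _) _ upsi) EFinM (base_meanE w upsi).
  apply: (minorization gw xr (psi := fun z => psi (z, w))).
    exact: (measurable_section w upsi).
  by move=> z; have [_ ] := upsi.
(* The complement is at most 1 - eta0 n in the ball and at most 1 outside. A single affine function
   of |x'| dominates both, so the m previous steps can be applied to it. *)
have lin x' : 1 - kernel_op (t + m) psi (x', w) <=
    (eta0 * n / rho) * `|x'| + (1 - eta0 * n).
  case: (leP `|x'| rho) => xr.
    have h1 := kn _ xr.
    have h2 : 0 <= eta0 * n / rho * `|x'| by rewrite !mulr_ge0// invr_ge0 ltW.
    by lra.
  have /andP[h0 _] := k01 (x', w).
  have : eta0 * n <= eta0 * n / rho * `|x'|.
    by rewrite -mulrA ler_peMr// mulrC ler_pdivlMr// mul1r ltW.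
  by lra.
have := @kernel_iter_lin_bound _ t m _ (eta0 * n / rho) (1 - eta0 * n) w x
  mYG (unit_fun_onem uk) (divr_ge0 en0 (ltW rho0)) _ lin.
rewrite subr_ge0 (kernel_iter_onem _ _ mYG uk) => /(_ en1).
have hd : eta0 * n / rho * drift t m w <= eta0 * n / 2.
  rewrite -!mulrA; apply: ler_wpM2l => //; apply: ler_wpM2l => //.
  by rewrite mulrC ler_pdivrMr// mulrC.
have hg : eta0 * n / rho * (decay t m w * `|x|) <= decay t m w * `|x|.
  rewrite ler_piMl ?mulr_ge0 ?decay_ge0// ler_pdivrMr// mul1r.
  exact: le_trans rho_ge1.
by rewrite mulrDr; lra.
Qed.

Definition good_block (t m : nat) : set T :=
  [set w | drift t m w <= rho / 2 /\ good (Y (t + m)%N%:Z w)].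

Definition coupling_rate (t m : nat) (w : T) : R :=
  eta0 / 2 * \1_(good_block t m) w.

Definition excess (t m : nat) (w : T) : R :=
  \1_(good_block t m) w * decay t m w.

Lemma coupling_rate_bounds t m w : 0 <= coupling_rate t m w <= 2^-1.
Proof.
have /andP[e0 e1] := eta0_01.
rewrite /coupling_rate indicE; case: (w \in _) => /=; rewrite ?mulr0 ?mulr1.
  by apply/andP; split; lra.
by rewrite lexx /= invr_ge0 ler0n.
Qed.

Lemma excess_ge0 t m w : 0 <= excess t m w.
Proof. by rewrite mulr_ge0// decay_ge0. Qed.

Lemma sigma_good_block (G : set_system T) t m :
  (forall s, (t <= s <= t + m)%N -> measurable_fun setT (Y s%:Z : sT G -> V)) ->
  <<s G >> (good_block t m).
Proof.
move=> mYG.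
have -> : good_block t m = (drift t m @^-1` `]-oo, rho / 2]) `&`
    (Y (t + m)%N%:Z @^-1` good).
  by apply/seteqP; split => w; rewrite /good_block /= in_itv.
apply: setI_closed_sigma.
  have md : measurable_fun setT (drift t m : sT G -> R).
    by apply: measurable_drift => s /andP[h1 h2]; apply: mYG; rewrite h1 ltnW.
  by have := md measurableT _ (measurable_itv `]-oo, rho / 2]); rewrite setTI.
have := mYG (t + m)%N; rewrite leq_addr leqnn => /(_ isT) mYt.
by have := mYt measurableT _ mgood; rewrite setTI.
Qed.

Lemma measurable_coupling_rate (G : set_system T) t m :
  (forall s, (t <= s <= t + m)%N -> measurable_fun setT (Y s%:Z : sT G -> V)) ->
  measurable_fun setT (coupling_rate t m : sT G -> R).
Proof.
move=> mYG; apply: measurable_funM => //.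
exact: (@measurable_indic _ (sT G) R setT _ (sigma_good_block mYG)).
Qed.

Lemma measurable_excess (G : set_system T) t m :
  (forall s, (t <= s <= t + m)%N -> measurable_fun setT (Y s%:Z : sT G -> V)) ->
  measurable_fun setT (excess t m : sT G -> R).
Proof.
move=> mYG; apply: measurable_funM => //.
  exact: (@measurable_indic _ (sT G) R setT _ (sigma_good_block mYG)).
by apply: measurable_decay => s /andP[h1 h2]; apply: mYG; rewrite h1 ltnW.
Qed.

(** A weak form of the bound M on the mean of |z| given the environment, in the truncated and
    weighted shape in which [close_contract] produces its errors. *)
Definition moment_bound N (z M : T -> R) := forall (h Z : T -> R),
  unit_weight (env N) Z -> measurable_fun setT (h : sT (env N) -> R) ->
  (forall w, 0 <= h w) ->
  (\int[P]_w (Z w * Num.min 1 (h w * `|z w|))%:E <=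
   \int[P]_w (Z w * (h w * M w))%:E)%E.

(** Contraction with n the mean of psi under the uniform law, slope [coupling_rate] and defect
    [excess]: on a good block the two laws share a uniform component. *)
Lemma close_block N (A : set T) (z z' W M M' : T -> R) t m :
  (t + m.+1 <= N)%N -> <<s past t >> A ->
  measurable_fun setT (z : sT (past t) -> R) ->
  measurable_fun setT (z' : sT (past t) -> R) ->
  measurable_fun setT W -> (forall w, 0 <= W w) ->
  measurable_fun setT M -> (forall w, 0 <= M w) ->
  measurable_fun setT M' -> (forall w, 0 <= M' w) ->
  moment_bound N z M -> moment_bound N z' M' -> close N A z z' W ->
  close N A (chain t m.+1 z) (chain t m.+1 z') (fun w =>
    (1 - coupling_rate t m w) * W w + excess t m w * (M w + M' w)).
Proof.
move=> tmN sA mz mz' mW W0 mM M0 mM' M'0 zM zM' cl psi Z upsi uZ.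
have [mZ Z01] := uZ; have Z0 w : 0 <= Z w by case/andP: (Z01 w).
have mYG := @measurable_Y_env N.
have pM : past t `<=` measurable by exact: generators_sub.
have mA : measurable A by exact: (smallest_sub (sigma_algebra_measurable T) pM).
have mzT := measurable_fun_subT pM mz; have mzT' := measurable_fun_subT pM mz'.
have mAp : measurable_fun setT (\1_A : sT (past t) -> R).
  exact: (@measurable_indic _ (sT (past t)) R setT A sA).
have uZpsi := unit_fun_weight upsi uZ.
rewrite (integral_chain tmN mAp _ mz uZpsi)//.
rewrite (integral_chain tmN mAp _ mz' uZpsi)//.
rewrite (kernel_iter_weight t m.+1 mYG upsi uZ).
set phi := kernel_iter t m.+1 psi.
have uphi : unit_fun (env N) phi by exact: unit_fun_kernel_iter.
have [_ phi01] := uphi.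
have un := unit_weight_base_mean upsi; have [_ n01] := un.
have me : measurable_fun setT (coupling_rate t m : sT (env N) -> R).
  exact: measurable_coupling_rate.
have mh : measurable_fun setT (excess t m : sT (env N) -> R).
  exact: measurable_excess.
have meT := measurable_fun_subT (@env_sub N) me.
have mhT := measurable_fun_subT (@env_sub N) mh.
have mZT := measurable_fun_subT (@env_sub N) mZ.
apply: (le_trans (close_contract mA mzT mzT' mW W0 cl uphi uZ un me
  (coupling_rate_bounds t m) mhT (excess_ge0 t m) _ _)).
(* The upper bound on phi is the minorization applied to 1 - psi. *)
- move=> x w; rewrite /coupling_rate /excess indicE.
  case: (boolP (w \in good_block t m)) => [/set_mem[dw gw]|_] /=.
    have := kernel_iter_minorized x (unit_fun_onem upsi) gw dw.
    rewrite (base_mean_onem w upsi) (kernel_iter_onem _ _ mYG upsi) -/phi.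
    by rewrite mulr1 mul1r; lra.
  by rewrite !(mulr0, mul0r) subr0 addr0; case/andP: (phi01 (x, w)).
- move=> x w; rewrite /coupling_rate /excess indicE.
  case: (boolP (w \in good_block t m)) => [/set_mem[dw gw]|_] /=.
    by have := kernel_iter_minorized x upsi gw dw; rewrite mulr1 mul1r.
  by rewrite !(mulr0, mul0r) subr0; case/andP: (phi01 (x, w)).
rewrite -addeA leeD2l//.
have r1 w : 0 <= 1 - coupling_rate t m w.
  by have := coupling_rate_bounds t m w; lra.
have ZhM0 (B : T -> R) : (forall w, 0 <= B w) ->
    forall w, 0 <= Z w * (excess t m w * B w).
  by move=> B0 w; rewrite mulr_ge0// mulr_ge0// excess_ge0.
have mZhM (B : T -> R) : measurable_fun setT B ->
    measurable_fun setT (fun w => Z w * (excess t m w * B w)).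
  by move=> mB; apply: measurable_funM => //; exact: measurable_funM.
have -> : (\int[P]_w (Z w * ((1 - coupling_rate t m w) * W w +
      excess t m w * (M w + M' w)))%:E =
    \int[P]_w (Z w * ((1 - coupling_rate t m w) * W w))%:E +
    (\int[P]_w (Z w * (excess t m w * M w))%:E +
     \int[P]_w (Z w * (excess t m w * M' w))%:E))%E.
  rewrite -(integral_eqD _ (f := fun w => Z w * (excess t m w * (M w + M' w)))).
  - apply: integral_eqD.
    + apply: measurable_funM => //; apply: measurable_funM => //.
      exact: measurable_funB.
    + by apply: mZhM; exact: measurable_funD.
    + by move=> w; rewrite mulr_ge0// mulr_ge0.
    + by apply: ZhM0 => w; rewrite addr_ge0.
    + by move=> w; rewrite mulrDr.
  - exact: mZhM.
  - exact: mZhM.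
  - exact: ZhM0.
  - exact: ZhM0.
  - by move=> w; rewrite !mulrDr.
by rewrite leeD2l// leeD//; [apply: zM|apply: zM'] => // w; exact: excess_ge0.
Qed.

Section blocks.
Variables (x : R) (s m : nat).

(** A block has m idle steps, during which Y decorrelates, followed by the m + 1 steps of
    [close_block]. *)
Definition block_start (i : nat) : nat := (s + i * (m + m.+1))%N.

(* Bounds the sum of the mean absolute states at time t, given Y, of the chains
   started at x at the times 0 and s. *)
Definition state_bound (t : nat) (w : T) : R :=
  (decay 0 t w * `|x| + drift 0 t w) + drift s (t - s) w.

(** The distance between the two laws after i blocks, given Y, starting from the trivial bound 1.
    The rate involves Y only after the idle steps of the block, whereas [uncoupled i'] involves Y
    only before them. *)
Fixpoint uncoupled (i : nat) (w : T) : R :=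
  if i is i'.+1 then
    let t := (block_start i' + m)%N in
    Num.min 1 ((1 - coupling_rate t m w) * uncoupled i' w +
               excess t m w * state_bound t w)
  else 1.

Lemma state_bound_ge0 t w : 0 <= state_bound t w.
Proof.
by rewrite !addr_ge0 ?drift_ge0// mulr_ge0// decay_ge0.
Qed.

Lemma uncoupled_bounds i w : 0 <= uncoupled i w <= 1.
Proof.
elim: i => [|i /andP[IH0 IH1]] /=; first by rewrite lexx ler01.
rewrite ge_min lexx /= le_min ler01 /= andbT.
have /andP[r0 r1] := coupling_rate_bounds (block_start i + m) m w.
rewrite addr_ge0// mulr_ge0 ?excess_ge0 ?state_bound_ge0//.
by lra.
Qed.

Lemma block_startS i : block_start i.+1 = (block_start i + m + m.+1)%N.
Proof. by rewrite /block_start mulSn [(m + m.+1 + _)%N]addnC !addnA. Qed.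

Lemma leq_block_start i : (s <= block_start i)%N.
Proof. exact: leq_addr. Qed.

Lemma measurable_state_bound (G : set_system T) t :
  (forall u, (u < t)%N -> measurable_fun setT (Y u%:Z : sT G -> V)) ->
  (s <= t)%N -> measurable_fun setT (state_bound t : sT G -> R).
Proof.
move=> mYG st; apply: measurable_funD.
  apply: measurable_funD; last first.
    by apply: measurable_drift => u /andP[_ h]; exact: mYG.
  apply: measurable_funM => //.
  by apply: measurable_decay => u /andP[_ h]; exact: mYG.
by apply: measurable_drift => u /andP[_ h]; apply: mYG; rewrite subnKC in h.
Qed.

Lemma measurable_uncoupled (G : set_system T) i :
  (forall u, (u < block_start i)%N -> measurable_fun setT (Y u%:Z : sT G -> V)) ->
  measurable_fun setT (uncoupled i : sT G -> R).
Proof.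
elim: i => [|i IH] mYG /=; first exact: measurable_cst.
have mYi u : (u < block_start i + m + m.+1)%N ->
    measurable_fun setT (Y u%:Z : sT G -> V) by rewrite -block_startS; exact: mYG.
apply: measurable_minr => //; apply: measurable_funD.
  apply: measurable_funM; last first.
    by apply: IH => u ui; apply: mYi; rewrite -addnA ltn_addr.
  apply: measurable_funB => //; apply: measurable_coupling_rate => u /andP[_ h].
  by apply: mYi; rewrite addnS ltnS.
apply: measurable_funM.
  by apply: measurable_excess => u /andP[_ h]; apply: mYi; rewrite addnS ltnS.
apply: measurable_state_bound; last by rewrite (leq_trans (leq_block_start i))// leq_addr.
by move=> u h; apply: mYi; rewrite ltn_addr.
Qed.

(** Each block is crossed by [close_chain] on the idle steps, then [close_block], then [close_min1].
    The second chain restarts from 0, so that its moment bound is the drift since time s alone. *)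
Lemma close_uncoupled N (A : set T) i : (block_start i <= N)%N ->
  <<s past s >> A ->
  close N A (chain 0 (block_start i) (cst x))
    (chain s (block_start i - s) (cst 0)) (uncoupled i).
Proof.
move=> iN sA.
have pS t : (s <= t)%N -> past s `<=` <<s past t >>.
  by move=> st; apply: sub_generators => // j /= js; rewrite (le_trans js)// lez_nat.
have mzt t : measurable_fun setT (chain 0 t (cst x) : sT (past t) -> R).
  apply: measurable_chain => //.
    by move=> u _; exact: measurable_Y_sub.
  by move=> u /andP[_ h]; apply: measurable_eps_sub; rewrite /= lez_nat.
have mzt' t : (s <= t)%N ->
    measurable_fun setT (chain s (t - s) (cst 0) : sT (past t) -> R).
  move=> st; apply: measurable_chain => //.
    by move=> u _; exact: measurable_Y_sub.
  move=> u /andP[_ h]; rewrite subnKC// in h.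
  by apply: measurable_eps_sub; rewrite /= lez_nat.
have pM t : past t `<=` measurable by exact: generators_sub.
have mA : measurable A by exact: (smallest_sub (sigma_algebra_measurable T) (pM s)).
elim: i iN => [|i IH] iN.
  apply: close1 => //; rewrite /block_start mul0n addn0.
  exact: (measurable_fun_subT (pM s)).
set t := (block_start i + m)%N.
have tN : (t + m.+1 <= N)%N by rewrite /t -block_startS.
have st : (s <= t)%N by rewrite /t (leq_trans (leq_block_start i))// leq_addr.
have iN' : (block_start i + m <= N)%N by rewrite (leq_trans _ tN)// leq_addr.
have sAt u : (s <= u)%N -> <<s past u >> A.
  move=> su; exact: (smallest_sub (smallest_sigma_algebra _ _) (pS _ su)).
have chain_split z u k v : (v <= u)%N ->
    chain u k (chain v (u - v) z) = chain v (u + k - v) z.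
  by move=> vu; rewrite addnC -addnBA// addnC chainD subnKC.
have cl := close_chain iN' (sAt _ (leq_block_start i)) (mzt _)
  (mzt' _ (leq_block_start i)) (IH (leq_trans (leq_addr _ _) iN')).
rewrite -[X in chain 0 X _]subn0 !chain_split ?leq_block_start// subn0 in cl.
rewrite -/t in cl.
have mE (f : T -> R) : measurable_fun setT (f : sT (env N) -> R) ->
  measurable_fun setT f by exact: measurable_fun_subT (@env_sub N).
have mYE := @measurable_Y_env N.
have mM : measurable_fun setT (fun w => decay 0 t w * `|x| + drift 0 t w).
  apply: mE; apply: measurable_funD; last exact: measurable_drift.
  by apply: measurable_funM => //; exact: measurable_decay.
have mM' : measurable_fun setT (drift s (t - s)).
  by apply: mE; exact: measurable_drift.
have M0 w : 0 <= decay 0 t w * `|x| + drift 0 t w.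
  by rewrite addr_ge0 ?drift_ge0// mulr_ge0// decay_ge0.
have mW : measurable_fun setT (uncoupled i : sT (env N) -> R).
  exact: measurable_uncoupled.
have W0 w : 0 <= uncoupled i w by case/andP: (uncoupled_bounds i w).
have zM : moment_bound N (chain 0 t (cst x))
    (fun w => decay 0 t w * `|x| + drift 0 t w).
  move=> h Z uZ mh h0; apply: (integral_moment (N := N)) => //.
have zM' : moment_bound N (chain s (t - s) (cst 0)) (drift s (t - s)).
  move=> h Z uZ mh h0.
  have tsN : (s + (t - s) <= N)%N by rewrite subnKC// (leq_trans _ tN)// leq_addr.
  have := integral_moment 0 tsN uZ mh h0.
  by under [X in (_ <= X)%E -> _]eq_integral do rewrite normr0 mulr0 add0r.
have := close_block tN (sAt _ st) (mzt t) (mzt' _ st) (mE _ mW) W0 mM M0 mM'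
  (drift_ge0 _ _) zM zM' cl.
rewrite -[X in chain 0 X _]subn0 !chain_split// subn0.
rewrite -block_startS => /close_min1; apply => //.
- exact: (measurable_fun_subT (pM _) (mzt _)).
- apply: (measurable_fun_subT (pM _) (mzt' _ _)); exact: leq_block_start.
- apply: measurable_funD; apply: measurable_funM.
  + by apply: measurable_funB => //; exact: measurable_coupling_rate.
  + exact: measurable_uncoupled.
  + exact: measurable_excess.
  + exact: measurable_state_bound.
- move=> w; have /andP[r0 r1] := coupling_rate_bounds t m w.
  apply: addr_ge0; first by apply: mulr_ge0 => //; lra.
  by apply: mulr_ge0; [exact: excess_ge0|exact: state_bound_ge0].
Qed.

(** The means satisfy u' <= (1 - eta0 / 4) u + alpha + h, whose fixed point is (alpha + h) / (eta0 /
    4). *)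
Lemma integral_uncoupled (alpha h : R) i :
  0 < eta0 -> 0 <= alpha -> 0 <= h ->
  (forall (t : nat) A B, <<s gY [set k | (k <= t%:Z)%R] >> A ->
     <<s gY [set k | ((t + m)%N%:Z <= k)%R] >> B ->
     (P (A `&` B) <= P A * P B + alpha%:E)%E) ->
  (forall t, (P (~` good_block t m) <= (2^-1)%:E)%E) ->
  (forall t, (s <= t)%N ->
     (\int[P]_w (decay t m w * state_bound t w)%:E <= h%:E)%E) ->
  (\int[P]_w (uncoupled i w)%:E <=
    ((1 - eta0 / 4) ^+ i + (alpha + h) / (eta0 / 4))%:E)%E.
Proof.
move=> e0 a0 h0 mix pgood hexc.
have /andP[_ e1] := eta0_01.
have mYT k : measurable_fun setT (Y k) by [].
have mT (f : T -> R) : measurable_fun setT (f : sT (env 0) -> R) ->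
  measurable_fun setT f by exact: measurable_fun_subT (@env_sub 0).
have mYE := @measurable_Y_env 0.
elim: i => [|i IH].
  rewrite /= integral_cst//= probability_setT mule1 lee_fin expr0 lerDl.
  by rewrite divr_ge0 ?addr_ge0// divr_ge0// ltW.
set t := (block_start i + m)%N.
have st : (s <= t)%N by rewrite /t (leq_trans (leq_block_start i))// leq_addr.
have mG := sigma_good_block (t := t) (m := m) (fun u _ => mYE u).
have mGT : measurable (good_block t m).
  exact: (smallest_sub (sigma_algebra_measurable T) (@env_sub 0)).
have mr1 : measurable_fun setT (coupling_rate t m).
  by apply: mT; exact: measurable_coupling_rate.
have rb w := coupling_rate_bounds t m w.
have r1 w : 0 <= 1 - coupling_rate t m w <= 1 by have := rb w; lra.
have mW : measurable_fun setT (uncoupled i) by apply: mT; exact: measurable_uncoupled.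
have W01 := uncoupled_bounds i.
have W0 w : 0 <= uncoupled i w by case/andP: (W01 w).
have msb : measurable_fun setT (state_bound t) by apply: mT; exact: measurable_state_bound.
have mex : measurable_fun setT (excess t m) by apply: mT; exact: measurable_excess.
have mde : measurable_fun setT (decay t m) by apply: mT; exact: measurable_decay.
apply: (@le_trans _ _ (\int[P]_w (uncoupled i w * (1 - coupling_rate t m w))%:E +
    \int[P]_w (decay t m w * state_bound t w)%:E)%E).
  apply: integral_leD.
  - by apply: mT; exact: measurable_uncoupled.
  - by apply: measurable_funM => //; exact: measurable_funB.
  - exact: measurable_funM.
  - by move=> w; case/andP: (uncoupled_bounds i.+1 w).
  - by move=> w; rewrite mulr_ge0//; case/andP: (r1 w).
  - by move=> w; rewrite mulr_ge0 ?decay_ge0 ?state_bound_ge0.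
  - move=> w /=; rewrite -/t ge_min mulrC; apply/orP; right.
    rewrite lerD2l ler_wpM2r ?state_bound_ge0// /excess indicE.
    by case: (w \in _); rewrite ?mul1r ?mul0r ?decay_ge0.
have cov := @covariance_le _ _ _ P (gY [set k | (k <= (block_start i)%:Z)%R])
  (gY [set k | (t%:Z <= k)%R]) (uncoupled i) (fun w => 1 - coupling_rate t m w) alpha
  (generators_sub_measurable mYT) (generators_sub_measurable mYT) _ _ W01 r1
  (mix (block_start i)).
have mYJ (J : set int) k : J k -> measurable_fun setT (Y k : sT (gY J) -> V).
  by move=> Jk; exact: (measurable_generator Jk).
have {}cov := cov _ _.
have : (\int[P]_w (uncoupled i w * (1 - coupling_rate t m w))%:E <=
    \int[P]_w (uncoupled i w)%:E * \int[P]_w (1 - coupling_rate t m w)%:E +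
    alpha%:E)%E.
  apply: cov.
  - apply: measurable_uncoupled => u ui; apply: mYJ => /=.
    by rewrite lez_nat ltnW.
  - apply: measurable_funB => //; apply: measurable_coupling_rate => u /andP[ut _].
    by apply: mYJ; rewrite /= lez_nat.
(* The rate is eta0 / 2 on an event of probability at least 1/2. *)
have rint : (\int[P]_w (1 - coupling_rate t m w)%:E <= (1 - eta0 / 4)%:E)%E.
  have -> : (\int[P]_w (1 - coupling_rate t m w)%:E =
      \int[P]_w (1 - eta0 / 2)%:E + \int[P]_w (eta0 / 2 * \1_(~` good_block t m) w)%:E)%E.
    apply: (integral_eqD _ (g := cst (1 - eta0 / 2))) => //.
    - by apply: measurable_funM => //; apply: measurable_indic; exact: measurableC.
    - by move=> w /=; lra.
    - by move=> w; rewrite mulr_ge0// divr_ge0// ltW.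
    - move=> w; rewrite /coupling_rate !indicE in_setC.
      by case: (w \in _) => /=; rewrite ?mulr0 ?mulr1 ?addr0 ?subrK ?subr0.
  rewrite integral_cst//= probability_setT mule1.
  rewrite integral_scale//; last 2 first.
  - by apply: measurable_indic; exact: measurableC.
  - by rewrite divr_ge0// ltW.
  rewrite integral_indic//; last exact: measurableC.
  rewrite setIT; apply: (@le_trans _ _ ((1 - eta0 / 2)%:E + (eta0 / 2)%:E * (2^-1)%:E)%E).
    apply: leeD2l; apply: lee_wpmul2l; last exact: pgood.
    by rewrite lee_fin divr_ge0// ltW.
  by rewrite -EFinM -EFinD lee_fin; lra.
move=> h1; have h2 := hexc t st.
apply: (le_trans (leeD h1 h2)).
have k0 : 0 <= 1 - eta0 / 4 by lra.
apply: (@le_trans _ _ ((((1 - eta0 / 4) ^+ i + (alpha + h) / (eta0 / 4)) *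
  (1 - eta0 / 4))%:E + alpha%:E + h%:E)%E).
  rewrite leeD2r// leeD2r// EFinM; apply: lee_pmul => //.
  - by apply: integral_ge0 => w _; rewrite lee_fin.
  - by apply: integral_ge0 => w _; rewrite lee_fin; case/andP: (r1 w).
rewrite -!EFinD lee_fin exprSr le_eqVlt; apply/orP; left; apply/eqP.
by field; rewrite gt_eqF.
Qed.

Lemma chain_cst t k z w : chain t k z w = chain t k (cst (z w)) w.
Proof.
by elim: k t z => //= k IH t z; rewrite IH [RHS]IH.
Qed.

Lemma measurable_chain_start (G : set_system T) t k :
  (forall u, (t <= u)%N -> measurable_fun setT (Y u%:Z : sT G -> V)) ->
  (forall u, (t < u)%N -> measurable_fun setT (eps u%:Z : sT G -> R)) ->
  measurable_fun setT (fun p : R * sT G => chain t k (cst p.1) p.2).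
Proof.
elim: k t => [|k IH] t mYG meG; first exact: measurable_fst.
have {}IH : measurable_fun setT (fun p : R * sT G => chain t.+1 k (cst p.1) p.2).
  by apply: IH => u h; [apply: mYG; exact: ltnW|apply: meG; exact: ltnW].
pose g (p : R * sT G) := (next t p (eps t.+1%:Z p.2), p.2) : R * sT G.
have mg : measurable_fun setT g.
  have mp : measurable_fun setT (fun p : R * sT G => (p, p.2) : (R * sT G) * sT G).
    by apply/measurable_fun_pairP; split => /=;
      [exact: measurable_id|exact: measurable_snd].
  have mn := measurable_next (mYG t (leqnn t)) (meG t.+1 (ltnSn t)).
  exact: (measurableT_comp mn mp).
have := measurableT_comp IH mg; apply: eq_measurable_fun => p _ /=.
by rewrite [RHS]chain_cst.
Qed.

Variable X : int -> T -> R.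
Hypothesis X_chain : forall n : nat, X n%:Z = chain 0 n (cst x).
Let XY (k : int) (w : T) : R * V := (X k w, Y k w).

Lemma process_past (j : nat) :
  <<s generators XY [set k | (0 <= k)%R /\ (k <= j%:Z)%R] >> `<=`
  <<s gY [set k | (k <= j%:Z)%R] `|` ge [set k | (k <= j%:Z)%R] >>.
Proof.
apply: smallest_sub; first exact: smallest_sigma_algebra.
move=> _ [k [k0 kj] [D mD <-]]; case: k k0 kj => // n _ nj.
set G := _ `|` _.
have mXY : measurable_fun setT (XY n%:Z : sT G -> R * V).
  apply/measurable_fun_pairP; split => /=; last exact: measurable_Y_sub.
  rewrite /comp /XY /= X_chain; apply: measurable_chain => //.
  - move=> u /andP[_ h]; apply: measurable_Y_sub => /=.
    by rewrite (le_trans _ nj)// lez_nat ltnW.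
  - move=> u /andP[_ h]; apply: measurable_eps_sub => /=.
    by rewrite (le_trans _ nj)// lez_nat.
exact: mXY.
Qed.

(** From time N on the process is a function of X N, of Y from N on and of the noise after N. The
    state is kept as a separate coordinate so that another chain can be substituted for it. *)
Lemma process_future (N : nat) (B : set T) :
  <<s generators XY [set k | (0 <= k)%R /\ (N%:Z <= k)%R] >> B ->
  exists2 D : set (R * sT (gY [set k | (N%:Z <= k)%R] `|` ge [set k | (N%:Z < k)%R])),
    measurable D & B = (fun w => (X N%:Z w, w)) @^-1` D.
Proof.
set F := _ `|` _.
apply: sigma_preimage => _ [k [k0 kN] [D mD <-]]; case: k k0 kN => // n _.
rewrite lez_nat => Nn.
pose g (p : R * sT F) := (chain N (n - N) (cst p.1) p.2, Y n%:Z p.2).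
have XE w : X n%:Z w = chain N (n - N) (cst (X N%:Z w)) w.
  by rewrite !X_chain -[in LHS](subnKC Nn) chainD add0n chain_cst.
exists (g @^-1` D); last first.
  have -> : XY n%:Z = g \o (fun w => (X N%:Z w, w)).
    by apply/funext => w; rewrite /XY /g /= -XE.
  by rewrite setTI comp_preimage.
have mg : measurable_fun setT g.
  apply/measurable_fun_pairP; split => /=.
    apply: measurable_chain_start => u h.
      by apply: measurable_Y_sub; rewrite /= lez_nat.
    by apply: measurable_eps_sub; rewrite /= ltz_nat.
  apply: (measurableT_comp (f := Y n%:Z : sT F -> V) _ measurable_snd).
  by apply: measurable_Y_sub; rewrite /= lez_nat.
by have := mg measurableT _ mD; rewrite setTI.
Qed.

(** Let B' be B with the restarted chain in place of X. Passing from B to B' costs u in P (A [&] B)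
    and u in P B, and A, B' are separated by the gap m from j to s, so [mixing_with_noise] gives the
    remaining alpha. *)
Lemma process_covariance (alpha u : R) (j N q : nat) (A B : set T) :
  s = (j + m)%N -> (block_start q <= N)%N -> 0 <= u ->
  (forall A B, <<s gY [set k | (k <= j%:Z)%R] >> A ->
     <<s gY [set k | (s%:Z <= k)%R] >> B ->
     (P (A `&` B) <= P A * P B + alpha%:E)%E) ->
  (\int[P]_w (uncoupled q w)%:E <= u%:E)%E ->
  <<s generators XY [set k | (0 <= k)%R /\ (k <= j%:Z)%R] >> A ->
  <<s generators XY [set k | (0 <= k)%R /\ (N%:Z <= k)%R] >> B ->
  (P (A `&` B) <= P A * P B + (alpha + u + u)%:E)%E.
Proof.
move=> sjm qN u0 mix Wu sA sB.
have js : (j <= s)%N by rewrite sjm leq_addr.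
have sN : (s <= N)%N by rewrite (leq_trans (leq_block_start q)).
pose F := gY [set k | (N%:Z <= k)%R] `|` ge [set k | (N%:Z < k)%R].
have [D mD BD] : exists2 D : set (R * sT F), measurable D &
    B = (fun w => (X N%:Z w, w)) @^-1` D := process_future sB.
have mID : measurable_fun setT (\1_D : R * sT F -> R) by exact: measurable_indic.
have pA := process_past sA.
have EM := @env_sub N.
have pAs : <<s past s >> A.
  apply: (smallest_sub (smallest_sigma_algebra _ _) _ pA).
  by apply: sub_generators => // k /= kj; rewrite (le_trans kj)// lez_nat.
have pM t : past t `<=` measurable by exact: generators_sub.
have mA : measurable A by exact: (smallest_sub (sigma_algebra_measurable T) (pM s)).
pose z := chain 0 N (cst x); pose z' := chain s (N - s) (cst 0).
pose W := uncoupled q.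
have cl (C : set T) : <<s past s >> C -> close N C z z' W.
  move=> pC.
  have pS t : (s <= t)%N -> past s `<=` <<s past t >>.
    by move=> st; apply: sub_generators => // k /= js'; rewrite (le_trans js')// lez_nat.
  have bN : (block_start q + (N - block_start q) <= N)%N by rewrite subnKC.
  have pCq : <<s past (block_start q) >> C.
    exact: (smallest_sub (smallest_sigma_algebra _ _) (pS _ (leq_block_start q))).
  have mz : measurable_fun setT
      (chain 0 (block_start q) (cst x) : sT (past (block_start q)) -> R).
    apply: measurable_chain => // v; first by move=> _; exact: measurable_Y_sub.
    by move=> /andP[_ h]; apply: measurable_eps_sub; rewrite /= lez_nat.
  have mz' : measurable_fun setT
      (chain s (block_start q - s) (cst 0) : sT (past (block_start q)) -> R).
    apply: measurable_chain => // v; first by move=> _; exact: measurable_Y_sub.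
    move=> /andP[_ h]; apply: measurable_eps_sub; rewrite /= lez_nat.
    by rewrite subnKC ?leq_block_start in h.
  have := close_chain bN pCq mz mz' (close_uncoupled qN pC).
  have E1 : chain (block_start q) (N - block_start q)
      (chain 0 (block_start q) (cst x)) = z.
    by rewrite /z -[in RHS](subnKC qN) chainD.
  have E2 : chain (block_start q) (N - block_start q)
      (chain s (block_start q - s) (cst 0)) = z'.
    rewrite /z' -{1}(subnKC (leq_block_start q)) -chainD; congr chain.
    by rewrite addnC addnBA ?leq_block_start// subnK.
  by rewrite E1 E2.
have FN : F `<=` <<s env N >>.
  by apply: sub_generators.
pose psi (p : R * T) : R := \1_D p.
have upsi : unit_fun (env N) psi.
  split; last by move=> p; rewrite /psi indicE; case: (p \in D); rewrite ?lexx ler01.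
  have mi : measurable_fun setT (fun p : R * sT (env N) => (p.1, p.2) : R * sT F).
    apply/measurable_fun_pairP; split => /=; first exact: measurable_fst.
    exact: (measurableT_comp (measurable_fun_idg FN) measurable_snd).
  by apply: eq_measurable_fun (measurableT_comp mID mi) => -[a b] _.
have GT : gY setT `|` ge setT `<=` measurable by exact: generators_sub.
have mzT : measurable_fun setT z.
  apply: (measurable_fun_subT GT); apply: measurable_chain => // v _.
    exact: measurable_Y_sub.
  exact: measurable_eps_sub.
have mzT' : measurable_fun setT z'.
  apply: (measurable_fun_subT GT); apply: measurable_chain => // v _.
    exact: measurable_Y_sub.
  exact: measurable_eps_sub.
pose B' : set T := (fun w => (z' w, w)) @^-1` D.
have BE : B = (fun w => (z w, w)) @^-1` D by rewrite BD X_chain.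
have mset (v : T -> R) : measurable_fun setT v -> measurable ((fun w => (v w, w)) @^-1` D).
  move=> mv.
  have mvw : measurable_fun setT (fun w : T => (v w, w) : R * sT F).
    apply/measurable_fun_pairP; split => //=.
    exact: (measurable_fun_idT (@generators_sub
      [set k | (N%:Z <= k)%R] [set k | (N%:Z < k)%R])).
  by have := mvw measurableT _ mD; rewrite setTI.
have mB : measurable B by rewrite BE; exact: mset.
have mB' : measurable B' by exact: mset.
have PE (C : set T) (v : T -> R) (E : set T) : measurable C -> measurable E ->
    (forall w, \1_C w * (cst 1 w * v w) = \1_(C `&` E) w :> R) ->
    (\int[P]_w (\1_C w * (cst 1 w * v w))%:E = P (C `&` E))%E.
  move=> mC mE vE; under eq_integral do rewrite vE.
  by rewrite integral_indic ?setIT//; exact: measurableI.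
have u1 : unit_weight (env N) (cst 1).
  by split; [exact: measurable_cst|move=> w; rewrite /= ler01 lexx].
have Wu' : (\int[P]_w (cst 1 w * W w)%:E <= u%:E)%E.
  by under eq_integral do rewrite mul1r.
have psiE (v : T -> R) w : psi (v w, w) = \1_((fun w => (v w, w)) @^-1` D) w.
  by rewrite /psi !indicE; congr (_ _)%:R; apply/idP/idP => /set_mem h; exact/mem_set.
have AB : (P (A `&` B) <= P (A `&` B') + u%:E)%E.
  have := cl A pAs psi (cst 1) upsi u1.
  rewrite (PE A _ B)//; last by move=> w; rewrite mul1r psiE -BE indicI.
  rewrite (PE A _ B')//; last by move=> w; rewrite mul1r psiE indicI.
  by move=> /le_trans; apply; rewrite leeD2l.
(* The reverse inequality comes from the test function 1 - psi on the sure event. *)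
have BB : (P B' <= P B + u%:E)%E.
  have pT : <<s past s >> setT by exact: (@measurableT _ (sT (past s))).
  have := cl setT pT _ (cst 1) (unit_fun_onem upsi) u1.
  have mCB : measurable (~` B) by exact: measurableC.
  have mCB' : measurable (~` B') by exact: measurableC.
  have ind1 (E : set T) w : 1 - \1_E w = \1_(~` E) w :> R.
    by rewrite !indicE in_setC; case: (w \in E) => /=; rewrite ?subrr ?subr0.
  rewrite (PE setT _ (~` B))//; last by move=> w; rewrite mul1r psiE -BE indicI ind1.
  rewrite (PE setT _ (~` B'))//; last by move=> w; rewrite mul1r psiE indicI ind1.
  rewrite !setTI !probability_setC// => /le_trans/(_ (leeD2l _ Wu')).
  have fB : P B \is a fin_num by exact: fin_num_measure.
  have fB' : P B' \is a fin_num by exact: fin_num_measure.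
  rewrite -(fineK fB) -(fineK fB') -!EFinD !lee_fin; lra.
have sB' : <<s gY [set k | (s%:Z <= k)%R] `|` ge [set k | (s%:Z < k)%R] >> B'.
  set G := _ `|` _.
  have FG : F `<=` <<s G >>.
    have sN' : (s%:Z <= N%:Z)%R by rewrite lez_nat.
    apply: sub_generators => k /=; first exact: le_trans.
    exact: le_lt_trans.
  have mzG : measurable_fun setT (z' : sT G -> R).
    apply: measurable_chain => // v /andP[h1 h2].
      by apply: measurable_Y_sub; rewrite /= lez_nat.
    by apply: measurable_eps_sub; rewrite /= ltz_nat.
  have mvw : measurable_fun setT (fun w : sT G => (z' w, w) : R * sT F).
    by apply/measurable_fun_pairP; split => //=; exact: (measurable_fun_idg FG).
  by have := mvw measurableT _ mD; rewrite setTI.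
have := mixing_with_noise js mix pA sB'.
have fA : P A \is a fin_num by exact: fin_num_measure.
have fB : P B \is a fin_num by exact: fin_num_measure.
have fB' : P B' \is a fin_num by exact: fin_num_measure.
have fAB : P (A `&` B) \is a fin_num.
  by apply: fin_num_measure; exact: measurableI.
have fAB' : P (A `&` B') \is a fin_num.
  by apply: fin_num_measure; exact: measurableI.
have A1 : (P A <= 1)%E by exact: probability_le1.
have A0 : (0 <= P A)%E by [].
move: AB BB A1 A0; rewrite -(fineK fA) -(fineK fB) -(fineK fB') -(fineK fAB)
  -(fineK fAB') -!EFinM -!EFinD !lee_fin.
move: (fine (P A)) (fine (P B)) (fine (P B')) => a b b' h1 h2 a1 a0 h3.
have : a * b' <= a * (b + u) by rewrite ler_wpM2l.
have : a * u <= u by rewrite ler_piMl.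
by rewrite mulrDr; lra.
Qed.

End blocks.

End coupling.

End growth.

End random_recursion.

(** * Means of the products against the states *)

Section decay_moments.
Context disp (T : measurableType disp) (R : realType) (P : probability T R).
Context dV (V : measurableType dV).
Variables (Y : int -> T -> V) (gamma K : V -> R).
Hypothesis mY : forall k, measurable_fun setT (Y k).
Hypothesis mgamma : measurable_fun setT gamma.
Hypothesis mK : measurable_fun setT K.
Hypothesis gamma_ge0 : forall y, 0 <= gamma y.
Hypothesis K_ge0 : forall y, 0 <= K y.

Local Notation decay := (decay Y gamma).
Local Notation drift := (drift Y gamma K).

Let YT : generators Y setT `<=` measurable.
Proof. exact: generators_sub_measurable. Qed.

Let mYG k : measurable_fun setT (Y k : sub_sigma (generators Y setT) -> V).
Proof. exact: (measurable_generator (J := setT)). Qed.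

Lemma measurable_decayT t k : measurable_fun setT (decay t k).
Proof.
by apply: (measurable_fun_subT YT); apply: measurable_decay.
Qed.

Lemma measurable_driftT t k : measurable_fun setT (drift t k).
Proof.
by apply: (measurable_fun_subT YT); apply: measurable_drift.
Qed.

Lemma decayD t k m w : decay t (k + m) w = decay t k w * decay (t + k) m w.
Proof.
elim: k t => [|k IH] t; first by rewrite mul1r addn0.
by rewrite addSn /= IH addSnnS mulrA.
Qed.

Variables (D D' : nat -> R).
Hypothesis decayP : forall u k, (\int[P]_w (decay u k w)%:E <= (D k)%:E)%E.
Hypothesis driftP : forall u k,
  (\int[P]_w (K (Y u%:Z w) * decay u.+1 k w)%:E <= (D' k)%:E)%E.

Let mKY u : measurable_fun setT (fun w => K (Y u w)).
Proof. exact: (measurableT_comp mK (mY u)). Qed.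

Let d0 := decay_ge0 Y gamma_ge0.
Let s0 := drift_ge0 Y gamma_ge0 K_ge0.

Lemma integral_drift t k :
  (\int[P]_w (drift t k w)%:E <= (\sum_(0 <= l < k) D' l)%:E)%E.
Proof.
elim: k t => [|k IH] t.
  by rewrite big_geq//= integral0.
rewrite big_nat_recr//= addrC EFinD.
rewrite (@integral_eqD _ _ _ P _ (fun w => K (Y t%:Z w) * decay t.+1 k w)
  (drift t.+1 k))//.
- exact: leeD.
- by apply: measurable_funM => //; exact: measurable_decayT.
- exact: measurable_driftT.
- by move=> w; rewrite mulr_ge0.
Qed.

(** A further product over m steps lengthens every product inside the drift by m, so its k terms
    have means bounded by D' at the lags m, ..., m + k - 1. *)
Lemma integral_decay_drift t k m :
  (\int[P]_w (decay (t + k) m w * drift t k w)%:E <=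
   (\sum_(m <= l < m + k) D' l)%:E)%E.
Proof.
elim: k t => [|k IH] t.
  by rewrite (big_geq (eq_leq (addn0 m))) integral0_eq// => w _; rewrite /= mulr0.
rewrite [X in (_ <= (\sum_(_ <= _ < X) _)%:E)%E]addnS big_nat_recr/= ?leq_addr// addrC EFinD.
rewrite (@integral_eqD _ _ _ P _ (fun w => K (Y t%:Z w) * decay t.+1 (m + k) w)
  (fun w => decay (t.+1 + k) m w * drift t.+1 k w)).
- exact: leeD.
- by apply: measurable_funM => //; exact: measurable_decayT.
- by apply: measurable_funM; [exact: measurable_decayT|exact: measurable_driftT].
- by move=> w; rewrite mulr_ge0.
- by move=> w; rewrite mulr_ge0.
- by move=> w; rewrite addnS /= (addnC m) decayD addSn; ring.
Qed.

(** Three terms arise, each controlled by h: |x| times a product of length at least m, and one tail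
    sum of D' for each chain. *)
Lemma integral_state_bound (x h : R) (s t m : nat) : 0 <= h ->
  (forall l, (m <= l)%N -> D l <= h) ->
  (forall M, \sum_(m <= l < M) D' l <= h) -> (s <= t)%N ->
  (\int[P]_w (decay t m w * state_bound Y gamma K x s t w)%:E <=
   (h * (`|x| + 2))%:E)%E.
Proof.
move=> h0 Dh D'h st.
have mde := measurable_decayT; have mdr := measurable_driftT.
rewrite (@integral_eqD _ _ _ P _ (fun w => `|x| * decay 0 (t + m) w + decay t m w * drift 0 t w)
  (fun w => decay t m w * drift s (t - s) w)).
- rewrite (@integral_eqD _ _ _ P _ (fun w => `|x| * decay 0 (t + m) w)
    (fun w => decay t m w * drift 0 t w)).
  + rewrite integral_scale//.
    apply: (@le_trans _ _ (`|x|%:E * h%:E + h%:E + h%:E)%E); last first.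
      by rewrite -EFinM -!EFinD lee_fin; lra.
    apply: leeD; first apply: leeD.
    * apply: lee_wpmul2l; first by rewrite lee_fin.
      by apply: (le_trans (decayP _ _)); rewrite lee_fin Dh// leq_addl.
    * have := integral_decay_drift 0 t m; rewrite add0n => /le_trans; apply.
      by rewrite lee_fin.
    * have := integral_decay_drift s (t - s) m; rewrite subnKC// => /le_trans; apply.
      by rewrite lee_fin.
  + exact: measurable_funM.
  + exact: measurable_funM.
  + by move=> w; rewrite mulr_ge0.
  + by move=> w; rewrite mulr_ge0.
  + by [].
- by apply: measurable_funD; exact: measurable_funM.
- exact: measurable_funM.
- by move=> w; rewrite addr_ge0// mulr_ge0.
- by move=> w; rewrite mulr_ge0.
- by move=> w; rewrite /state_bound decayD add0n; ring.
Qed.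

End decay_moments.

Lemma probability_markov disp (T : measurableType disp) (R : realType)
    (P : probability T R) (f : T -> R) (c e : R) : measurable_fun setT f ->
  (forall w, 0 <= f w) -> 0 < c -> (\int[P]_w (f w)%:E <= e%:E)%E ->
  (P [set w | (c < f w)%R] <= (e / c)%:E)%E.
Proof.
move=> mf f0 c0 fe.
have mA : measurable [set w | c < f w] by exact: measurable_set_lt (measurable_cst c) mf.
rewrite mulrC EFinM -[leLHS]mul1e -(mulVf (lt0r_neq0 c0)) EFinM -muleA.
rewrite lee_pmul2l ?lte_fin ?invr_gt0//.
apply: le_trans fe.
have -> : (c%:E * P [set w | (c < f w)%R] = \int[P]_w (c * \1_[set w | c < f w] w)%:E)%E.
  rewrite integral_scale//; last exact: ltW.
  by rewrite integral_indic// setIT.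
apply: integral_le => //.
- exact: measurable_funM.
- by move=> w; rewrite mulr_ge0// ltW.
- move=> w; rewrite indicE; case: (boolP (w \in _)) => [/set_mem /= /ltW|_].
    by rewrite mulr1.
  by rewrite mulr0.
Qed.

(** * Bounds on the mixing coefficients *)

Section alpha_bounds.
Context d (T : measurableType d) (R : realType) (P : probability T R).
Context d' (V : measurableType d').
Variables (I : set int) (W : int -> T -> V).
Hypothesis mW : forall k, I k -> measurable_fun setT (W k).

Local Notation gen := (generators W).
Let past (j : int) := gen [set k | I k /\ k <= j].
Let future (j : int) := gen [set k | I k /\ j <= k].

Let sigma_past j : sigma_process I W `]-oo, j] = <<s past j >>.
Proof.
by congr (<<s \bigcup_(k in _) _ >>); apply/seteqP; split => k /=; rewrite in_itv.
Qed.

Let sigma_future j : sigma_process I W `[j, +oo[ = <<s future j >>.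
Proof.
congr (<<s \bigcup_(k in _) _ >>); apply/seteqP; split => k /=;
  by rewrite in_itv/= andbT.
Qed.

Let past_measurable j : <<s past j >> `<=` measurable.
Proof.
apply: (smallest_sub (@sigma_algebra_measurable _ T)) => A [k [Ik _] [B mB <-]].
exact: mW.
Qed.

Let future_measurable j : <<s future j >> `<=` measurable.
Proof.
apply: (smallest_sub (@sigma_algebra_measurable _ T)) => A [k [Ik _] [B mB <-]].
exact: mW.
Qed.

Let fine01 A : measurable A -> 0 <= fine (P A) <= 1.
Proof.
move=> mA; rewrite fine_ge0//=.
by rewrite -lee_fin fineK ?fin_num_measure// probability_le1.
Qed.

Let alpha_set (n : nat) (j : int) := [set x | exists A B, [/\ <<s past j >> A,
  <<s future (j + n%:Z) >> B &
  x = `|fine (P (A `&` B)) - fine (P A) * fine (P B)|]].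

Let alpha_set_ub n j : ubound (alpha_set n j) 1.
Proof.
move=> _ [A [B [pA fB ->]]].
have mA := past_measurable pA; have mB := future_measurable fB.
have /andP[a0 a1] := fine01 mA; have /andP[b0 b1] := fine01 mB.
have /andP[c0 c1] := fine01 (measurableI _ _ mA mB).
by rewrite ler_norml; apply/andP; split; nra.
Qed.

Let alpha_set_neq0 n j : alpha_set n j !=set0.
Proof.
have s0 G : <<s G >> (set0 : set T).
  by move=> S [[] ? _ _ _].
by exists `|fine (P (set0 `&` set0)) - fine (P set0) * fine (P set0)|, set0, set0; split.
Qed.

Let alpha_coefE n j : alpha_coef P (sigma_process I W `]-oo, j])
  (sigma_process I W `[(j + n%:Z)%R, +oo[) = sup (alpha_set n j).
Proof. by rewrite sigma_past sigma_future. Qed.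

(** A one-sided bound suffices: replacing B by its complement changes the sign of the covariance. *)
Lemma alpha_process_le (n : nat) (beta : R) :
  (forall j A B, <<s gen [set k | I k /\ k <= j] >> A ->
     <<s gen [set k | I k /\ j + n%:Z <= k] >> B ->
     (P (A `&` B) <= P A * P B + beta%:E)%E) ->
  alpha_process P I W n <= beta.
Proof.
move=> H; apply: ge_sup; first by exists (alpha_coef P (sigma_process I W `]-oo, 0%R])
  (sigma_process I W `[(0 + n%:Z)%R, +oo[)), 0.
move=> _ [j _ <-]; rewrite alpha_coefE; apply: ge_sup; first exact: alpha_set_neq0.
have HR A B : <<s past j >> A -> <<s future (j + n%:Z) >> B ->
    fine (P (A `&` B)) <= fine (P A) * fine (P B) + beta.
  move=> pA fB; have mA := past_measurable pA; have mB := future_measurable fB.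
  have := H _ _ _ pA fB.
  rewrite -[leLHS]fineK; last by rewrite fin_num_measure//; exact: measurableI.
  by rewrite -{1}(fineK (fin_num_measure P _ mA)) -{1}(fineK (fin_num_measure P _ mB)).
move=> _ [A [B [pA fB ->]]].
have mA := past_measurable pA; have mB := future_measurable fB.
have h1 := HR _ _ pA fB.
have fcB : <<s future (j + n%:Z) >> (~` B) by rewrite -setTD; exact: sigma_algebraCD.
have h2 := HR _ _ pA fcB.
have e1 : fine (P (~` B)) = 1 - fine (P B).
  by rewrite probability_setC// fineB// ?fin_num_measure.
have e2 : fine (P A) = fine (P (A `&` B)) + fine (P (A `&` ~` B)).
  rewrite -setDE addrC -fineD ?fin_num_measure//.
  - by rewrite -measureDI.
  - exact: measurableD.
  - exact: measurableI.
rewrite e1 in h2.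
by rewrite ler_norml; apply/andP; split; lra.
Qed.

Lemma le_alpha_process (n : nat) j A B : 
  <<s gen [set k | I k /\ k <= j] >> A ->
  <<s gen [set k | I k /\ j + n%:Z <= k] >> B ->
  (P (A `&` B) <= P A * P B + (alpha_process P I W n)%:E)%E.
Proof.
move=> pA fB.
have mA := past_measurable pA; have mB := future_measurable fB.
rewrite -[leLHS]fineK; last by rewrite fin_num_measure//; exact: measurableI.
rewrite -(fineK (fin_num_measure P _ mA)) -(fineK (fin_num_measure P _ mB)).
rewrite -EFinM -EFinD lee_fin -lerBlDl; apply: (le_trans (ler_norm _)).
apply: (@le_trans _ _ (sup (alpha_set n j))).
  apply: ub_le_sup; first by exists 1; exact: alpha_set_ub.
  by exists A, B.
apply: ub_le_sup; last by exists j => //; rewrite alpha_coefE.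
exists 1 => _ [i _ <-]; rewrite alpha_coefE.
by apply: ge_sup; [exact: alpha_set_neq0|exact: alpha_set_ub].
Qed.

Lemma alpha_process_ge0 n : 0 <= alpha_process P I W n.
Proof.
have s0 G : <<s G >> (set0 : set T) by move=> S [[] ? _ _ _].
have := @le_alpha_process n 0 set0 set0 (s0 _) (s0 _).
by rewrite set0I measure0 mul0e add0e lee_fin.
Qed.

Lemma alpha_process_le1 n : alpha_process P I W n <= 1.
Proof.
apply: alpha_process_le => j A B /past_measurable mA /future_measurable mB.
apply: (le_trans (probability_le1 P (measurableI _ _ mA mB))).
by rewrite leeDr// mule_ge0.
Qed.

(** Meant for negative j, where the past of a process indexed by t >= 0 is trivial. *)
Lemma sigma_generators_set0 A : <<s gen set0 >> A -> A = set0 \/ A = setT.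
Proof.
apply: (smallest_sub (X := [set B | B = set0 \/ B = setT])) => [|B []]; last by [].
split => [|B [->|->]|F h]; first by left.
- by right; rewrite setD0.
- by left; rewrite setDT.
have [[k Fk]|nk] := pselect (exists k, F k = setT).
  by right; apply/seteqP; split => // w _; exists k => //; rewrite Fk.
left; apply/seteqP; split => // w [k _]; have [->//|Fk] := h k.
by case: nk; exists k.
Qed.

End alpha_bounds.

Section alpha_bound.
Context disp (T : measurableType disp) (R : realType) (P : probability T R).
Context dV (V : measurableType dV).
Variables (Y : int -> T -> V) (eps : int -> {RV P >-> R}) (r sigma : V * R -> R).
Variables (gamma K : V -> R).
Hypothesis mY : forall k, measurable_fun setT (Y k).
Hypothesis mr : measurable_fun setT r.
Hypothesis msigma : measurable_fun setT sigma.
Hypothesis mgamma : measurable_fun setT gamma.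
Hypothesis mK : measurable_fun setT K.
Hypothesis gamma_ge0 : forall y, 0 <= gamma y.
Hypothesis K_ge0 : forall y, 0 <= K y.
Hypothesis sigma_ge0 : forall z, 0 <= sigma z.
Hypothesis growth : forall y u, `|r (y, u)| + sigma (y, u) <= gamma y * `|u| + K y.
Hypothesis Y_id : identically_distributed P Y.
Hypothesis eps_iid : iid P (fun k => eps k : T -> R).
Hypothesis eps_Y_indep : independent_systems P
  <<s generators (fun k => eps k : T -> R) setT >> <<s generators Y setT >>.
Hypothesis eps_abs : forall k, (\int[P]_w `|eps k w|%:E <= 1%:E)%E.
Hypothesis eps_density : exists2 f : R -> R, has_density (eps 0) f &
  forall u v : R, exists2 e : R, 0 < e & forall s, s \in `[u, v] -> e <= f s.
Hypothesis sigma_inf : forall (rho : R) y, 0 < rho ->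
  0 < inf [set sigma (y, u) | u in [set u : R | `|u| <= rho]].

Lemma sigma_lower_bound (rho : R) y : 0 < rho ->
  exists2 e : R, 0 < e & forall u, `|u| <= rho -> e <= sigma (y, u).
Proof.
move=> rho0; exists (inf [set sigma (y, u) | u in [set u : R | `|u| <= rho]]).
  exact: sigma_inf.
move=> u ur; apply: ge_inf; last by exists u.
by exists 0 => _ [v _ <-].
Qed.

(** Outside a set of mass 1/8, sigma is at least some s0 on the ball; outside another one, gamma rho
    + K is at most some n, which bounds |r| and sigma there. The noise then only has to range over
    [- B, B], where its density is bounded below. *)
Lemma exists_good (rho : R) : 1 <= rho -> exists good : set V, exists eta0 : R,
  [/\ measurable good, 0 < eta0 <= 1,
   forall t : nat, (P [set w | ~ good (Y t%:Z w)] <= (4^-1)%:E)%E &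
   forall (t : nat) (w : T) (psi : R -> R) (x : R),
    good (Y t%:Z w) -> `|x| <= rho ->
    measurable_fun setT psi -> (forall z, 0 <= psi z <= 1) ->
    (eta0%:E * \int[uniform_prob (@ltr01 R)]_z (psi z)%:E <=
     \int[P]_w' (psi (r (Y t%:Z w, x) + eps t.+1%:Z w' * sigma (Y t%:Z w, x)))%:E)%E].
Proof.
move=> rho1; have rho0 : 0 < rho by exact: lt_le_trans rho1.
pose Y0 : {mfun T >-> V} :=
  HB.pack_for {mfun T >-> V} (Y 0) (isMeasurableFun.Build _ _ _ _ _ (mY 0)).
pose mu := distribution P Y0.
have e8 : (0 : R) < 8^-1 by rewrite invr_gt0.
have [G [mG muG [s0 s00 sG]]] := measurable_uniform_lower_bound mu msigma
  (fun y => sigma_lower_bound y rho0) e8.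
pose H (n : nat) := [set y | n%:R < gamma y * rho + K y].
have mgK : measurable_fun setT (fun y => gamma y * rho + K y).
  by apply: measurable_funD => //; exact: measurable_funM.
have mH n : measurable (H n) by exact: measurable_set_lt (measurable_cst _) mgK.
have cH : mu (H n) @[n --> \oo] --> mu (\bigcap_n H n).
  apply: nonincreasing_cvg_mu => //.
  - by rewrite ltey_eq fin_num_measure.
  - exact: bigcapT_measurable.
  - move=> m n mn; apply/subsetPset => y; rewrite /H /=; apply: le_lt_trans.
    by rewrite ler_nat.
have H0 : \bigcap_n H n = set0.
  apply/seteqP; split => // y Hy; have := Hy (Num.trunc (gamma y * rho + K y)).+1 I.
  by rewrite /H /= => /(lt_trans (truncnS_gt _)); rewrite ltxx.
have mu0 : mu set0 = 0%E by exact: measure0.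
rewrite H0 mu0 in cH.
have [n Hn] : exists n, (mu (H n) <= (8^-1)%:E)%E.
  have /fine_cvgP[_ cH'] := cH.
  have := cvgr_lt _ cH' (8^-1) e8; move=> [n _ /(_ n (leqnn n)) /= h].
  have hf : mu (H n) \is a fin_num by exact: fin_num_measure.
  by exists n; move: h; rewrite -lte_fin (fineK hf) => /ltW.
(* The successor keeps M positive when n = 0. *)
pose M : R := n.+1%:R.
have M0 : 0 < M by rewrite ltr0n.
have [f fd flow] := eps_density.
pose B := (1 + M) / s0.
have [e e0 ef] := flow (- B) B.
exists (G `&` ~` H n), (Num.min 1 (e / M)); split.
- by apply: measurableI => //; exact: measurableC.
- by rewrite lt_min ltr01 divr_gt0//= ge_min lexx.
- move=> t.
  have -> : P [set w | ~ (G `&` ~` H n) (Y t%:Z w)] = mu (~` (G `&` ~` H n)).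
    rewrite /mu /distribution /= /pushforward.
    rewrite (Y_id 0 t%:Z)//; apply: measurableC; apply: measurableI => //.
    exact: measurableC.
  rewrite setCI setCK; apply: (@le_trans _ _ (mu (~` G) + mu (H n))%E).
    by apply: measureU2 => //; exact: measurableC.
  apply: (le_trans (leeD muG Hn)); rewrite -EFinD lee_fin.
  by lra.
move=> t w psi x [Gy nHy] xr mpsi psi01; set y := Y t%:Z w in Gy nHy *.
have fe u : `|u| <= B -> e <= f u.
  by rewrite ler_norml => h; apply: ef; rewrite in_itv.
have yM : gamma y * rho + K y <= n%:R by rewrite leNgt; apply/negP.
have nM : n%:R <= M by rewrite /M ler_nat.
have grow := growth y x.
have gx : gamma y * `|x| <= gamma y * rho by rewrite ler_wpM2l.
have s0y : s0 <= sigma (y, x) by exact: sG.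
have sy : 0 < sigma (y, x) by exact: lt_le_trans s0y.
have rn : 0 <= `|r (y, x)| by [].
have sM : sigma (y, x) <= M by lra.
have rM : `|r (y, x)| <= M by move: (sigma_ge0 (y, x)); lra.
have aB : (1 + `|r (y, x)|) / sigma (y, x) <= B.
  by rewrite /B ler_pM// ?invr_ge0 ?addr_ge0 ?(ltW sy)// ?lerD2l// lef_pV2.
have fdt : has_density (eps t.+1%:Z) f.
  have [mf f0 fA] := fd; split => // A mA.
  by rewrite -fA// /distribution /= /pushforward (eps_iid.2 t.+1%:Z 0).
have psi0 z : 0 <= psi z by case/andP: (psi01 z).
apply: le_trans (density_minorization fdt e0 M0 fe sy sM aB mpsi psi0).
apply: lee_wpmul2r; first by apply: integral_ge0 => z _; rewrite lee_fin.
by rewrite lee_fin ge_min lexx orbT.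
Qed.

Variables (x : R) (X : int -> T -> R).
Let epsT (k : int) : T -> R := eps k.
Hypothesis X_chain : forall n : nat, X n%:Z = chain Y epsT r sigma 0 n (cst x).
Let XY (k : int) (w : T) : R * V := (X k w, Y k w).
Let I := [set t : int | 0 <= t].

Let meps k : measurable_fun setT (epsT k).
Proof. by []. Qed.

Lemma measurable_process k : I k -> measurable_fun setT (XY k).
Proof.
case: k => // n _; apply/measurable_fun_pairP; split; last exact: mY.
rewrite (_ : fst \o _ = X n); last by apply/funext.
rewrite X_chain.
have GM : generators Y setT `|` generators epsT setT `<=` measurable.
  by move=> A [|]; exact: generators_sub_measurable.
apply: (measurable_fun_subT GM); apply: measurable_chain => //.
- by move=> s _; apply: (measurable_generator (J := setT)) => // A; left.
- by move=> s _; apply: (measurable_generator (J := setT)) => // A; right.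
Qed.

Definition gap_mixing (m : nat) (alpha : R) := forall (t : int) A B,
  <<s generators Y [set k | k <= t] >> A ->
  <<s generators Y [set k | t + m%:Z <= k] >> B ->
  (P (A `&` B) <= P A * P B + alpha%:E)%E.

Variables (D D' : nat -> R).
Hypothesis decayP : forall u k, (\int[P]_w (decay Y gamma u k w)%:E <= (D k)%:E)%E.
Hypothesis driftP : forall u k,
  (\int[P]_w (K (Y u%:Z w) * decay Y gamma u.+1 k w)%:E <= (D' k)%:E)%E.

(** The radius, the good set and hence kappa and C depend on the summability bound S but not on m, q
    or n, which leaves the block structure free to be optimized later. *)
Lemma alpha_process_bound (S : R) : (forall M, \sum_(0 <= l < M) D' l <= S) ->
  exists kappa C : R, [/\ 0 < kappa, kappa < 1, 0 <= C &
  forall (m q n : nat) (alpha h : R), (m + q * (m + m.+1) <= n)%N ->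
    0 <= alpha -> 0 <= h -> gap_mixing m alpha ->
    (forall l, (m <= l)%N -> D l <= h) ->
    (forall M, \sum_(m <= l < M) D' l <= h) ->
    alpha_process P I XY n <= C * (kappa ^+ q + alpha + h)].
Proof.
move=> D'S.
have S0 : 0 <= S by have := D'S 0%N; rewrite big_geq.
(* By Markov's inequality the drift then exceeds rho / 2 with probability at most 1/4; with the 1/4
   for the good set, a block is good with probability at least 1/2. *)
pose rho := 1 + 8 * S.
have rho1 : 1 <= rho by rewrite lerDl mulr_ge0.
have [good [eta0 [mgood /andP[e0 e1] good4 minorization]]] :=
  exists_good rho1.
have e01 : 0 <= eta0 <= 1 by rewrite (ltW e0).
pose c := 4 / eta0.
have c0 : 0 <= c by rewrite divr_ge0// ltW.
exists (1 - eta0 / 4), (3 + 2 * c * (`|x| + 3)); split.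
- lra.
- lra.
- by rewrite addr_ge0// mulr_ge0 ?addr_ge0// mulr_ge0.
move=> m q n alpha h mqn a0 h0 mix Dh D'h.
have n0 : 0 <= `|x| by [].
have k0 : 0 <= (1 - eta0 / 4) ^+ q by rewrite exprn_ge0//; lra.
pose hx := h * (`|x| + 2).
have hx0 : 0 <= hx by rewrite mulr_ge0// addr_ge0.
pose u := (1 - eta0 / 4) ^+ q + (alpha + hx) / (eta0 / 4).
have uE : u = (1 - eta0 / 4) ^+ q + c * (alpha + hx).
  by rewrite /u /c; congr (_ + _); field; exact: lt0r_neq0.
have u0 : 0 <= u by rewrite uE addr_ge0// mulr_ge0// addr_ge0.
have pgood t : (P (~` good_block Y gamma K good rho t m) <= (2^-1)%:E)%E.
  have md := measurable_driftT mY mgamma mK t m.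
  have mA : measurable [set w | rho / 2 < drift Y gamma K t m w].
    exact: measurable_set_lt (measurable_cst _) md.
  have mB : measurable [set w | ~ good (Y (t + m)%N w)].
    by have := mY (t + m)%N measurableT (measurableC mgood); rewrite setTI.
  have -> : ~` good_block Y gamma K good rho t m =
      [set w | rho / 2 < drift Y gamma K t m w] `|` [set w | ~ good (Y (t + m)%N w)].
    apply/seteqP; split => w; rewrite /good_block /=.
      have [dr|dr] := leP (drift Y gamma K t m w) (rho / 2); last by left.
      by move=> h1; right => gd; apply: h1.
    by case=> [dr|ng] [dr' gd]; [rewrite leNgt dr in dr'|exact: ng].
  apply: (le_trans (measureU2 _ _ _)) => //.
  apply: (@le_trans _ _ ((4^-1)%:E + (4^-1)%:E)%E); last by rewrite -EFinD lee_fin; lra.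
  apply: leeD; last exact: good4.
  have rho2 : 0 < rho / 2 by rewrite divr_gt0// (lt_le_trans _ rho1).
  have drS : (\int[P]_w (drift Y gamma K t m w)%:E <= S%:E)%E.
    apply: (le_trans (integral_drift mY mgamma mK gamma_ge0 K_ge0 driftP t m)).
    by rewrite lee_fin.
  apply: (le_trans (probability_markov md (drift_ge0 Y gamma_ge0 K_ge0 t m) rho2 drS)).
  by rewrite lee_fin ler_pdivrMr// /rho; lra.
have Wu j : (\int[P]_w (uncoupled Y gamma K good rho eta0 x (j + m) m q w)%:E <= u%:E)%E.
  apply: (integral_uncoupled mY meps mgamma mK gamma_ge0 K_ge0 mgood e01) => //.
    by move=> t A B sA sB; apply: (mix t%:Z).
  move=> t jt; apply: (integral_state_bound mY mgamma mK gamma_ge0 K_ge0 decayP driftP) => //.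
have uC : alpha + u + u <= (3 + 2 * c * (`|x| + 3)) * ((1 - eta0 / 4) ^+ q + alpha + h).
  rewrite uE /hx; set p := _ ^+ q in k0 *; set n' := `|x| in n0 *.
  rewrite -subr_ge0.
  have -> : (3 + 2 * c * (n' + 3)) * (p + alpha + h) -
    (alpha + (p + c * (alpha + h * (n' + 2))) + (p + c * (alpha + h * (n' + 2)))) =
    p + 2 * alpha + 3 * h + 2 * c * ((n' + 3) * p + (n' + 2) * alpha + h) by ring.
  by do !(done || apply: addr_ge0 || apply: mulr_ge0).
apply: le_trans uC.
apply: alpha_process_le => [|j A B].
  exact: measurable_process.
case: j => [j|j] sA sB.
  (* The gap n is spent on m steps before the restart at j + m and on q blocks of length 2 m + 1. *)
  apply: (process_covariance mY meps eps_iid.1 eps_Y_indep mr msigma mgamma mK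
    gamma_ge0 K_ge0 sigma_ge0 growth eps_abs mgood rho1 e01 minorization X_chain
    (j := j) (N := (j + n)%N) erefl _ u0 (mix j%:Z) (Wu j) sA sB).
  by rewrite /block_start -addnA leq_add2l.
have A0 : A = set0 \/ A = setT.
  apply: (@sigma_generators_set0 _ T _ _ XY).
  suff -> : set0 = [set k | I k /\ k <= Negz j] by [].
  by apply/seteqP; split => // k [/= k0' /(le_trans k0')].
have au : 0 <= alpha + u + u by exact: addr_ge0 (addr_ge0 a0 u0) u0.
case: A0 => ->; first by rewrite set0I measure0 mul0e add0e lee_fin.
by rewrite setTI probability_setT mul1e leeDl// lee_fin.
Qed.

End alpha_bound.

(** * Rates *)

Section rates.
Context (R : realType).
Implicit Types (x y s b p kappa : R).

Lemma ln_le_subr1 x : 0 < x -> ln x <= x - 1.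
Proof.
move=> x0; have e : x = 1 + (x - 1) by ring.
by rewrite {1}e; apply: le_ln1Dx; lra.
Qed.

Lemma ler_powRl x y b : 0 <= x -> x <= y -> 0 <= b -> x `^ b <= y `^ b.
Proof.
by move=> x0 xy b0; apply: ge0_ler_powR; rewrite ?nnegrE// (le_trans x0).
Qed.

Lemma ler_powRN x y b : 0 < x -> x <= y -> 0 <= b -> y `^ (- b) <= x `^ (- b).
Proof.
move=> x0 xy b0; have y0 := lt_le_trans x0 xy.
by rewrite !powRN lef_pV2 ?posrE ?powR_gt0// ler_powRl// ltW.
Qed.

Lemma powR_ge1 x b : 1 <= x -> 0 <= b -> 1 <= x `^ b.
Proof. by move=> x1 b0; have := ler_powRl ler01 x1 b0; rewrite powR1. Qed.

(** A logarithm that is at least 1 for every n, so that estimates hold without exceptions at small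
    n. *)
Definition log1 (n : nat) : R := 1 + ln n.+1%:R.

Lemma log1_ge1 n : 1 <= log1 n.
Proof. by rewrite lerDl ln_ge0// ler1n. Qed.

Lemma le_log1 m n : (m <= n)%N -> log1 m <= log1 n.
Proof. by move=> mn; rewrite lerD2l ler_ln ?posrE ?ltr0n// ler_nat. Qed.

(* Balances the number q of blocks against their length m: q is of order
   log n, so that kappa ^ q is at most n ^ (- b), and m is of order n / q. *)
Lemma block_rate kappa (C b p : R) :
  0 < kappa < 1 -> 0 <= C -> 0 < b -> 0 <= p -> exists2 C' : R, 1 <= C' &
  forall f : nat -> R, (forall n, f n <= 1) ->
  (forall m q n, (0 < m)%N -> (0 < q)%N -> (4 * q * m <= n)%N ->
    f n <= C * (kappa ^+ q + log1 m `^ p * m%:R `^ (- b))) ->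
  forall n, f n <= C' * (log1 n `^ (p + b) * n.+1%:R `^ (- b)).
Proof.
move=> /andP[k0 k1] C0 b0 p0.
have lnk : 0 < - ln kappa by have := ln_le_subr1 k0; lra.
(* With q >= c log1 n one has kappa ^ q <= (n + 1) ^ (- b). *)
pose c := b / - ln kappa.
have c0 : 0 < c by rewrite divr_gt0.
(* The factor c + 1 bounds q / log1 n, and 8 comes from n + 1 <= 4 q (m + 1) <= 8 q m. *)
pose A := 8 * (c + 1).
have A1 : 1 <= A by rewrite /A; lra.
have Ab := powR_ge1 A1 (ltW b0).
exists (C * (1 + A `^ b) + A `^ b).
  by rewrite (le_trans Ab)// lerDr mulr_ge0// addr_ge0// powR_ge0.
(* The constant is fixed before f, so the rate is uniform over families of functions, as
   [decay_rate] needs in its starting time u. *)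
move=> f f1 fC n; set L := log1 n; set N : R := n.+1%:R.
have N0 : 0 < N by rewrite ltr0n.
have L1 : 1 <= L := log1_ge1 n.
have L0 : 0 < L by lra.
have Lp := powR_ge1 L1 p0.
have Lb := powR_ge1 L1 (ltW b0).
have Lpb : L `^ (p + b) = L `^ p * L `^ b.
  by rewrite powRD// (lt0r_neq0 L0) implybT.
have Nb : 0 < N `^ (- b) by rewrite powR_gt0.
pose q := (Num.trunc (c * L)).+1.
have cL0 : 0 <= c * L by rewrite mulr_ge0// ltW.
have qL : q%:R <= A / 8 * L.
  have h : (Num.trunc (c * L))%:R <= c * L by rewrite truncn_le.
  have -> : A / 8 = c + 1 by rewrite /A; field.
  by rewrite /q -addn1 natrD; lra.
have q0 : 0 < q%:R :> R by rewrite ltr0n.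
have bound M : 0 < M -> N <= A * L * M -> M `^ (- b) <= A `^ b * L `^ b * N `^ (- b).
  move=> M0 NM.
  have AL0 : 0 < A * L by rewrite mulr_gt0//; lra.
  rewrite -powRM; [|lra|lra].
  have -> : (A * L) `^ b = ((A * L)^-1) `^ (- b).
    by rewrite -powR_inv1 ?(ltW AL0)// -powRrM mulrN mulN1r opprK.
  rewrite -powRM; [|by rewrite invr_ge0 ltW|exact: ltW].
  apply: ler_powRN; last exact: ltW.
    by rewrite mulr_gt0// invr_gt0.
  by rewrite mulrC ler_pdivrMr// mulrC.
(* When n is too small for blocks of positive length, n + 1 <= A log1 n and the trivial bound f n <=
   1 is enough. *)
have [qn|nq] := leqP (4 * q) n; last first.
  apply: (le_trans (f1 n)).
  have h : N <= A * L * 1.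
    apply: (@le_trans _ _ (4 * q)%:R); first by rewrite ler_nat.
    by rewrite natrM; nra.
  have := bound 1 ltr01 h; rewrite powR1 => h1.
  rewrite Lpb mulrA; apply: (le_trans h1); rewrite ler_wpM2r ?(ltW Nb)//.
  rewrite mulrA ler_wpM2r//; first lra.
  rewrite (@le_trans _ _ (A `^ b * L `^ p))//; first by rewrite ler_peMr//; lra.
  by rewrite ler_wpM2r//; [lra|rewrite lerDr mulr_ge0//; lra].
pose m := (n %/ (4 * q))%N.
have m0 : (0 < m)%N by rewrite divn_gt0// muln_gt0.
have mq : (4 * q * m <= n)%N by rewrite mulnC leq_trunc_div.
have mn : (m <= n)%N by rewrite leq_div.
have kq : kappa ^+ q <= N `^ (- b).
  rewrite -powR_mulrn ?(ltW k0)// /powR (gt_eqF k0) (gt_eqF N0) ler_expR.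
  have h : c * L < q%:R by exact: truncnS_gt.
  have e : b * L = c * L * - ln kappa by rewrite /c; field; apply: ltr0_neq0; lra.
  have h2 : c * L * - ln kappa <= q%:R * - ln kappa by apply: ler_wpM2r; exact: ltW.
  have h3 : b * ln N <= b * L by rewrite ler_wpM2l ?(ltW b0)// /L /log1 lerDr.
  lra.
have mb : m%:R `^ (- b) <= A `^ b * L `^ b * N `^ (- b).
  apply: bound; first by rewrite ltr0n.
  have h : (n.+1 <= 4 * q * (m + m))%N.
    have := ltn_ceil n (_ : 0 < 4 * q)%N; rewrite -/m muln_gt0/= => /(_ isT) h.
    have mm : (m.+1 <= m + m)%N by rewrite -[m.+1]addn1 leq_add2l.
    by rewrite (leq_trans h)// mulnC leq_mul2l mm orbT.
  apply: (@le_trans _ _ (4 * q * (m + m))%:R); first by rewrite ler_nat.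
  rewrite !natrM natrD.
  have M0 : 0 <= m%:R :> R by [].
  have -> : 4 * q%:R * (m%:R + m%:R) = q%:R * (8 * m%:R) :> R by ring.
  have -> : A * L * m%:R = A / 8 * L * (8 * m%:R) by field.
  by rewrite ler_wpM2r// mulr_ge0.
apply: (le_trans (fC m q n m0 isT mq)).
apply: (@le_trans _ _ (C * ((1 + A `^ b) * (L `^ (p + b) * N `^ (- b))))).
  apply: ler_wpM2l => //; rewrite mulrDl mul1r; apply: lerD.
    by rewrite (le_trans kq)// ler_peMl ?(ltW Nb)// Lpb mulr_ege1.
  apply: (@le_trans _ _ (L `^ p * (A `^ b * L `^ b * N `^ (- b)))).
    apply: ler_pM (powR_ge0 _ _) (powR_ge0 _ _) _ mb.
    by rewrite ler_powRl ?le_log1// (le_trans _ (log1_ge1 m)).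
  by rewrite Lpb le_eqVlt; apply/orP; left; apply/eqP; ring.
rewrite mulrA ler_wpM2r ?mulr_ge0 ?powR_ge0// lerDl; exact: powR_ge0.
Qed.

(** Dividing by (x + 1) ^ (- s) leaves exp (- s ln (x / (x + 1))) >= 1 + s / (x + 1), which follows
    from exp u >= 1 + u and ln z <= z - 1. It replaces a comparison with an integral. *)
Lemma powR_series x s : 0 < x -> 0 < s ->
  s * (x + 1) `^ (- (1 + s)) <= x `^ (- s) - (x + 1) `^ (- s).
Proof.
move=> x0 s0; have y0 : 0 < x + 1 by lra.
have -> : (x + 1) `^ (- (1 + s)) = (x + 1)^-1 * (x + 1) `^ (- s).
  rewrite opprD powRD; last by rewrite (lt0r_neq0 y0) implybT.
  by rewrite powR_inv1// ltW.
have -> : x `^ (- s) = (x / (x + 1)) `^ (- s) * (x + 1) `^ (- s).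
  rewrite -powRM ?ltW// ?divr_gt0//; congr (_ `^ _).
  by field; exact: lt0r_neq0.
rewrite mulrA -[X in _ <= _ - X]mul1r -mulrBl ler_wpM2r ?powR_ge0//.
have z0 : 0 < x / (x + 1) by rewrite divr_gt0.
rewrite /powR (gt_eqF z0) lerBrDl; apply: le_trans (expR_ge1Dx _).
rewrite lerD2l mulNr -mulrN ler_wpM2l ?(ltW s0)//.
have := ln_le_subr1 z0.
have -> : x / (x + 1) - 1 = - (x + 1)^-1 by field; exact: lt0r_neq0.
by lra.
Qed.

Lemma sum_powR_tail s m M : 0 < s ->
  \sum_(m <= l < M) l.+2%:R `^ (- (1 + s)) <= m.+1%:R `^ (- s) / s.
Proof.
move=> s0; rewrite ler_pdivlMr// mulr_suml.
have [mM|Mm] := leqP m M; last first.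
  by rewrite big_geq ?powR_ge0// ltnW.
apply: (@le_trans _ _ (\sum_(m <= l < M) (- l.+2%:R `^ (- s) - - l.+1%:R `^ (- s)))).
  apply: ler_sum => l _; rewrite [leLHS]mulrC opprK.
  have h := @powR_series l.+1%:R s; rewrite natr1 in h.
  by rewrite (le_trans (h _ s0)) ?ltr0n// addrC.
rewrite telescope_sumr// opprK gerDr oppr_le0; exact: powR_ge0.
Qed.

(** With s half of the surplus b - 1, the growth of the logarithm from m to l is absorbed by (l + 1)
    ^ s, and the exponent - b + s = - (1 + s) is still summable. The logarithm in the bound is thus
    that of m, to the same power b. *)
Lemma sum_log1_tail b : 1 < b -> exists2 C : R, 0 <= C & forall m M,
  \sum_(m <= l < M) log1 l `^ b * l.+1%:R `^ (- b) <=
  C * (log1 m `^ b * m.+1%:R `^ (- (b - 1))).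
Proof.
move=> b1; pose s := (b - 1) / 2; pose e := s / b.
have s0 : 0 < s by rewrite /s; lra.
have b0 : 0 < b by lra.
have e0 : 0 < e by rewrite divr_gt0.
pose A := 1 + e^-1.
have A0 : 0 <= A by rewrite addr_ge0// invr_ge0 ltW.
have tp : 0 <= 2 `^ (1 + s) :> R by exact: powR_ge0.
exists (A `^ b * (2 `^ (1 + s) / s)).
  by rewrite mulr_ge0 ?powR_ge0// divr_ge0// ltW.
move=> m M; set L := log1 m; set N : R := m.+1%:R.
have L1 : 1 <= L := log1_ge1 m.
have N0 : 0 < N by rewrite ltr0n.
(* The factor 2 ^ (1 + s) shifts l + 1 to l + 2, the form that [sum_powR_tail] sums. *)
pose B := A `^ b * (L `^ b * N `^ (- s)) * 2 `^ (1 + s).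
have B0 : 0 <= B by rewrite !mulr_ge0 ?powR_ge0.
apply: (@le_trans _ _ (\sum_(m <= l < M) B * l.+2%:R `^ (- (1 + s)))).
  rewrite big_nat_cond [leRHS]big_nat_cond; apply: ler_sum => l /andP[/andP[ml _] _].
  set n : R := l.+1%:R.
  have n0 : 0 < n by rewrite ltr0n.
  have Nn : N <= n by rewrite ler_nat.
  have y1 : 1 <= n / N by rewrite ler_pdivlMr// mul1r.
  have y0 : 0 < n / N by rewrite divr_gt0.
  have Le : log1 l <= L * (A * (n / N) `^ e).
    have ye := powR_ge1 y1 (ltW e0).
    have lnl : log1 l = L + ln (n / N).
      by rewrite ln_div ?posrE// /L /log1 -/n -/N; lra.
    have h : ln (n / N) <= e^-1 * (n / N) `^ e.
      rewrite [leRHS]mulrC ler_pdivlMr// [leLHS]mulrC -ln_powR.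
      have := @ln_le_subr1 ((n / N) `^ e); rewrite powR_gt0// => /(_ isT); lra.
    have ey : 0 <= e^-1 * (n / N) `^ e by rewrite mulr_ge0 ?invr_ge0 ?powR_ge0// ltW.
    have -> : L * (A * (n / N) `^ e) = L * (n / N) `^ e + L * (e^-1 * (n / N) `^ e).
      by rewrite /A; ring.
    rewrite lnl; apply: lerD.
      by rewrite ler_peMr//; lra.
    by rewrite (le_trans h)// ler_peMl.
  have Lb : log1 l `^ b <= L `^ b * (A `^ b * (n / N) `^ s).
    have l0 : 0 <= log1 l by rewrite (le_trans _ (log1_ge1 l)).
    apply: (le_trans (ler_powRl l0 Le (ltW b0))).
    rewrite powRM ?mulr_ge0 ?powR_ge0//; last lra.
    rewrite (powRM b A0 (powR_ge0 _ _)) -powRrM.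
    by rewrite (_ : e * b = s)// /e; field; exact: lt0r_neq0.
  apply: (le_trans (ler_wpM2r (powR_ge0 _ _) Lb)).
  have -> : (n / N) `^ s = n `^ s * N `^ (- s).
    rewrite powRM ?invr_ge0 ?ltW//; congr (_ * _).
    by rewrite -powR_inv1 ?ltW// -powRrM mulN1r.
  have -> : L `^ b * (A `^ b * (n `^ s * N `^ (- s))) * n `^ (- b) =
    A `^ b * (L `^ b * N `^ (- s)) * (n `^ s * n `^ (- b)) by ring.
  have -> : n `^ s * n `^ (- b) = n `^ (- (1 + s)).
    rewrite -powRD; last by rewrite (lt0r_neq0 n0) implybT.
    by congr (_ `^ _); rewrite /s; lra.
  rewrite /B -[leRHS]mulrA; apply: ler_wpM2l; first by rewrite !mulr_ge0 ?powR_ge0.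
  have -> : 2 `^ (1 + s) = (2^-1) `^ (- (1 + s)) :> R.
    by rewrite -powR_inv1// -powRrM mulrN mulN1r opprK.
  rewrite -powRM ?invr_ge0//; apply: ler_powRN.
  - by rewrite mulr_gt0 ?ltr0n// invr_gt0.
  - have n1 : 1 <= n by rewrite ler1n.
    have -> : l.+2%:R = n + 1 by rewrite /n natr1.
    lra.
  - by rewrite addr_ge0// ltW.
rewrite -mulr_sumr; apply: (le_trans (ler_wpM2l B0 (sum_powR_tail m M s0))).
have -> : N `^ (- (b - 1)) = N `^ (- s) * N `^ (- s).
  rewrite -powRD; last by rewrite (lt0r_neq0 N0) implybT.
  by congr (_ `^ _); rewrite /s; lra.
by rewrite /B le_eqVlt; apply/orP; left; apply/eqP; ring.
Qed.

Lemma geometric_rate (g b : R) : 0 < g < 1 -> 0 < b ->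
  exists2 C : R, 0 <= C & forall m : nat, (0 < m)%N -> g ^+ m <= C * m%:R `^ (- b).
Proof.
move=> /andP[g0 g1] b0.
have d0 : 0 < - ln g by have := ln_le_subr1 g0; lra.
have e0 : 0 < - ln g / b by rewrite divr_gt0.
(* The witness is (b / - ln g) ^ b; the bound is ln z <= z - 1 at z = (- ln g / b) m. *)
exists (expR (- (b * ln (- ln g / b)))); first exact: expR_ge0.
move=> m m0; have M0 : 0 < m%:R :> R by rewrite ltr0n.
rewrite -powR_mulrn ?(ltW g0)// /powR (gt_eqF g0) (gt_eqF M0) -expRD ler_expR.
have z0 : 0 < - ln g / b * m%:R by rewrite mulr_gt0.
have := ln_le_subr1 z0; rewrite lnM ?posrE// => h.
have h2 : b * (ln (- ln g / b) + ln m%:R) <= b * (- ln g / b * m%:R - 1).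
  by rewrite ler_wpM2l// ltW.
have e : b * (- ln g / b * m%:R - 1) = - ln g * m%:R - b.
  by field; exact: lt0r_neq0.
by rewrite e in h2; lra.
Qed.

End rates.

Section asymptotics.
Context (R : realType).

Lemma log1_le_powR (n : nat) (e : R) : 0 < e -> log1 R n <= (1 + e^-1) * n.+1%:R `^ e.
Proof.
move=> e0; have N1 : 1 <= n.+1%:R :> R by rewrite ler1n.
have ye := powR_ge1 N1 (ltW e0).
rewrite mulrDl mul1r lerD//.
rewrite [leRHS]mulrC ler_pdivlMr// [leLHS]mulrC -ln_powR.
have y0 : 0 < n.+1%:R `^ e :> R by lra.
by have := ln_le_subr1 y0; lra.
Qed.

Variables (f : nat -> R) (C s b : R).
Hypothesis C0 : 0 <= C.
Hypothesis s0 : 0 <= s.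
Hypothesis b0 : 0 < b.
Hypothesis f0 : forall n, 0 <= f n.
Hypothesis fC : forall n, f n <= C * (log1 R n `^ s * n.+1%:R `^ (- b)).

Lemma log1_rate_cvg0 : f n @[n --> \oo] --> (0 : R).
Proof.
have b2 : 0 < b / 2 by rewrite divr_gt0.
(* The logarithm to the power s costs at most e s <= b / 2; the shift s + 1 covers s = 0. *)
pose e := b / (2 * (s + 1)).
have s1 : 0 < 2 * (s + 1) by rewrite mulr_gt0// ltr_wpDl.
have e0 : 0 < e by rewrite divr_gt0.
have es : e * s <= b / 2.
  rewrite /e mulrAC ler_pdivrMr// (_ : b / 2 * (2 * (s + 1)) = b * s + b); last by field.
  by rewrite lerDl ltW.
pose A := (1 + e^-1) `^ s.
have A0 : 0 < A by rewrite powR_gt0// ltr_wpDr// invr_ge0 ltW.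
have fA n : f n <= C * A * n.+1%:R `^ (- (b / 2)).
  have N0 : 0 < n.+1%:R :> R by rewrite ltr0n.
  have N1 : 1 <= n.+1%:R :> R by rewrite ler1n.
  apply: (le_trans (fC n)); rewrite -mulrA ler_wpM2l//.
  have l0 : 0 <= log1 R n by rewrite (le_trans _ (log1_ge1 R n)).
  apply: (@le_trans _ _ (A * n.+1%:R `^ (b / 2) * n.+1%:R `^ (- b))).
    rewrite ler_wpM2r ?powR_ge0// (le_trans (ler_powRl l0 (log1_le_powR n e0) s0))//.
    rewrite powRM ?powR_ge0//; last by rewrite addr_ge0// invr_ge0 ltW.
    by rewrite ler_wpM2l ?(ltW A0)// -powRrM ler_powR.
  rewrite -mulrA -powRD; last by rewrite (lt0r_neq0 N0) implybT.
  by rewrite (_ : b / 2 - b = - (b / 2))//; lra.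
apply/cvgrPdist_le => d d0.
pose z := (C * A / d) `^ (b / 2)^-1.
near=> n.
rewrite sub0r normrN ger0_norm//; apply: (le_trans (fA n)).
have N0 : 0 < n.+1%:R :> R by rewrite ltr0n.
rewrite powRN ler_pdivrMr ?powR_gt0// [leRHS]mulrC -ler_pdivrMr//.
have zn : z <= n.+1%:R.
  apply: (le_trans (ltW (truncnS_gt z))); rewrite ler_nat ltnS.
  by near: n; exact: nbhs_infty_ge.
apply: le_trans (ler_powRl (powR_ge0 _ _) zn (ltW b2)).
rewrite /z -powRrM mulVf ?lt0r_neq0// powRr1//.
by rewrite divr_ge0 ?mulr_ge0 ?(ltW A0)// ltW.
Unshelve. all: by end_near. Qed.

Lemma log1_rate_bigO : f =O_\oo (fun n : nat => ln n%:R `^ s * n%:R `^ (- b)).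
Proof.
apply/eqO_exP; exists (C * 3 `^ s + 1); first by rewrite ltr_wpDl// mulr_ge0 ?powR_ge0.
near=> n.
(* From ln n >= 1 on, log1 n <= 2 + ln n <= 3 ln n. *)
have ne : expR 1 <= n%:R :> R.
  apply: (le_trans (ltW (truncnS_gt _))); rewrite ler_nat.
  by near: n; exact: nbhs_infty_ge.
have n0 : 0 < n%:R :> R by exact: lt_le_trans (expR_gt0 1) ne.
have n1 : 1 <= n%:R :> R by rewrite ler1n -(ltr0n R).
have ln1 : 1 <= ln n%:R :> R.
  by rewrite -ler_expR lnK.
have lnS : ln n.+1%:R <= 1 + ln n%:R :> R.
  apply: (@le_trans _ _ (ln (2 * n%:R))).
    have -> : n.+1%:R = n%:R + 1 :> R by rewrite natr1.
    by rewrite ler_ln ?posrE; lra.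
  have l2 := @ln_le_subr1 R 2 (ltr0Sn _ _).
  by rewrite lnM ?posrE//; lra.
have L3 : log1 R n <= 3 * ln n%:R by rewrite /log1; lra.
have l0 : 0 <= log1 R n by rewrite (le_trans _ (log1_ge1 R n)).
have p0 : 0 <= ln n%:R `^ s * n%:R `^ (- b) :> R by rewrite mulr_ge0 ?powR_ge0.
rewrite !ger0_norm//; apply: (le_trans (fC n)).
apply: (@le_trans _ _ (C * 3 `^ s * (ln n%:R `^ s * n%:R `^ (- b)))); last first.
  by rewrite ler_wpM2r// lerDl.
rewrite -[leRHS]mulrA ler_wpM2l// [leRHS]mulrA; apply: ler_pM; rewrite ?powR_ge0//.
  rewrite -powRM//; last lra.
  exact: ler_powRl.
apply: ler_powRN (ltW b0) => //.
by rewrite ler_nat.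
Unshelve. all: by end_near. Qed.

End asymptotics.

(** * Moments of the random products *)

Section stationary_moments.
Context disp (T : measurableType disp) (R : realType) (P : probability T R).
Context dV (V : measurableType dV).
Variable Y : int -> T -> V.
Hypothesis mY : forall k, measurable_fun setT (Y k).
Hypothesis Y_id : identically_distributed P Y.

Lemma integral_identically (f : V -> R) (s t : int) : measurable_fun setT f ->
  (forall y, 0 <= f y) -> (\int[P]_w (f (Y s w))%:E = \int[P]_w (f (Y t w))%:E)%E.
Proof.
move=> mf f0.
have mfE : measurable_fun setT (EFin \o f) by exact/measurable_EFinP.
have pf u : (\int[P]_w (f (Y u w))%:E = \int[pushforward P (Y u)]_y (f y)%:E)%E.
  rewrite (@ge0_integral_pushforward _ _ _ _ _ (Y u) (mY u) P setT (EFin \o f))//.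
  by move=> y _; rewrite lee_fin.
rewrite !pf.
pose mu u : {measure set V -> \bar R} := distribution P
  (HB.pack_for {mfun T >-> V} (Y u) (isMeasurableFun.Build _ _ _ _ _ (mY u))).
apply: (@eq_measure_integral _ _ _ _ (mu t) (mu s)) => A mA _.
exact: Y_id.
Qed.

Lemma ae_identically (Q : set V) : measurable Q ->
  {ae P, forall w, Q (Y 0 w)} -> {ae P, forall w, forall t : nat, Q (Y t%:Z w)}.
Proof.
move=> mQ Q0; apply: ae_foralln => t.
have mA u : measurable [set w | ~ Q (Y u w)].
  by have := mY u measurableT (measurableC mQ); rewrite setTI.
apply/negligibleP; first exact: mA.
have P0 : P [set w | ~ Q (Y 0 w)] = 0%E by apply/negligibleP => //; exact: mA.
by rewrite -P0; apply: (Y_id t%:Z 0 (A := ~` Q)); exact: measurableC.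
Qed.

End stationary_moments.

Section decay_bounds.
Context disp (T : measurableType disp) (R : realType) (P : probability T R).
Context dV (V : measurableType dV).
Variables (Y : int -> T -> V) (gamma K : V -> R).
Hypothesis mY : forall k, measurable_fun setT (Y k).
Hypothesis Y_id : identically_distributed P Y.
Hypothesis mgamma : measurable_fun setT gamma.
Hypothesis mK : measurable_fun setT K.
Hypothesis gamma_ge0 : forall y, 0 <= gamma y.
Hypothesis K_ge0 : forall y, 0 <= K y.

Let mKY u : measurable_fun setT (fun w => K (Y u w)).
Proof. exact: (measurableT_comp mK (mY u)). Qed.

Lemma ae_integral_le (f g : T -> R) : measurable_fun setT f -> measurable_fun setT g ->
  (forall w, 0 <= f w) -> (forall w, 0 <= g w) -> {ae P, forall w, f w <= g w} ->
  (\int[P]_w (f w)%:E <= \int[P]_w (g w)%:E)%E.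
Proof.
move=> mf mg f0 g0 fg; apply: ae_ge0_le_integral => //.
- by move=> w _; rewrite lee_fin.
- exact/measurable_EFinP.
- by move=> w _; rewrite lee_fin.
- exact/measurable_EFinP.
- by apply: filterS fg => w fg _; rewrite lee_fin.
Qed.

Lemma ae_decay_le (g : R) : {ae P, forall w, gamma (Y 0 w) <= g} ->
  {ae P, forall w, forall u k, decay Y gamma u k w <= g ^+ k}.
Proof.
move=> h; have mQ : measurable [set y | gamma y <= g].
  exact: measurable_set_le mgamma (measurable_cst g).
apply: filterS (ae_identically mY Y_id mQ h) => w gY u k.
elim: k u => [|k IH] u /=; first by rewrite expr0.
by rewrite exprS; apply: ler_pM => //; [exact: decay_ge0|exact: gY].
Qed.

Lemma integral_decay_geometric (g : R) u k : 0 <= g ->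
  {ae P, forall w, gamma (Y 0 w) <= g} ->
  (\int[P]_w (decay Y gamma u k w)%:E <= (g ^+ k)%:E)%E.
Proof.
move=> g0 /ae_decay_le h.
rewrite -[leRHS]mule1 -(@probability_setT _ _ _ P) -integral_cst//.
apply: (ae_integral_le (g := cst (g ^+ k))) => //.
- exact: measurable_decayT.
- exact: decay_ge0.
- by move=> w; rewrite exprn_ge0.
- by apply: filterS h => w; apply.
Qed.

Lemma integral_K_decay_geometric (g EK : R) u k : 0 <= g ->
  {ae P, forall w, gamma (Y 0 w) <= g} -> (\int[P]_w (K (Y 0 w))%:E <= EK%:E)%E ->
  (\int[P]_w (K (Y u%:Z w) * decay Y gamma u.+1 k w)%:E <= (EK * g ^+ k)%:E)%E.
Proof.
move=> g0 /ae_decay_le h EKb; have gk : 0 <= g ^+ k by rewrite exprn_ge0.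
apply: (@le_trans _ _ (\int[P]_w (g ^+ k * K (Y u w))%:E)%E).
  apply: ae_integral_le.
  - by apply: measurable_funM => //; exact: measurable_decayT.
  - exact: measurable_funM.
  - by move=> w; rewrite mulr_ge0// decay_ge0.
  - by move=> w; rewrite mulr_ge0.
  - by apply: filterS h => w h; rewrite mulrC ler_wpM2r.
rewrite integral_scale// (integral_identically mY Y_id _ 0)// (mulrC EK) EFinM.
by rewrite lee_wpmul2l.
Qed.

(** The bound gamma <= 1 holds almost surely only; truncation gives products in [0,1] everywhere, as
    [covariance_le] requires, and they dominate the original ones almost surely. *)
Let xi y := Num.min (gamma y) 1.

Let mxi : measurable_fun setT xi.
Proof. exact: measurable_minr. Qed.

Let xi01 y : 0 <= xi y <= 1.
Proof. by rewrite /xi le_min gamma_ge0 ler01 ge_min lexx orbT. Qed.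

Let xi_ge0 y : 0 <= xi y.
Proof. by case/andP: (xi01 y). Qed.

Lemma decay_min01 u k w : 0 <= decay Y xi u k w <= 1.
Proof.
elim: k u => [|k IH] u; rewrite /= ?lexx ?ler01//.
have /andP[a0 a1] := IH u.+1; have /andP[b0 b1] := xi01 (Y u w).
by rewrite mulr_ge0//= mulr_ile1.
Qed.

Fixpoint thinned (l q t : nat) (w : T) : R :=
  if q is q'.+1 then xi (Y t%:Z w) * thinned l q' (t + l) w else 1.

Lemma thinned01 l q t w : 0 <= thinned l q t w <= 1.
Proof.
elim: q t => [|q IH] t; rewrite /= ?lexx ?ler01//.
have /andP[a0 a1] := IH (t + l)%N; have /andP[b0 b1] := xi01 (Y t w).
by rewrite mulr_ge0//= mulr_ile1.
Qed.

Lemma measurable_thinned l q t (G : set_system T) :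
  (forall s, (t <= s)%N -> measurable_fun setT (Y s%:Z : sub_sigma G -> V)) ->
  measurable_fun setT (thinned l q t : sub_sigma G -> R).
Proof.
elim: q t => [|q IH] t mG //=; apply: measurable_funM.
  by apply: (measurableT_comp mxi); exact: mG.
by apply: IH => s ts; apply: mG; rewrite (leq_trans _ ts)// leq_addr.
Qed.

(** Every discarded factor is at most 1. *)
Lemma decay_le_thinned l q t v w : (0 < l)%N -> (q * l <= v)%N ->
  decay Y xi t v w <= thinned l q t w.
Proof.
move=> l0; elim: q t v => [|q IH] t v qv /=; first by case/andP: (decay_min01 t v w).
have lv : (l <= v)%N by rewrite (leq_trans _ qv)// mulSn leq_addr.
rewrite -(subnKC lv) decayD; apply: ler_pM.
- by case/andP: (decay_min01 t l w).
- by case/andP: (decay_min01 (t + l) (v - l) w).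
- case: l l0 {IH qv lv} => // l _ /=; rewrite ler_piMr//.
  by case/andP: (decay_min01 t.+1 l w).
- by apply: IH; rewrite leq_subRL// -mulSn.
Qed.

Variable kappa : R.
Hypothesis kappa01 : 0 < kappa < 1.
Hypothesis xi_kappa : (\int[P]_w (xi (Y 0 w))%:E <= kappa%:E)%E.

(* Thinning to one time out of l makes consecutive factors nearly independent. *)
Lemma integral_thinned l q t alpha : 0 <= alpha -> gap_mixing P Y l alpha ->
  (\int[P]_w (thinned l q t w)%:E <= (kappa ^+ q + alpha / (1 - kappa))%:E)%E.
Proof.
move=> a0 mix; have /andP[k0 k1] := kappa01.
have k1' : 0 < 1 - kappa by lra.
have b0 : 0 <= alpha / (1 - kappa) by rewrite divr_ge0// ltW.
elim: q t => [|q IH] t.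
  by rewrite /= integral_cst//= probability_setT mule1 lee_fin expr0 lerDl.
have GM J : generators Y J `<=` measurable by exact: generators_sub_measurable.
apply: (le_trans (covariance_le (U := fun w => xi (Y t%:Z w))
  (V := thinned l q (t + l)) (GM [set k | k <= t%:Z])
  (GM [set k | t%:Z + l%:Z <= k]) _ _ _ _ (mix t%:Z))).
- apply: (measurableT_comp mxi).
  by apply: (measurable_generator (J := [set k | k <= t%:Z])) => /=.
- apply: measurable_thinned => s ts.
  apply: (measurable_generator (J := [set k | t%:Z + l%:Z <= k])) => //=.
- by move=> w; exact: xi01.
- by move=> w; exact: thinned01.
have i0 (f : T -> R) : (forall w, 0 <= f w) -> (0 <= \int[P]_w (f w)%:E)%E.
  by move=> f0; apply: integral_ge0 => w _; rewrite lee_fin.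
apply: (@le_trans _ _ (kappa%:E * (kappa ^+ q + alpha / (1 - kappa))%:E + alpha%:E)%E).
  rewrite leeD2r//; apply: lee_pmul => //.
  - exact: i0.
  - by apply: i0 => w; case/andP: (thinned01 l q (t + l) w).
  - by rewrite (integral_identically mY Y_id _ 0).
rewrite -EFinM -EFinD lee_fin exprS le_eqVlt; apply/orP; left; apply/eqP.
by field; exact: lt0r_neq0.
Qed.

Let ge0_decay u v w : 0 <= decay Y xi u v w.
Proof. by case/andP: (decay_min01 u v w). Qed.

Let mdecay u v : measurable_fun setT (decay Y xi u v).
Proof. exact: measurable_decayT. Qed.

(** Thinning with gap m and q retained factors gives kappa ^ q plus a multiple of m ^ (- a0), and
    [block_rate] with p = 0 balances the two. *)
Lemma decay_rate (a0 C : R) : 0 < a0 -> 0 <= C ->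
  (forall m, (0 < m)%N -> gap_mixing P Y m (C * m%:R `^ (- a0))) ->
  exists2 D : R, 1 <= D & forall u v,
  (\int[P]_w (decay Y xi u v w)%:E <= (D * (log1 R v `^ a0 * v.+1%:R `^ (- a0)))%:E)%E.
Proof.
move=> a00 C0 mix; have /andP[k0 k1] := kappa01.
have k1' : 0 < 1 - kappa by lra.
have c0 : 0 <= C / (1 - kappa) by rewrite divr_ge0// ltW.
have C1 : 0 <= 1 + C / (1 - kappa) by rewrite addr_ge0.
have [D D1 DP] := block_rate kappa01 C1 a00 (lexx 0).
exists D => // u v.
have i1 n : (\int[P]_w (decay Y xi u n w)%:E <= 1)%E.
  by apply: integral_le1 => // w; exact: decay_min01.
have fi n : (\int[P]_w (decay Y xi u n w)%:E)%E \is a fin_num.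
  rewrite ge0_fin_numE ?(le_lt_trans (i1 n)) ?ltry//.
  by apply: integral_ge0 => w _; rewrite lee_fin.
rewrite -[leLHS]fineK// lee_fin -[X in log1 R v `^ X]add0r.
apply: (DP (fun n => fine (\int[P]_w (decay Y xi u n w)%:E)%E)) => [n|m q n m0 q0 qmn].
  by rewrite -lee_fin fineK.
rewrite -lee_fin fineK// powRr0 mul1r.
have am0 : 0 <= C * m%:R `^ (- a0) by rewrite mulr_ge0 ?powR_ge0.
apply: (@le_trans _ _ (\int[P]_w (thinned m q u w)%:E)%E).
  apply: integral_le => //.
    apply: (measurable_fun_subT (@generators_sub_measurable _ _ _ _ Y setT mY)).
    by apply: measurable_thinned => s _; exact: (measurable_generator (J := setT)).
  move=> w; apply: decay_le_thinned => //; apply: leq_trans qmn.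
  by rewrite leq_mul2r leq_pmull// orbT.
apply: (le_trans (integral_thinned q u am0 (mix m m0))); rewrite lee_fin.
have kq : 0 <= kappa ^+ q by rewrite exprn_ge0// ltW.
have mp : 0 <= m%:R `^ (- a0) :> R by exact: powR_ge0.
rewrite -subr_ge0 (_ : _ - _ = m%:R `^ (- a0) + C / (1 - kappa) * kappa ^+ q); last by ring.
by rewrite addr_ge0// mulr_ge0.
Qed.

(* Truncates K at the level M = D ^ (- 1 / k), by z <= M + z ^ k * M ^ (1 - k). *)
Lemma integral_K_decay (k EK D : R) u v : 1 < k -> 0 < D ->
  (\int[P]_w (decay Y xi u.+1 v w)%:E <= D%:E)%E ->
  (\int[P]_w (K (Y 0 w) `^ k)%:E <= EK%:E)%E ->
  (\int[P]_w (K (Y u%:Z w) * decay Y xi u.+1 v w)%:E <=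
   ((1 + EK) * D `^ ((k - 1) / k))%:E)%E.
Proof.
move=> k1 D0 Db EKb.
have k0 : 0 < k by lra.
pose M := D `^ (- k^-1).
have M0 : 0 < M by rewrite powR_gt0.
have MD : M * D = D `^ ((k - 1) / k).
  transitivity (D `^ (- k^-1) * D `^ 1); first by rewrite powRr1// ltW.
  rewrite -powRD; last by rewrite (lt0r_neq0 D0) implybT.
  by congr (_ `^ _); field; exact: lt0r_neq0.
have MkE : M `^ (1 - k) = D `^ ((k - 1) / k).
  by rewrite -powRrM; congr (_ `^ _); field; exact: lt0r_neq0.
have split z : 0 <= z -> z <= M + M `^ (1 - k) * z `^ k.
  move=> z0; have [zM|Mz] := leP z M.
    by rewrite (le_trans zM)// lerDl mulr_ge0 ?powR_ge0.
  have zp : 0 < z by exact: lt_trans Mz.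
  apply: (@le_trans _ _ (z `^ (1 - k) * z `^ k)).
    rewrite -powRD; last by rewrite (lt0r_neq0 zp) implybT.
    by rewrite subrK powRr1.
  rewrite (@le_trans _ _ (M `^ (1 - k) * z `^ k)) ?lerDr ?(ltW M0)//.
  by rewrite ler_wpM2r ?powR_ge0// -opprB; apply: ler_powRN; lra.
have mKk : measurable_fun setT (fun y => K y `^ k) by exact: measurableT_comp (measurable_powR k) mK.
have mKkY t : measurable_fun setT (fun w => K (Y t w) `^ k).
  exact: (measurableT_comp mKk (mY t)).
have md := mdecay u.+1 v.
apply: (@le_trans _ _ (\int[P]_w (M * decay Y xi u.+1 v w)%:E +
    \int[P]_w (M `^ (1 - k) * K (Y u%:Z w) `^ k)%:E)%E).
  apply: integral_leD; try exact: measurable_funM.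
  - by move=> w; rewrite mulr_ge0.
  - by move=> w; rewrite mulr_ge0// ltW.
  - by move=> w; rewrite mulr_ge0 ?powR_ge0.
  move=> w; have /andP[d0 d1] := decay_min01 u.+1 v w.
  apply: (le_trans (ler_wpM2r d0 (split _ (K_ge0 (Y u w))))).
  by rewrite mulrDl lerD2l ler_piMr// mulr_ge0 ?powR_ge0.
rewrite integral_scale//; last exact: ltW.
rewrite integral_scale ?powR_ge0//; last by move=> w; exact: powR_ge0.
rewrite (@integral_identically _ _ _ P _ _ _ mY Y_id (fun y => K y `^ k) u 0)//; last first.
  by move=> y; exact: powR_ge0.
rewrite MkE (_ : (1 + EK) * _ = M * D + D `^ ((k - 1) / k) * EK); last first.
  by rewrite MD; ring.
rewrite EFinD !EFinM; apply: leeD.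
  by apply: lee_wpmul2l => //; rewrite lee_fin ltW.
by apply: lee_wpmul2l => //; rewrite lee_fin powR_ge0.
Qed.

Hypothesis gamma_le1 : {ae P, forall w, gamma (Y 0 w) <= 1}.

Lemma ae_decay_min : {ae P, forall w, forall u v, decay Y gamma u v w <= decay Y xi u v w}.
Proof.
have mQ : measurable [set y | gamma y <= 1].
  exact: measurable_set_le mgamma (measurable_cst (1 : R)).
apply: filterS (ae_identically mY Y_id mQ gamma_le1) => w gY u v.
elim: v u => [|v IH] u //=; apply: ler_pM => //; first exact: decay_ge0.
by rewrite /xi le_min lexx; exact: gY.
Qed.

Lemma integral_decay_min u v :
  (\int[P]_w (decay Y gamma u v w)%:E <= \int[P]_w (decay Y xi u v w)%:E)%E.
Proof.
apply: ae_integral_le => //; first exact: measurable_decayT.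
  exact: decay_ge0.
by apply: filterS ae_decay_min => w; apply.
Qed.

Lemma integral_K_decay_min t u v :
  (\int[P]_w (K (Y t w) * decay Y gamma u v w)%:E <=
   \int[P]_w (K (Y t w) * decay Y xi u v w)%:E)%E.
Proof.
apply: ae_integral_le.
- by apply: measurable_funM => //; exact: measurable_decayT.
- exact: measurable_funM.
- by move=> w; rewrite mulr_ge0// decay_ge0.
- by move=> w; rewrite mulr_ge0.
- by apply: filterS ae_decay_min => w h; rewrite ler_wpM2l.
Qed.

End decay_bounds.

Lemma integral_min_lt1 disp (T : measurableType disp) (R : realType)
    (P : probability T R) (g : T -> R) : measurable_fun setT g ->
  (forall w, 0 <= g w) -> (0 < P [set w | (g w < 1)%R])%E ->
  exists2 kappa : R, 0 < kappa < 1 &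
    (\int[P]_w (Num.min (g w) 1)%:E <= kappa%:E)%E.
Proof.
move=> mg g0 Pg; pose h w := 1 - Num.min (g w) 1.
have mm : measurable_fun setT (fun w => Num.min (g w) 1) by exact: measurable_minr.
have m0 w : 0 <= Num.min (g w) 1 by rewrite le_min g0 ler01.
have m1 w : Num.min (g w) 1 <= 1 by rewrite ge_min lexx orbT.
have h0 w : 0 <= h w by rewrite subr_ge0.
have mh : measurable_fun setT h by exact: measurable_funB.
have hle : (\int[P]_w (h w)%:E <= 1)%E.
  by apply: integral_le1 => // w; rewrite h0/= gerBl.
have i0 (f : T -> R) : (forall w, 0 <= f w) -> (0 <= \int[P]_w (f w)%:E)%E.
  by move=> f0; apply: integral_ge0 => w _; rewrite lee_fin.
have e1 : (\int[P]_w (Num.min (g w) 1)%:E + \int[P]_w (h w)%:E = 1)%E.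
  rewrite -(@integral_eqD _ _ _ P (cst 1))//.
    by rewrite -[RHS](@probability_setT _ _ _ P) -[RHS]mul1e -integral_cst.
  by move=> w; rewrite /h addrC subrK.
have hpos : (0 < \int[P]_w (h w)%:E)%E.
  rewrite lt_neqAle i0// andbT; apply/negP => /eqP hz.
  have mhE : measurable_fun setT (EFin \o h) by exact/measurable_EFinP.
  have /(ae_eq_integral_abs P measurableT mhE) hae :
      (\int[P]_w `|(EFin \o h) w|)%E = 0%E.
    rewrite [RHS]hz; by apply: eq_integral => w _ /=; rewrite ger0_norm.
  have mA : measurable [set w | g w < 1] by exact: measurable_set_lt mg (measurable_cst (1 : R)).
  suff PA0 : P [set w | (g w < 1)%R] = 0%E by rewrite PA0 ltxx in Pg.
  apply: measure_negligible => //; apply: negligibleS hae => w /= gw hw.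
  have := hw I; rewrite /h /= => -[]; rewrite min_l ?ltW//; lra.
have hf : (\int[P]_w (h w)%:E)%E \is a fin_num.
  by rewrite ge0_fin_numE ?i0// (le_lt_trans hle) ?ltry.
set d := (\int[P]_w (h w)%:E)%E in e1 hle hpos hf *.
have dE : d = (fine d)%:E by rewrite fineK.
have d0 : 0 < fine d by rewrite -lte_fin fineK.
have d1 : fine d <= 1 by rewrite -lee_fin fineK.
(* Half of the mass d is given up so that kappa stays positive when d = 1. *)
exists (1 - fine d / 2); first by apply/andP; split; lra.
have -> : (\int[P]_w (Num.min (g w) 1)%:E = 1 - d)%E by rewrite -e1 addeK.
by rewrite dE -EFinB lee_fin; lra.
Qed.

(** * Reduction of the theorem to the moment bounds *)

Section reduction.
Context (R : realType).

Lemma sum_geometric_tail (g : R) m M : 0 < g < 1 ->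
  \sum_(m <= l < M) g ^+ l <= g ^+ m / (1 - g).
Proof.
move=> /andP[g0 g1]; have g1' : 0 < 1 - g by lra.
have gn n : 0 <= g ^+ n by rewrite exprn_ge0// ltW.
rewrite ler_pdivlMr// mulr_suml.
have [mM|Mm] := leqP m M; last by rewrite big_geq// ltnW.
rewrite (eq_bigr (fun l => - g ^+ l.+1 - - g ^+ l)); last first.
  by move=> l _; rewrite exprSr; ring.
by rewrite telescope_sumr// opprK gerDr oppr_le0.
Qed.

Lemma stationary_identically disp (T : measurableType disp) (P : probability T R)
    dV (V : measurableType dV) (W : int -> T -> V) :
  stationary P W -> identically_distributed P W.
Proof.
move=> st s t A mA.
pose B := [set v : 1.-tuple V | A (tnth v ord0)].
have mB : measurable B.
  have mt : measurable_fun setT (fun v : 1.-tuple V => tnth v ord0).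
    exact: measurable_tnth.
  by have := mt measurableT _ mA; rewrite setTI.
have := st 1%N (fun=> t) (s - t) B mB.
rewrite (_ : [set w | _] = W s @^-1` A); last first.
  by apply/seteqP; split => w; rewrite /B /= tnth_mktuple addrC subrK.
rewrite (_ : [set w | _] = W t @^-1` A)//.
by apply/seteqP; split => w; rewrite /B /= tnth_mktuple.
Qed.

(** Integrates |u| <= (1 + u ^ 2) / 2. *)
Lemma integral_abs_le1 disp (T : measurableType disp) (P : probability T R)
    (f : T -> R) : measurable_fun setT f ->
  (\int[P]_w (f w ^+ 2)%:E = 1)%E -> (\int[P]_w `|f w|%:E <= 1)%E.
Proof.
move=> mf f2.
have mf2 : measurable_fun setT (fun w => f w ^+ 2) by exact: measurable_funX.
apply: (@le_trans _ _ (\int[P]_w (cst 2^-1 w)%:E + \int[P]_w (2^-1 * f w ^+ 2)%:E)%E).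
  apply: integral_leD => //.
  - exact: measurableT_comp.
  - exact: measurable_funM.
  - by move=> w; rewrite /= invr_ge0.
  - by move=> w; rewrite mulr_ge0 ?sqr_ge0.
  - move=> w; have := sqr_ge0 (`|f w| - 1); rewrite sqrrB real_normK ?num_real//=; lra.
rewrite integral_scale ?f2//; last by move=> w; exact: sqr_ge0.
have -> : (\int[P]_w (cst (2^-1 : R) w)%:E = (2^-1)%:E)%E.
  by rewrite -[RHS]mule1 -(@probability_setT _ _ _ P) -integral_cst.
by rewrite mule1 -EFinD lee_fin; lra.
Qed.

Section gap.
Context disp (T : measurableType disp) (P : probability T R).
Context dV (V : measurableType dV).
Variable Y : int -> T -> V.
Hypothesis mY : forall k, measurable_fun setT (Y k).

Lemma gap_mixing_alpha m : gap_mixing P Y m (alpha_process P setT Y m).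
Proof.
move=> t A B sA sB; apply: (@le_alpha_process _ _ _ _ _ _ setT Y _ m t) => //.
  by apply: sub_smallest2r sA; [exact: smallest_sigma_algebra|exact: generatorsS].
by apply: sub_smallest2r sB; [exact: smallest_sigma_algebra|exact: generatorsS].
Qed.

(** The asymptotic bound holds from some N on; below N the trivial bound 1 is at most N ^ a0 m ^ (-
    a0). *)
Lemma gap_mixing_rate (a0 : R) : 0 < a0 ->
  alpha_process P setT Y =O_\oo (fun m : nat => m%:R `^ (- a0)) ->
  exists2 C : R, 0 <= C & forall m, (0 < m)%N -> gap_mixing P Y m (C * m%:R `^ (- a0)).
Proof.
move=> a00 /eqO_exP[k k0 [N _ kN]].
exists (k + N%:R `^ a0); first by rewrite addr_ge0 ?powR_ge0// ltW.
move=> m m0 t A B sA sB.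
have M0 : 0 < m%:R :> R by rewrite ltr0n.
apply: (le_trans (@gap_mixing_alpha m t A B sA sB)).
rewrite leeD2l// lee_fin mulrDl.
have kp : 0 <= k * m%:R `^ (- a0) by rewrite mulr_ge0 ?powR_ge0// ltW.
have Np : 0 <= N%:R `^ a0 * m%:R `^ (- a0) :> R by rewrite mulr_ge0 ?powR_ge0.
have [Nm|mN] := leqP N m.
  have := kN m Nm; rewrite /= ger0_norm ?alpha_process_ge0// ger0_norm ?powR_ge0//.
  lra.
have a1 : alpha_process P setT Y m <= 1 by exact: alpha_process_le1.
apply: (le_trans a1); apply: (@le_trans _ _ (N%:R `^ a0 * m%:R `^ (- a0))); last lra.
rewrite powRN ler_pdivlMr ?powR_gt0// mul1r.
by rewrite ler_powRl ?(ltW M0) ?(ltW a00)// ler_nat ltnW.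
Qed.

End gap.

(** Since b <= a0, the coefficient of Y is absorbed into the moment error, and m + q (2 m + 1) <= 4
    q m for positive m and q, which brings the bound to the form of [block_rate]. *)
Lemma mixing_rate (f : nat -> R) (kappa C Ca H a0 b p : R) :
  0 < kappa < 1 -> 0 <= C -> 0 <= Ca -> 0 <= H -> 0 < b -> b <= a0 -> 0 <= p ->
  (forall n, 0 <= f n) -> (forall n, f n <= 1) ->
  (forall m q n, (0 < m)%N -> (m + q * (m + m.+1) <= n)%N ->
    f n <= C * (kappa ^+ q + Ca * m%:R `^ (- a0) +
      H * (log1 R m `^ p * m%:R `^ (- b)))) ->
  f n @[n --> \oo] --> (0 : R) /\
  f =O_\oo (fun n : nat => ln n%:R `^ (p + b) * n%:R `^ (- b)).
Proof.
move=> k01 C0 Ca0 H0 b0 ba p0 f0 f1 fC; have /andP[k0 k1] := k01.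
have C1 : 0 <= C * (1 + Ca + H) by rewrite mulr_ge0 ?addr_ge0.
have [C' C'1 fC'] := block_rate k01 C1 b0 p0.
have C'0 : 0 <= C' by lra.
have pb0 : 0 <= p + b by rewrite addr_ge0// ltW.
suff h n : f n <= C' * (log1 R n `^ (p + b) * n.+1%:R `^ (- b)).
  by split; [exact: log1_rate_cvg0 h|exact: log1_rate_bigO h].
apply: fC' => // {}n0 q {}n m0 q0 qmn; move: n0 m0 qmn => m m0 qmn.
have mq : (m + q * (m + m.+1) <= n)%N.
  apply: leq_trans qmn.
  have h1 : (m <= q * m)%N by rewrite leq_pmull.
  have h2 : (q <= q * m)%N by rewrite leq_pmulr.
  rewrite mulnDr mulnS -mulnA -[4%N]/(1 + 1 + 1 + 1)%N !mulnDl !mul1n.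
  by rewrite -!addnA leq_add// addnCA leq_add// addnC leq_add// addnC.
apply: (le_trans (fC m q n m0 mq)); rewrite -[leRHS]mulrA ler_wpM2l//.
set w := _ `^ p * _; set k := kappa ^+ q.
have kq : 0 <= k by rewrite exprn_ge0// ltW.
have M1 : 1 <= m%:R :> R by rewrite ler1n.
have w0 : 0 <= w by rewrite mulr_ge0 ?powR_ge0.
have mw : m%:R `^ (- a0) <= w.
  apply: (@le_trans _ _ (m%:R `^ (- b))); first by rewrite ler_powR// lerN2.
  by rewrite ler_peMl ?powR_ge0// powR_ge1// log1_ge1.
have Cm : Ca * m%:R `^ (- a0) <= Ca * w by rewrite ler_wpM2l.
have h1 : 0 <= Ca * k by rewrite mulr_ge0.
have h2 : 0 <= H * k by rewrite mulr_ge0.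
by rewrite !mulrDl !mulrDr !mul1r; lra.
Qed.

End reduction.

Theorem proposition3p1
  (R : realType) (disp : measure_display) (T : measurableType disp)
  (P : probability T R) (dim : nat)
  (Y : int -> {RV P >-> dim.-tuple R}) (eps : int -> {RV P >-> R})
  (x : R) (X : int -> T -> R)
  (r sigma : dim.-tuple R * R -> R) (a b c d : dim.-tuple R -> R) (a0 : R)
  (Y_stationary : stationary P (fun t => Y t : T -> dim.-tuple R))
  (eps_iid : iid P (fun t => eps t : T -> R))
  (eps_Y_indep : independent_systems P
    (sigma_process setT (fun t => eps t : T -> R) `]-oo, +oo[)
    (sigma_process setT (fun t => Y t : T -> dim.-tuple R) `]-oo, +oo[))
  (eps_mean : ('E_P[eps 0%R] = 0)%E)
  (eps_var : ('E_P[fun w => (eps 0%R w ^+ 2)%R] = 1)%E)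
  (X_init : forall w, X 0 w = x)
  (X_rec : forall (t : int) w, 1 <= t ->
    X t w = r (Y (t - 1) w, X (t - 1) w)
            + eps t w * sigma (Y (t - 1) w, X (t - 1) w))
  (r_meas : measurable_fun setT r)
  (sigma_meas : measurable_fun setT sigma)
  (sigma_ge0 : forall z, 0 <= sigma z)
  (a_meas : measurable_fun setT a) (a_ge0 : forall y, 0 <= a y)
  (b_meas : measurable_fun setT b) (b_ge0 : forall y, 0 <= b y)
  (c_meas : measurable_fun setT c) (c_ge0 : forall y, 0 <= c y)
  (d_meas : measurable_fun setT d) (d_ge0 : forall y, 0 <= d y)
  (r_growth : forall y u, `|r (y, u)| <= a y * `|u| + b y)
  (sigma_growth : forall y u, `|sigma (y, u)| <= c y * `|u| + d y)
  (a0_gt0 : 0 < a0)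
  (alphaY : alpha_process P setT (fun t => Y t : T -> dim.-tuple R)
    =O_\oo (fun m : nat => m%:R `^ (- a0)))
  (eps_density : exists2 f : R -> R, has_density (eps 0) f &
    forall u v : R, exists2 e : R, 0 < e & forall s, s \in `[u, v] -> e <= f s)
  (sigma_inf : forall (rho : R) (y : dim.-tuple R), 0 < rho ->
    0 < inf [set sigma (y, u) | u in [set u : R | `|u| <= rho]]) :
  let gamma := fun y => a y + c y in
  let K := fun y => b y + d y in
  let I := [set t : int | 0 <= t] in
  let XY := fun (t : int) (w : T) => (X t w, Y t w : dim.-tuple R) in
  (forall gamma_plus : R, 0 < gamma_plus < 1 ->
     {ae P, forall w, gamma (Y 0 w) <= gamma_plus} ->
     ('E_P[fun w => K (Y 0%R w)] < +oo)%E ->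
     alpha_mixing P I XY /\
     alpha_process P I XY
       =O_\oo (fun m : nat => (ln m%:R) `^ a0 * m%:R `^ (- a0))) /\
  (forall k : R,
     {ae P, forall w, 0 <= gamma (Y 0 w) <= 1} ->
     (0 < P [set w | (gamma (Y 0%R w) < 1)%R])%E ->
     1 < k ->
     ('E_P[fun w => (K (Y 0%R w) `^ k)%R] < +oo)%E ->
     let b0 := a0 * (k - 1) / k in
     1 < b0 ->
     alpha_mixing P I XY /\
     alpha_process P I XY
       =O_\oo (fun m : nat =>
         (ln m%:R) `^ (2 * b0 - 1) * m%:R `^ (- b0 + 1))).
Proof.
move=> gamma K I XY.
pose Yf (t : int) : T -> dim.-tuple R := Y t.
pose ef (t : int) : T -> R := eps t.
have mY k : measurable_fun setT (Yf k) by [].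
have Y_id : identically_distributed P Yf by exact: stationary_identically.
have gamma_ge0 y : 0 <= gamma y by rewrite addr_ge0.
have K_ge0 y : 0 <= K y by rewrite addr_ge0.
have mgamma : measurable_fun setT gamma by exact: measurable_funD.
have mK : measurable_fun setT K by exact: measurable_funD.
have growth y u : `|r (y, u)| + sigma (y, u) <= gamma y * `|u| + K y.
  have := r_growth y u; have := sigma_growth y u.
  by rewrite ger0_norm// /gamma /K mulrDl; lra.
have eps_abs k : (\int[P]_w `|eps k w|%:E <= 1%:E)%E.
  rewrite (integral_identically (Y := ef) _ eps_iid.2 (f := fun z => `|z|) k 0)//.
  apply: integral_abs_le1 => //.
  by rewrite -eps_var unlock.
have indep : independent_systems P <<s generators ef setT >> <<s generators Yf setT >>.
  have setTE : [set k : int | setT k /\ k \in `]-oo, +oo[] = setT.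
    by apply/seteqP; split => k.
  by have := eps_Y_indep; rewrite /sigma_process setTE.
have X_chain n : X n%:Z = chain Yf ef r sigma 0 n (cst x).
  elim: n => [|n IH]; first by apply/funext => w; rewrite X_init.
  apply/funext => w; rewrite -[in RHS]addn1 chainD -IH X_rec// /= /next /=.
  by rewrite -[n.+1%:Z]/(n.+1%N%:Z) -addn1 PoszD addrK add0n.
have mXY := measurable_process mY r_meas sigma_meas X_chain.
have [Ca Ca0 mixY] := gap_mixing_rate mY a0_gt0 alphaY.
(* Both parts reduce to decay rates for D and for the tails of D': the first has p = 0 and b' = a0,
   the second p = b0 and b' = b0 - 1, hence s = 2 b0 - 1. *)
have conclude (D D' : nat -> R) (S H b' p s t : R) : p + b' = s -> - b' = t -> 0 < b' -> b' <= a0 -> 0 <= p -> 0 <= H ->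
    (forall u k, (\int[P]_w (decay Yf gamma u k w)%:E <= (D k)%:E)%E) ->
    (forall u k, (\int[P]_w (K (Yf u%:Z w) * decay Yf gamma u.+1 k w)%:E <= (D' k)%:E)%E) ->
    (forall M, \sum_(0 <= l < M) D' l <= S) ->
    (forall m l, (0 < m)%N -> (m <= l)%N -> D l <= H * (log1 R m `^ p * m%:R `^ (- b'))) ->
    (forall m M, (0 < m)%N ->
      \sum_(m <= l < M) D' l <= H * (log1 R m `^ p * m%:R `^ (- b'))) ->
    alpha_mixing P I XY /\ alpha_process P I XY
      =O_\oo (fun n : nat => ln n%:R `^ s * n%:R `^ t).
  move=> <- <- b'0 ba p0 H0 decayP driftP D'S DH D'H.
  have [kappa [C [k0 k1 C0 bound]]] := alpha_process_bound mY r_meas sigma_meas mgamma mK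
    gamma_ge0 K_ge0 sigma_ge0 growth Y_id eps_iid indep eps_abs eps_density sigma_inf
    X_chain decayP driftP D'S.
  apply: (@mixing_rate _ _ kappa C Ca H a0) => //; first by rewrite k0.
  - by move=> n; exact: alpha_process_ge0.
  - by move=> n; exact: alpha_process_le1.
  move=> m q n m0 mqn; apply: bound mqn _ _ (mixY m m0) _ _.
  - by rewrite mulr_ge0 ?powR_ge0.
  - by rewrite !mulr_ge0 ?powR_ge0.
  - by move=> l; exact: DH.
  - by move=> M; exact: D'H.
split.
  move=> g g01 gamma_g EKfin; have /andP[g0 g1] := g01.
  have [Cg Cg0 gr] := geometric_rate g01 a0_gt0.
  pose EK := fine (\int[P]_w (K (Yf 0 w))%:E)%E.
  have EK0 : 0 <= EK.
    by rewrite fine_ge0// integral_ge0// => w _; rewrite lee_fin.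
  have EKE : (\int[P]_w (K (Yf 0 w))%:E)%E = EK%:E.
    rewrite fineK// ge0_fin_numE; first by move: EKfin; rewrite unlock.
    by apply: integral_ge0 => w _; rewrite lee_fin.
  have EKle : (\int[P]_w (K (Yf 0 w))%:E <= EK%:E)%E by rewrite EKE.
  have gE : 0 <= EK / (1 - g) by rewrite divr_ge0// subr_ge0 ltW.
  have tail m M : \sum_(m <= l < M) EK * g ^+ l <= g ^+ m * (EK / (1 - g)).
    rewrite -mulr_sumr (mulrCA _ EK) ler_wpM2l//; exact: sum_geometric_tail.
  have rateg m : (0 < m)%N ->
      g ^+ m <= Cg * (log1 R m `^ 0 * m%:R `^ (- a0)).
    by move=> m0; rewrite powRr0 mul1r gr.
  apply: (@conclude (fun k => g ^+ k) (fun k => EK * g ^+ k) (g ^+ 0 * (EK / (1 - g)))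
    (Cg * (1 + EK / (1 - g))) a0 0) => //; first by rewrite add0r.
  - by rewrite mulr_ge0// addr_ge0.
  - by move=> u k; exact: integral_decay_geometric (ltW g0) gamma_g.
  - by move=> u k; exact: integral_K_decay_geometric (ltW g0) gamma_g EKle.
  - move=> m l m0 ml; apply: (@le_trans _ _ (g ^+ m)).
      by rewrite ler_wiXn2l// ltW.
    apply: (le_trans (rateg m m0)); rewrite ler_wpM2r ?mulr_ge0 ?powR_ge0//.
    by rewrite mulrDr mulr1 lerDl mulr_ge0.
  - move=> m M m0; apply: (le_trans (tail m M)).
    apply: (le_trans (ler_wpM2r gE (rateg m m0))).
    rewrite mulrAC ler_wpM2r ?mulr_ge0 ?powR_ge0//.
    by rewrite mulrDr mulr1 lerDr.
move=> k gamma_1 gamma_lt1 k1 EKfin b0 b01.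
have k0 : 0 < k by lra.
have gamma_le1 : {ae P, forall w, gamma (Yf 0 w) <= 1}.
  by apply: filterS gamma_1 => w /andP[].
have mgY : measurable_fun setT (fun w => gamma (Yf 0 w)) by exact: measurableT_comp mgamma (mY 0).
have [kappa kappa01 xi_kappa] := integral_min_lt1 mgY (fun w => gamma_ge0 (Yf 0 w)) gamma_lt1.
have [CD CD1 decayP] := decay_rate mY Y_id mgamma gamma_ge0 kappa01 xi_kappa a0_gt0 Ca0 mixY.
have CD0 : 0 < CD by lra.
pose EK := fine (\int[P]_w (K (Yf 0 w) `^ k)%:E)%E.
have EK0 : 0 <= EK.
  by rewrite fine_ge0// integral_ge0// => w _; rewrite lee_fin powR_ge0.
have EKle : (\int[P]_w (K (Yf 0 w) `^ k)%:E <= EK%:E)%E.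
  rewrite fineK// ge0_fin_numE; first by move: EKfin; rewrite unlock.
  by apply: integral_ge0 => w _; rewrite lee_fin powR_ge0.
(* The power lost by truncating K in [integral_K_decay]; it turns the exponent a0 into b0. *)
pose theta := (k - 1) / k.
have b0E : b0 = a0 * theta by rewrite /b0 mulrA.
have theta0 : 0 <= theta by rewrite divr_ge0//; lra.
have theta1 : theta <= 1 by rewrite ler_pdivrMr//; lra.
have b0a : b0 <= a0 by rewrite b0E ler_piMr// ltW.
pose D2 (s : R) (v : nat) := log1 R v `^ s * v.+1%:R `^ (- s).
have D2_ge0 s v : 0 <= D2 s v by rewrite mulr_ge0 ?powR_ge0.
have l0 v : 0 <= log1 R v by rewrite (le_trans _ (log1_ge1 R v)).
(* As powers of one ratio in (0,1], the D2 s v decrease in s, and the power theta of D2 a0 v is D2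
   b0 v. *)
have D2E s v : D2 s v = (log1 R v / v.+1%:R) `^ s.
  by rewrite powRM ?invr_ge0// -(@powR_inv1 _ v.+1%:R)// -powRrM mulN1r.
have ratio v : 0 < log1 R v / v.+1%:R <= 1.
  rewrite divr_gt0 ?(lt_le_trans _ (log1_ge1 R v))//= ler_pdivrMr// mul1r.
  by have := @ln_le_subr1 R v.+1%:R (ltr0Sn _ _); rewrite /log1; lra.
pose C2 := (1 + EK) * CD `^ theta.
have C20 : 0 <= C2 by rewrite mulr_ge0 ?powR_ge0// addr_ge0.
have [CT CT0 tail] := sum_log1_tail b01.
have tail' m M : (0 < m)%N ->
    \sum_(m <= l < M) D2 b0 l <= CT * (log1 R m `^ b0 * m%:R `^ (- (b0 - 1))).
  move=> m0; apply: (le_trans (tail m M)); rewrite ler_wpM2l// ler_wpM2l ?powR_ge0//.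
  by apply: ler_powRN; rewrite ?ltr0n ?ler_nat//; lra.
apply: (@conclude (fun v => CD * D2 a0 v) (fun v => C2 * D2 b0 v)
  (C2 * (CT * (log1 R 0 `^ b0 * 1%:R `^ (- (b0 - 1))))) ((CD + C2) * CT) (b0 - 1) b0).
- by ring.
- by ring.
- lra.
- lra.
- lra.
- by rewrite mulr_ge0// addr_ge0// ltW.
- move=> u v; apply: (le_trans (integral_decay_min mY Y_id mgamma gamma_ge0 gamma_le1 u v)).
  exact: decayP.
- move=> u v.
  apply: (le_trans (integral_K_decay_min mY Y_id mgamma mK gamma_ge0 K_ge0 gamma_le1 u u.+1 v)).
  have D20 : 0 < CD * D2 a0 v.
    by rewrite mulr_gt0// D2E powR_gt0//; case/andP: (ratio v).
  apply: (le_trans (integral_K_decay mY Y_id mgamma mK gamma_ge0 K_ge0 k1 D20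
    (decayP u.+1 v) EKle)).
  rewrite lee_fin -/theta powRM ?(ltW CD0)// D2E -powRrM -b0E -D2E.
  by rewrite /C2 mulrA.
- by move=> M; rewrite -mulr_sumr ler_wpM2l//; exact: tail.
- move=> m l m0 ml.
  (* The products decay faster than D2 b0, a single term of the tail sum, so the bound on the tail
     of D' serves for D as well. *)
  have h : D2 a0 l <= \sum_(m <= i < l.+1) D2 b0 i.
    rewrite big_nat_recr//=; apply: (@le_trans _ _ (D2 b0 l)).
      by rewrite !D2E ger_powR.
    by rewrite lerDr sumr_ge0.
  have h2 := le_trans h (tail' m l.+1 m0).
  apply: (le_trans (ler_wpM2l (ltW CD0) h2)).
  set W := log1 R m `^ b0 * _.
  have W0 : 0 <= W by rewrite mulr_ge0 ?powR_ge0.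
  by rewrite -[leRHS]mulrA mulrDl lerDl (mulr_ge0 C20 (mulr_ge0 CT0 W0)).
move=> m M m0; rewrite -mulr_sumr; apply: (le_trans (ler_wpM2l C20 (tail' m M m0))).
set W := log1 R m `^ b0 * _.
have W0 : 0 <= W by rewrite mulr_ge0 ?powR_ge0.
by rewrite -[leRHS]mulrA mulrDl lerDr (mulr_ge0 (ltW CD0) (mulr_ge0 CT0 W0)).
Qed.
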